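(* (1) Let $r:[0,\pi/2]\to(0,+\infty)$ be a $C^2$ function satisfying $$r(\theta)r''(\theta)<2r'(\theta)^2+r(\theta)^2\quad\text{for a.e. }\theta\in[0,\pi/2],\tag{a}$$ $$r(0)=1,\qquad r(\pi/2)=r^*,\qquad r'(0)=r'(\pi/2)=0,\tag{b}$$ for some $r^*\ge1$. Consider the $\pi$-periodic function $\widetilde r:\mathbb{R}\to(0,+\infty)$ defined on $[0,\pi]$ by $$\widetilde r(\theta):=\begin{cases} r(\theta)&\text{if }0\le\theta\le\frac{\pi}{2},\\[4pt] \dfrac{r^*\sqrt{r(\tau^{-1}(\theta))^2+r'(\tau^{-1}(\theta))^2}}{r(\tau^{-1}(\theta))^2}&\text{if }\frac{\pi}{2}\le\theta\le\pi,\end{cases}\tag{c}$$ where $\tau:[0,\pi/2]\to[\pi/2,\pi]$ is the bijective map given by $$\tau(\eta)=\frac{\pi}{2}+\eta-\arctan\frac{r'(\eta)}{r(\eta)}.$$ Then $\widetilde r$ is of class $C^1(\mathbb{R})$, the set $$\{(\rho\cos\theta,\rho\sin\theta):\rho\in[0,\widetilde r(\theta)),\ \theta\in[0,2\pi]\}\tag{d}$$ is strictly convex, and the function $$\widetilde H(\rho\cos\theta,\rho\sin\theta):=\frac{\rho}{\widetilde r(\theta)},\qquad \rho\ge0,\ \theta\in[0,2\pi],$$ satisfies the sign condition (S) stated in the context. (2) Up to a rotation and a homothety of the plane $\mathbb{R}^2$, any even positive $1$-homogeneous function $H\in C^2(\mathbb{R}^2\setminus\{0\})$ with $H>0$ on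 $\mathbb{R}^2\setminus\{0\}$, having strictly convex unit ball $B_1^H$ and satisfying (S), is such that $B_1^H$ is of the form (d), with $\widetilde r$ given by (c), for some positive $r\in C^2([0,\pi/2])$ satisfying (a) and (b) for some $r^*\ge1$. (3) Let $\alpha\in(0,1]$ and let $H\in C^{3,\alpha}_{\rm loc}(\mathbb{R}^2\setminus\{0\})$ be an even positive $1$-homogeneous function with $H>0$ on $\mathbb{R}^2\setminus\{0\}$. Then $H$ is uniformly elliptic and satisfies (S) if and only if, up to a rotation and a homothety of $\mathbb{R}^2$, its unit ball $B_1^H$ is of the form (d), with $\widetilde r$ given by (c), for some positive $r\in C^{3,\alpha}([0,\pi/2])$ which satisfies (b) for some $r^*\ge 1$, satisfies the inequality $r(\theta)r''(\theta)<2r'(\theta)^2+r(\theta)^2$ at every $\theta\in[0,\pi/2]$, and satisfies $$r''\Big(\frac{\pi}{2}\Big)=-\frac{r^*r''(0)}{1-r''(0)},\qquad r'''\Big(\frac{\pi}{2}\Big)=-\frac{r^*r'''(0)}{(1-r''(0))^3}.$$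
   Context: A function $H:\mathbb{R}^2\setminus\{0\}\to(0,+\infty)$ is positive $1$-homogeneous if $H(t\xi)=tH(\xi)$ for $t>0$; it is extended by $H(0):=0$. Its unit ball is $B_1^H:=\{\xi\in\mathbb{R}^2:H(\xi)<1\}$ and its dual function is $H^*(x):=\sup_{\xi\in S^1}\frac{\langle x,\xi\rangle}{H(\xi)}$ (which is $C^1$ away from the origin when $B_1^H$ is strictly convex). Condition (S) for $H$: for any $\xi,x\in\mathbb{R}^2$, $$\operatorname{sgn}\langle H(\xi)\nabla H(\xi),H^*(x)\nabla H^*(x)\rangle=\operatorname{sgn}\langle\xi,x\rangle,$$ where $\operatorname{sgn}(0)=0$ and the fields $H\nabla H$, $H^*\nabla H^*$ are extended (continuously) by $0$ at the origin. $H$ is uniformly elliptic if $B_1^H$ is uniformly convex, i.e. the curvature of $\partial B_1^H$ is bounded away from zero; equivalently, there is $\lambda>0$ such that $H_{ij}(\xi)\zeta_i\zeta_j\ge\lambda|\zeta|^2$ (sum over repeated indices) for any $\xi\in\partial B_1^H$ and $\zeta\in\nabla H(\xi)^\perp$. *)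

(* Defs.v *)
From Stdlib Require Import Reals.
From Coquelicot Require Import Coquelicot.
Open Scope R_scope.

(** ** Calculus on a subset of the line *)

(* [D_in] is the derivative relative to [D]: one-sided at the endpoints of an
   interval, and independent of the values of [f] outside [D]. *)
Definition is_derive_in (D : R -> Prop) (f : R -> R) (x l : R) : Prop :=
  D_in f (fun _ => l) D x.

Definition Derive_in (D : R -> Prop) (f : R -> R) (x : R) : R :=
  iota (is_derive_in D f x).

Fixpoint Derive_n_in (D : R -> Prop) (n : nat) (f : R -> R) : R -> R :=
  match n with
  | O => f
  | S m => Derive_in D (Derive_n_in D m f)
  end.

Definition C_n_in (D : R -> Prop) (n : nat) (f : R -> R) : Prop :=
  (forall (k : nat) (x : R), (k < n)%nat -> D x ->
     exists l : R, is_derive_in D (Derive_n_in D k f) x l) /\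
  (forall x : R, D x -> continue_in (Derive_n_in D n f) D x).

(* The case x = y is excluded because [Rpower 0 alpha] is not 0. *)
Definition holder_in (D : R -> Prop) (alpha : R) (f : R -> R) : Prop :=
  exists C : R, forall x y : R, D x -> D y -> x <> y ->
    Rabs (f x - f y) <= C * Rpower (Rabs (x - y)) alpha.

Definition C_n_alpha_in (D : R -> Prop) (n : nat) (alpha : R) (f : R -> R)
  : Prop :=
  C_n_in D n f /\ holder_in D alpha (Derive_n_in D n f).

Definition class_C1 (f : R -> R) : Prop :=
  forall x : R, ex_derive f x /\ continuous (Derive f) x.

(* Lebesgue-null: outer measure zero. *)
Definition null_set (A : R -> Prop) : Prop :=
  forall eps : R, 0 < eps ->
    exists a b : nat -> R,
      (forall n, a n <= b n) /\
      (forall x, A x -> exists n, a n < x < b n) /\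
      ex_series (fun n => b n - a n) /\
      Series (fun n => b n - a n) <= eps.

Definition ae_in (D P : R -> Prop) : Prop :=
  null_set (fun x => D x /\ ~ P x).

(** ** Functions of two variables *)

Definition norm2 (x y : R) : R := sqrt (x ^ 2 + y ^ 2).

Definition C_n_punctured (n : nat) (H : R -> R -> R) : Prop :=
  forall x y : R, (x, y) <> (0, 0) -> ex_diff_n H n x y.

Definition C_n_alpha_loc_punctured (n : nat) (alpha : R) (H : R -> R -> R)
  : Prop :=
  C_n_punctured n H /\
  forall m k : nat, (m + k = n)%nat ->
  forall x y : R, (x, y) <> (0, 0) ->
  exists (delta : posreal) (C : R),
    forall u1 v1 u2 v2 : R,
      norm2 (u1 - x) (v1 - y) < delta ->
      norm2 (u2 - x) (v2 - y) < delta ->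
      (u1, v1) <> (u2, v2) ->
      Rabs (partial_derive m k H u1 v1 - partial_derive m k H u2 v2)
        <= C * Rpower (norm2 (u1 - u2) (v1 - v2)) alpha.

(** ** Positive 1-homogeneous functions *)

Definition pos_homogeneous (H : R -> R -> R) : Prop :=
  H 0 0 = 0 /\
  (forall x y : R, (x, y) <> (0, 0) -> 0 < H x y) /\
  (forall t x y : R, 0 < t -> H (t * x) (t * y) = t * H x y).

Definition even2 (H : R -> R -> R) : Prop :=
  forall x y : R, H (- x) (- y) = H x y.

Definition unit_ball (H : R -> R -> R) : R * R -> Prop :=
  fun p => H (fst p) (snd p) < 1.

(* The supremum is finite as soon as H is positive and continuous on S^1. *)
Definition dual (H : R -> R -> R) (x y : R) : R :=
  real (Lub_Rbar (fun v : R =>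
    exists a b : R, a ^ 2 + b ^ 2 = 1 /\ v = (x * a + y * b) / H a b)).

Definition grad1 (F : R -> R -> R) (x y : R) : R := Derive (fun u => F u y) x.
Definition grad2 (F : R -> R -> R) (x y : R) : R := Derive (fun v => F x v) y.

(* Both H and its dual vanish at the origin, so the factors [H x1 x2] and
   [dual H y1 y2] already extend the two fields by 0 there.
   The first clause excludes junk values of the total operator [Derive]. *)
Definition condition_S (H : R -> R -> R) : Prop :=
  (forall x y : R, (x, y) <> (0, 0) ->
     differentiable_pt H x y /\ differentiable_pt (dual H) x y) /\
  (forall x1 x2 y1 y2 : R,
     sign ((H x1 x2 * grad1 H x1 x2) * (dual H y1 y2 * grad1 (dual H) y1 y2)
         + (H x1 x2 * grad2 H x1 x2) * (dual H y1 y2 * grad2 (dual H) y1 y2))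
     = sign (x1 * y1 + x2 * y2)).

(** ** Planar sets *)

Definition interior2 (K : R * R -> Prop) (p : R * R) : Prop := locally p K.

Definition closure2 (K : R * R -> Prop) (p : R * R) : Prop :=
  ~ locally p (fun q => ~ K q).

Definition frontier2 (K : R * R -> Prop) (p : R * R) : Prop :=
  closure2 K p /\ ~ interior2 K p.

Definition strictly_convex (K : R * R -> Prop) : Prop :=
  forall p q : R * R, closure2 K p -> closure2 K q -> p <> q ->
  forall t : R, 0 < t < 1 ->
    interior2 K ((1 - t) * fst p + t * fst q, (1 - t) * snd p + t * snd q).

Definition uniformly_elliptic (H : R -> R -> R) : Prop :=
  exists lambda : R, 0 < lambda /\
    forall x y z1 z2 : R,
      frontier2 (unit_ball H) (x, y) ->
      z1 * grad1 H x y + z2 * grad2 H x y = 0 ->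
      lambda * (z1 ^ 2 + z2 ^ 2) <=
        partial_derive 2 0 H x y * z1 * z1
        + partial_derive 1 1 H x y * z1 * z2
        + partial_derive 1 1 H x y * z2 * z1
        + partial_derive 0 2 H x y * z2 * z2.

(** ** The construction in polar coordinates *)

Definition quarter (theta : R) : Prop := 0 <= theta <= PI / 2.

Definition d_quarter (n : nat) (r : R -> R) : R -> R := Derive_n_in quarter n r.

Definition tau (r : R -> R) (eta : R) : R :=
  PI / 2 + eta - atan (d_quarter 1 r eta / r eta).

(* Meaningful when [tau r] maps [0, pi/2] bijectively onto [pi/2, pi]. *)
Definition tau_inv (r : R -> R) (theta : R) : R :=
  iota (fun eta : R => quarter eta /\ tau r eta = theta).

Definition rtilde_second (r : R -> R) (rs theta : R) : R :=
  let eta := tau_inv r theta in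
  rs * sqrt (r eta ^ 2 + d_quarter 1 r eta ^ 2) / r eta ^ 2.

(* [theta - PI * floor (theta / PI)] is the representative of [theta] in
   [0, PI[; at the shared angles PI/2 and PI = 0 the two formulas agree
   under [boundary_cond]. *)
Definition rtilde (r : R -> R) (rs theta : R) : R :=
  let t := theta - PI * IZR (Int_part (theta / PI)) in
  if Rle_dec t (PI / 2) then r t else rtilde_second r rs t.

Definition polar_set (rho_max : R -> R) : R * R -> Prop :=
  fun p => exists rho theta : R,
    0 <= rho < rho_max theta /\ 0 <= theta <= 2 * PI /\
    p = (rho * cos theta, rho * sin theta).

(* These equations determine H, and are consistent if [rho_max] has
   period 2 pi. *)
Definition polar_gauge (rho_max : R -> R) (H : R -> R -> R) : Prop :=
  forall rho theta : R, 0 <= rho -> 0 <= theta <= 2 * PI ->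
    H (rho * cos theta) (rho * sin theta) = rho / rho_max theta.

Definition pos_on_quarter (r : R -> R) : Prop :=
  forall theta : R, quarter theta -> 0 < r theta.

Definition curvature_ineq (r : R -> R) (theta : R) : Prop :=
  r theta * d_quarter 2 r theta < 2 * d_quarter 1 r theta ^ 2 + r theta ^ 2.

Definition boundary_cond (r : R -> R) (rs : R) : Prop :=
  r 0 = 1 /\ r (PI / 2) = rs /\
  d_quarter 1 r 0 = 0 /\ d_quarter 1 r (PI / 2) = 0.

Definition similar_to (K L : R * R -> Prop) : Prop :=
  exists phi s : R, 0 < s /\
    forall x y : R,
      K (x, y) <->
      L (s * (cos phi * x - sin phi * y), s * (sin phi * x + cos phi * y)).

(* Main.v *)
Require Import Defs.
From Stdlib Require Import Reals Lra Lia ZArith Classical.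
From Coquelicot Require Import Coquelicot.
Open Scope R_scope.

(** The idea. Write [h th] for the value of the gauge [H] at the unit vector of angle
    [th], so that [1 / h] is the radius of the unit ball. In the frame of that unit vector
    and its rotation by a quarter turn, the gradient of [H] has components [h] and [h'];
    its direction is [nangle th = th + atan (h' / h)], and [conj_angle th = nangle th + PI / 2]
    is the direction of the tangent line, conjugate to [th] in the sense of Birkhoff.

    The sign condition says that conjugacy is symmetric. Indeed, if the ball is convex, the
    dual gauge at the gradient of angle [ps] is touched from below by the linear function
    of the boundary point of angle [ps], which is therefore its gradient there; so the
    condition compares the signs of [cos (ps - nangle th)] and [cos (th - nangle ps)]. At
    [ps = conj_angle th] the first one vanishes, and the second then gives
    [conj_angle (conj_angle th) = th + PI] ([conj_involution_of_S]): the unit circle is a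
    Radon curve. Conversely, on a curve with this involution the product of the gradient
    norm at [th] and of [h] at the conjugate of [th] is a constant [1 / k], which means that
    the dual gauge is [k] times the gauge rotated by a quarter turn ([radon_dual_eq]). The
    sign condition then only compares the directions of two gradients of [H], and
    it follows from the monotonicity of [nangle] ([radon_condition_S]).

    From the quarter to the curve. On the first quarter [conj_angle] is [tau], which is
    increasing because its derivative has the sign of the curvature expression, which is
    nonnegative and is positive somewhere in every interval. The involution and the constant
    product leave no choice on the second quarter: the logarithmic derivative of the radius
    at [tau eta] is the opposite of the one at [eta], and the radius there is the one in
    the definition of [rtilde]. These prescribed logarithmic derivatives agree
    at the ends of the two quarters, where they vanish, so they form a continuous periodic
    function, and its integral gives a radius of class C1 without any
    differentiation of the inverse of [tau] ([radon_of_quarter]).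

    From the curve to the quarter. Rotate and scale so that the boundary point nearest to
    the origin has angle 0 and norm 1. Then the derivative of the radius vanishes at
    0, hence at [PI / 2], its conjugate angle. A Radon curve is determined by its first
    quarter ([radon_unique]), so it is the curve constructed from it. When [H] is of class
    C2 the involution has an invertible derivative, so the curvature is positive everywhere
    ([curvature_pos]); this is uniform ellipticity, because the Hessian of [H]
    annihilates the radial direction and equals [h + h''], up to scaling, across it
    ([elliptic_of_curvature]). The two conditions on the derivatives at [PI / 2] are the
    first and second derivatives of the involution at 0 ([rad_compat]). *)

(** * Angles and polar coordinates *)

(** [auto_derive] leaves [Derive f x] for an abstract [f]; this replaces it by the value given
    by the hypothesis [H]. *)
Ltac derive_rw H :=
  match type of H with
  | is_derive ?f ?x ?l =>
      let g := eval cbv beta in (fun z : R => f z) in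
      replace (Derive g x) with l by (symmetry; apply is_derive_unique; exact H)
  end.

Lemma periodic_IZR (f : R -> R) (P : R) :
  (forall x, f (x + P) = f x) -> forall (n : Z) x, f (x + IZR n * P) = f x.
Proof.
  intros Hf.
  assert (Hn : forall (n : nat) x, f (x + INR n * P) = f x).
  { induction n as [|n IH]; intros x.
    - simpl. f_equal. ring.
    - rewrite S_INR. replace (x + (INR n + 1) * P) with (x + INR n * P + P) by ring.
      rewrite Hf. apply IH. }
  intros n x. destruct (Z_le_gt_dec 0 n) as [Hz|Hz].
  - rewrite <- (Z2Nat.id n Hz), <- INR_IZR_INZ. apply Hn.
  - rewrite <- (Hn (Z.to_nat (- n)) (x + IZR n * P)). f_equal.
    rewrite INR_IZR_INZ, Z2Nat.id by lia. rewrite opp_IZR. ring.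
Qed.

Lemma shift_into (P a x : R) : 0 < P -> exists n : Z, a <= x + IZR n * P < a + P.
Proof.
  intros HP. exists (- Int_part ((x - a) / P))%Z.
  destruct (base_Int_part ((x - a) / P)) as [H1 H2].
  rewrite opp_IZR. set (m := IZR (Int_part ((x - a) / P))) in *.
  assert (E : x - a = (x - a) / P * P) by (field; lra).
  split; nra.
Qed.

Lemma circle_param (a b : R) : a ^ 2 + b ^ 2 = 1 ->
  exists th, 0 <= th <= 2 * PI /\ a = cos th /\ b = sin th.
Proof.
  intros E. assert (Ha : -1 <= a <= 1) by nra.
  pose proof (acos_bound a) as [A1 A2].
  assert (S : sin (acos a) = sqrt (b ^ 2)).
  { rewrite sin_acos by exact Ha. f_equal. unfold Rsqr. lra. }
  destruct (Rle_dec 0 b) as [Hb|Hb].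
  - exists (acos a). rewrite cos_acos, S by exact Ha. rewrite sqrt_pow2 by exact Hb. lra.
  - exists (2 * PI - acos a). split; [lra|].
    replace (2 * PI - acos a) with (- acos a + 2 * INR 1 * PI) by (simpl; ring).
    rewrite cos_period, sin_period, cos_neg, sin_neg, cos_acos, S by exact Ha.
    replace (b ^ 2) with ((- b) ^ 2) by ring. rewrite sqrt_pow2 by lra. lra.
Qed.

Lemma polar_coords (x y : R) : (x, y) <> (0, 0) ->
  exists t th, 0 < t /\ 0 <= th <= 2 * PI /\ x = t * cos th /\ y = t * sin th.
Proof.
  intros Hxy.
  assert (Hp : 0 < x ^ 2 + y ^ 2).
  { destruct (Req_dec x 0) as [->|Hx]; [destruct (Req_dec y 0) as [->|Hy]|].
    - now contradiction Hxy.
    - assert (0 < y ^ 2) by (apply pow2_gt_0; exact Hy). lra.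
    - assert (0 < x ^ 2) by (apply pow2_gt_0; exact Hx). pose proof (pow2_ge_0 y). lra. }
  set (t := sqrt (x ^ 2 + y ^ 2)).
  assert (Ht : 0 < t) by (apply sqrt_lt_R0; exact Hp).
  assert (Et : t ^ 2 = x ^ 2 + y ^ 2) by (apply pow2_sqrt; lra).
  destruct (circle_param (x / t) (y / t)) as [th [Hth [E1 E2]]].
  { replace ((x / t) ^ 2 + (y / t) ^ 2) with ((x ^ 2 + y ^ 2) / t ^ 2) by (field; lra).
    rewrite Et. field. lra. }
  exists t, th. rewrite <- E1, <- E2. repeat split; try lra; field; lra.
Qed.


Lemma polar_nonzero (t th : R) : 0 < t -> (t * cos th, t * sin th) <> (0, 0).
Proof.
  intros Ht E. injection E as E1 E2. pose proof (sin2_cos2 th) as S. unfold Rsqr in S.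
  apply Rmult_integral in E1. apply Rmult_integral in E2.
  destruct E1 as [|E1]; [lra|]. destruct E2 as [|E2]; [lra|]. rewrite E1, E2 in S. lra.
Qed.

(** The half difference of the angles has sine 0, so the angles differ by full turns. *)
Lemma same_direction (f : R -> R) (a b : R) : (forall x, f (x + 2 * PI) = f x) ->
  cos a = cos b -> sin a = sin b -> f a = f b.
Proof.
  intros Hf Ec Es.
  assert (C : cos (a - b) = 1).
  { rewrite cos_minus, Ec, Es. pose proof (sin2_cos2 b) as S. unfold Rsqr in S. lra. }
  assert (S : sin ((a - b) / 2) = 0).
  { replace (a - b) with (2 * ((a - b) / 2)) in C by lra. rewrite cos_2a_sin in C. nra. }
  destruct (sin_eq_0_0 _ S) as [k Hk].
  replace a with (b + IZR k * (2 * PI)) by lra. now apply periodic_IZR.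
Qed.

(** * The normal angle *)

(** Norm of the gradient, at the unit vector of angle [th], of the homogeneous function with
    values [h] on the unit circle. *)
Definition amp (h dh : R -> R) (th : R) : R := sqrt (h th ^ 2 + dh th ^ 2).
(** Direction of that gradient, that is, of the outer normal of the unit ball. *)
Definition nangle (h dh : R -> R) (th : R) : R := th + atan (dh th / h th).
(** Direction of the tangent line. *)
Definition conj_angle (h dh : R -> R) (th : R) : R := nangle h dh th + PI / 2.

Lemma amp_pos h dh th : 0 < h th -> 0 < amp h dh th.
Proof. intros H. apply sqrt_lt_R0. pose proof (pow2_ge_0 (dh th)). nra. Qed.

Lemma amp_sqr h dh th : amp h dh th ^ 2 = h th ^ 2 + dh th ^ 2.
Proof. apply pow2_sqrt. pose proof (pow2_ge_0 (dh th)). pose proof (pow2_ge_0 (h th)). lra. Qed.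

Lemma amp_cos_sin h dh th : 0 < h th ->
  amp h dh th * cos (nangle h dh th - th) = h th /\
  amp h dh th * sin (nangle h dh th - th) = dh th.
Proof.
  intros H. unfold nangle. replace (th + atan (dh th / h th) - th) with (atan (dh th / h th)) by ring.
  rewrite cos_atan, sin_atan.
  assert (E : sqrt (1 + (dh th / h th)²) = amp h dh th / h th).
  { unfold amp. replace (h th) with (sqrt (h th ^ 2)) at 3 by (apply sqrt_pow2; lra).
    rewrite <- sqrt_div_alt by nra. f_equal. unfold Rsqr. field. lra. }
  rewrite E. pose proof (amp_pos h dh th H). split; field; lra.
Qed.

(** Pairing of the gradient at angle [ps] with the unit vector of angle [th], first by
    components, then by norm and direction. *)
Lemma amp_test h dh ps th : 0 < h ps ->
  h ps * cos (th - ps) + dh ps * sin (th - ps) = amp h dh ps * cos (th - nangle h dh ps).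
Proof.
  intros H. destruct (amp_cos_sin h dh ps H) as [E1 E2].
  rewrite <- E1, <- E2 at 1.
  replace (th - nangle h dh ps) with ((th - ps) - (nangle h dh ps - ps)) by ring.
  rewrite (cos_minus (th - ps)). ring.
Qed.

Lemma nangle_bounds h dh th : th - PI / 2 < nangle h dh th < th + PI / 2.
Proof. unfold nangle. pose proof (atan_bound (dh th / h th)). lra. Qed.

Lemma conj_bounds h dh th : th < conj_angle h dh th < th + PI.
Proof. unfold conj_angle. pose proof (nangle_bounds h dh th). lra. Qed.

(** Within a half turn of [ps], the quotient [cos (th - nangle ps) / h th] has derivative of the
    sign of [- sin (nangle th - nangle ps)], so it increases before [ps] and decreases after it. *)
Lemma support_strict (h dh : R -> R) :
  (forall th, 0 < h th) -> (forall th, is_derive h th (dh th)) ->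
  (forall a b, a < b -> nangle h dh a < nangle h dh b) ->
  (forall th, nangle h dh (th + PI) = nangle h dh th + PI) ->
  forall ps th, ps - PI <= th <= ps + PI -> th <> ps ->
  h ps * cos (th - ps) + dh ps * sin (th - ps) < h th.
Proof.
  intros Hp Hd Hi HP ps th Hth Hne.
  set (N := nangle h dh) in *.
  set (g := fun t => cos (t - N ps) / h t).
  set (dg := fun t => - (amp h dh t * sin (N t - N ps)) / h t ^ 2).
  assert (Dg : forall t, derivable_pt_lim g t (dg t)).
  { intros t. apply is_derive_Reals. unfold g, dg.
    pose proof (Hp t) as Hpt. pose proof (Hd t) as Hdt.
    auto_derive. { split; [now exists (dh t)|]. lra. }
    derive_rw Hdt.
    destruct (amp_cos_sin h dh t Hpt) as [E1 E2]. fold N in E1, E2.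
    change (t + - N ps) with (t - N ps).
    transitivity (- (h t * sin (t - N ps) + dh t * cos (t - N ps)) / h t ^ 2).
    { field. lra. }
    f_equal. f_equal. replace (N t - N ps) with ((N t - t) + (t - N ps)) by ring.
    rewrite sin_plus, <- E1, <- E2 at 1. ring. }
  assert (Hg : g th < g ps).
  { destruct (Rlt_or_le th ps) as [Hl|Hl].
    - destruct (MVT_cor2 g dg th ps Hl (fun c _ => Dg c)) as [c [Ec [C1 C2]]].
      assert (0 < dg c).
      { unfold dg. assert (sin (N c - N ps) < 0).
        { apply sin_lt_0_var; pose proof (Hi c ps C2).
          - pose proof (Hi (ps - PI) c ltac:(lra)). pose proof (HP (ps - PI)) as Q.
            replace (ps - PI + PI) with ps in Q by ring. lra.
          - lra. }
        pose proof (amp_pos h dh c (Hp c)). pose proof (Hp c).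
        apply Rdiv_lt_0_compat; nra. }
      nra.
    - assert (Hl' : ps < th) by lra.
      destruct (MVT_cor2 g dg ps th Hl' (fun c _ => Dg c)) as [c [Ec [C1 C2]]].
      assert (0 < - dg c).
      { unfold dg. assert (0 < sin (N c - N ps)).
        { apply sin_gt_0; pose proof (Hi ps c C1).
          - lra.
          - pose proof (Hi c (ps + PI) ltac:(lra)). pose proof (HP ps). lra. }
        pose proof (amp_pos h dh c (Hp c)). pose proof (Hp c).
        replace (- (- (amp h dh c * sin (N c - N ps)) / h c ^ 2))
          with ((amp h dh c * sin (N c - N ps)) / h c ^ 2) by (field; lra).
        apply Rdiv_lt_0_compat; nra. }
      nra. }
  rewrite (amp_test h dh ps th (Hp ps)). fold N.
  destruct (amp_cos_sin h dh ps (Hp ps)) as [E1 _]. fold N in E1.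
  pose proof (amp_pos h dh ps (Hp ps)) as HA.
  unfold g in Hg. pose proof (Hp ps) as P1. pose proof (Hp th) as P2.
  replace (ps - N ps) with (- (N ps - ps)) in Hg by ring. rewrite cos_neg in Hg.
  assert (Ec : cos (N ps - ps) = h ps / amp h dh ps) by (rewrite <- E1 at 1; field; lra).
  rewrite Ec in Hg.
  replace (h ps / amp h dh ps / h ps) with (/ amp h dh ps) in Hg by (field; lra).
  apply Rmult_lt_compat_r with (r := amp h dh ps * h th) in Hg; [|nra].
  field_simplify in Hg; lra.
Qed.

(** Full turns bring any angle within a half turn of [ps]. *)
Lemma support (h dh : R -> R) :
  (forall th, 0 < h th) -> (forall th, is_derive h th (dh th)) ->
  (forall th, h (th + PI) = h th) ->
  (forall a b, a < b -> nangle h dh a < nangle h dh b) ->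
  (forall th, nangle h dh (th + PI) = nangle h dh th + PI) ->
  forall ps th,
  h ps * cos (th - ps) + dh ps * sin (th - ps) <= h th /\
  (h ps * cos (th - ps) + dh ps * sin (th - ps) = h th -> cos th = cos ps /\ sin th = sin ps).
Proof.
  intros Hp Hd Hper Hi HP ps th.
  assert (Hper2 : forall x, h (x + 2 * PI) = h x).
  { intros x. replace (x + 2 * PI) with (x + PI + PI) by ring. now rewrite !Hper. }
  assert (cper : forall x, cos (x + 2 * PI) = cos x).
  { intros x. rewrite <- (cos_period x 1). f_equal. simpl; ring. }
  assert (sper : forall x, sin (x + 2 * PI) = sin x).
  { intros x. rewrite <- (sin_period x 1). f_equal. simpl; ring. }
  pose proof PI_RGT_0 as HPI.
  destruct (shift_into (2 * PI) (ps - PI) th ltac:(lra)) as [n Hn].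
  rewrite <- (periodic_IZR h _ Hper2 n th).
  rewrite <- (periodic_IZR cos _ cper n (th - ps)), <- (periodic_IZR sin _ sper n (th - ps)).
  rewrite <- (periodic_IZR cos _ cper n th), <- (periodic_IZR sin _ sper n th).
  replace (th - ps + IZR n * (2 * PI)) with (th + IZR n * (2 * PI) - ps) by ring.
  set (t := th + IZR n * (2 * PI)) in *.
  destruct (Req_dec t ps) as [->|Hne].
  - replace (ps - ps) with 0 by ring. rewrite cos_0, sin_0. split; [lra|]. intros _. now split.
  - pose proof (support_strict h dh Hp Hd Hi HP ps t ltac:(lra) Hne) as Hs.
    split; [lra|]. intros E. lra.
Qed.

(** * Differentiability of a gauge from its supporting lines *)

(** With a linear minorant that touches [F] at every nearby point, the error of the linear
    approximation is at most the increment tested against the difference of two minorants,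
    so continuity of the minorants suffices. *)
Lemma support_differentiable (F : R -> R -> R) (x0 y0 a b : R) :
  (forall x y, a * x + b * y <= F x y) -> F x0 y0 = a * x0 + b * y0 ->
  (forall eps : posreal, locally_2d (fun u v => exists a' b',
     Rabs (a' - a) < eps /\ Rabs (b' - b) < eps /\
     F u v = a' * u + b' * v /\ a' * x0 + b' * y0 <= F x0 y0) x0 y0) ->
  differentiable_pt_lim F x0 y0 a b.
Proof.
  intros Hs H0 Hn eps.
  destruct (Hn (mkposreal (eps / 2) ltac:(destruct eps; simpl; lra))) as [d Hd].
  exists d. intros u v Hu Hv. destruct (Hd u v Hu Hv) as [a' [b' [Ha [Hb [E1 E2]]]]].
  simpl in Ha, Hb. pose proof (Hs u v) as L.
  rewrite Rabs_pos_eq by lra.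
  apply Rle_trans with ((a' - a) * (u - x0) + (b' - b) * (v - y0)); [lra|].
  pose proof (Rmax_l (Rabs (u - x0)) (Rabs (v - y0))) as M1.
  pose proof (Rmax_r (Rabs (u - x0)) (Rabs (v - y0))) as M2.
  set (M := Rmax _ _) in *.
  assert (T1 : (a' - a) * (u - x0) <= eps / 2 * M).
  { eapply Rle_trans; [apply Rle_abs|]. rewrite Rabs_mult.
    apply Rmult_le_compat; try apply Rabs_pos; lra. }
  assert (T2 : (b' - b) * (v - y0) <= eps / 2 * M).
  { eapply Rle_trans; [apply Rle_abs|]. rewrite Rabs_mult.
    apply Rmult_le_compat; try apply Rabs_pos; lra. }
  lra.
Qed.

(** In the frame turned by [th0] the angle is the arctangent of a continuous quotient. *)
Lemma polar_near (t0 th0 : R) (eps : posreal) : 0 < t0 ->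
  locally_2d (fun u v => exists t th, 0 < t /\ Rabs (th - th0) < eps /\
    u = t * cos th /\ v = t * sin th) (t0 * cos th0) (t0 * sin th0).
Proof.
  intros Ht0.
  assert (Hc : continuity_2d_pt (fun u v => cos th0 * u + sin th0 * v) (t0 * cos th0) (t0 * sin th0)).
  { apply continuity_2d_pt_plus; apply continuity_2d_pt_mult;
      try apply continuity_2d_pt_const; [apply continuity_2d_pt_id1|apply continuity_2d_pt_id2]. }
  assert (Hd : continuity_2d_pt (fun u v => - sin th0 * u + cos th0 * v) (t0 * cos th0) (t0 * sin th0)).
  { apply continuity_2d_pt_plus; apply continuity_2d_pt_mult;
      try apply continuity_2d_pt_const; [apply continuity_2d_pt_id1|apply continuity_2d_pt_id2]. }
  pose proof (sin2_cos2 th0) as SC. unfold Rsqr in SC.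
  assert (C0 : cos th0 * (t0 * cos th0) + sin th0 * (t0 * sin th0) = t0) by nra.
  assert (D0 : - sin th0 * (t0 * cos th0) + cos th0 * (t0 * sin th0) = 0) by ring.
  assert (Hq : continuity_2d_pt (fun u v => atan ((- sin th0 * u + cos th0 * v) * / (cos th0 * u + sin th0 * v)))
     (t0 * cos th0) (t0 * sin th0)).
  { apply (continuity_1d_2d_pt_comp atan).
    - apply derivable_continuous_pt. apply derivable_pt_atan.
    - apply continuity_2d_pt_mult; [exact Hd|]. apply continuity_2d_pt_inv; [exact Hc|]. lra. }
  destruct (Hq eps) as [d1 H1].
  destruct (Hc (mkposreal t0 Ht0)) as [d2 H2].
  exists (mkposreal (Rmin d1 d2) (Rmin_stable_in_posreal d1 d2)).
  simpl. intros u v Hu Hv.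
  assert (A1 := Rmin_l d1 d2). assert (A2 := Rmin_r d1 d2).
  specialize (H1 u v ltac:(lra) ltac:(lra)). specialize (H2 u v ltac:(lra) ltac:(lra)).
  cbv beta in H1, H2. rewrite C0, D0 in H1. rewrite C0 in H2. simpl in H2.
  set (c := cos th0 * u + sin th0 * v) in *. set (d := - sin th0 * u + cos th0 * v) in *.
  apply Rabs_lt_between' in H2.
  replace (0 * / t0) with 0 in H1 by ring. rewrite atan_0, Rminus_0_r in H1.
  assert (Hcp : 0 < c) by lra.
  destruct (amp_cos_sin (fun _ => c) (fun _ => d) 0 Hcp) as [E1 E2].
  pose proof (amp_pos (fun _ => c) (fun _ => d) 0 Hcp) as Ap.
  unfold nangle in E1, E2. replace (0 + atan (d / c) - 0) with (atan (d / c)) in E1, E2 by ring.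
  exists (amp (fun _ => c) (fun _ => d) 0), (th0 + atan (d / c)).
  split; [exact Ap|]. split.
  { replace (th0 + atan (d / c) - th0) with (atan (d / c)) by ring. exact H1. }
  rewrite cos_plus, sin_plus. set (A := amp _ _ _) in *.
  split.
  - transitivity (u * (sin th0 * sin th0 + cos th0 * cos th0)); [rewrite SC; ring|].
    transitivity (c * cos th0 - d * sin th0); [unfold c, d; ring|].
    transitivity (A * cos (atan (d / c)) * cos th0 - A * sin (atan (d / c)) * sin th0); [|ring].
    now rewrite E1, E2.
  - transitivity (v * (sin th0 * sin th0 + cos th0 * cos th0)); [rewrite SC; ring|].
    transitivity (c * sin th0 + d * cos th0); [unfold c, d; ring|].
    transitivity (A * cos (atan (d / c)) * sin th0 + A * sin (atan (d / c)) * cos th0); [|ring].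
    now rewrite E1, E2.
Qed.

Lemma polar_coords0 (x y : R) :
  exists t th, 0 <= t /\ 0 <= th <= 2 * PI /\ x = t * cos th /\ y = t * sin th.
Proof.
  destruct (classic ((x, y) = (0, 0))) as [E|H].
  - injection E as -> ->. exists 0, 0. pose proof PI_RGT_0. repeat split; lra.
  - destruct (polar_coords x y H) as [t [th [Ht [Hth E]]]]. exists t, th.
    split; [lra|]. now split.
Qed.

Definition radial_gauge (h : R -> R) (H : R -> R -> R) : Prop :=
  forall t th, 0 <= t -> H (t * cos th) (t * sin th) = t * h th.

(** Components of the gradient at angle [th] in the fixed basis. *)
Definition grad_x (h dh : R -> R) (th : R) : R := h th * cos th - dh th * sin th.
Definition grad_y (h dh : R -> R) (th : R) : R := h th * sin th + dh th * cos th.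

Definition supported (h dh : R -> R) : Prop := forall ps th,
  h ps * cos (th - ps) + dh ps * sin (th - ps) <= h th.

Lemma grad_test h dh ps t th :
  grad_x h dh ps * (t * cos th) + grad_y h dh ps * (t * sin th)
  = t * (h ps * cos (th - ps) + dh ps * sin (th - ps)).
Proof. unfold grad_x, grad_y. rewrite cos_minus, sin_minus. ring. Qed.

Lemma gauge_zero h H : radial_gauge h H -> H 0 0 = 0.
Proof. intros HH. pose proof (HH 0 0 (Rle_refl 0)) as E. now rewrite !Rmult_0_l in E. Qed.

Lemma gauge_support h dh H : radial_gauge h H -> supported h dh ->
  forall ps x y, grad_x h dh ps * x + grad_y h dh ps * y <= H x y.
Proof.
  intros HH Hs ps x y. destruct (polar_coords0 x y) as [t [th [Ht [_ [-> ->]]]]].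
  rewrite grad_test, HH by exact Ht. apply Rmult_le_compat_l; [exact Ht|]. apply Hs.
Qed.

Lemma gauge_grad_eq h dh H : radial_gauge h H -> forall t ps, 0 <= t ->
  H (t * cos ps) (t * sin ps)
  = grad_x h dh ps * (t * cos ps) + grad_y h dh ps * (t * sin ps).
Proof.
  intros HH t ps Ht. rewrite HH, grad_test by exact Ht.
  replace (ps - ps) with 0 by ring. rewrite cos_0, sin_0. ring.
Qed.

Lemma gauge_differentiable h dh H : radial_gauge h H -> supported h dh ->
  (forall th, continuous h th) -> (forall th, continuous dh th) ->
  forall t th, 0 < t ->
  differentiable_pt_lim H (t * cos th) (t * sin th) (grad_x h dh th) (grad_y h dh th).
Proof.
  intros HH Hs Hc Hdc t th Ht. apply support_differentiable.
  - intros x y. now apply gauge_support.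
  - apply gauge_grad_eq; [exact HH|lra].
  - intros eps.
    assert (C1 : continuous (grad_x h dh) th).
    { unfold grad_x. apply (continuous_minus (V := R_NormedModule)); apply (continuous_mult (K := R_AbsRing)).
      - apply Hc. - apply continuous_cos. - apply Hdc. - apply continuous_sin. }
    assert (C2 : continuous (grad_y h dh) th).
    { unfold grad_y. apply (continuous_plus (V := R_NormedModule)); apply (continuous_mult (K := R_AbsRing)).
      - apply Hc. - apply continuous_sin. - apply Hdc. - apply continuous_cos. }
    destruct (C1 _ (locally_ball _ eps)) as [d1 H1].
    destruct (C2 _ (locally_ball _ eps)) as [d2 H2].
    destruct (polar_near t th (mkposreal _ (Rmin_stable_in_posreal d1 d2)) Ht) as [d Hd].
    exists d. intros u v Hu Hv. destruct (Hd u v Hu Hv) as [s [ps [Hs0 [Hps [-> ->]]]]].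
    simpl in Hps. pose proof (Rmin_l d1 d2). pose proof (Rmin_r d1 d2).
    exists (grad_x h dh ps), (grad_y h dh ps).
    split; [|split; [|split]].
    + apply H1. change (Rabs (ps - th) < d1). lra.
    + apply H2. change (Rabs (ps - th) < d2). lra.
    + apply gauge_grad_eq; [exact HH|lra].
    + now apply gauge_support.
Qed.

(** * Strict convexity of a supported gauge *)

(** Away from the origin the gauge is differentiable; at the origin it is bounded by a
    multiple of the norm. *)
Lemma gauge_continuous h dh H : radial_gauge h H -> supported h dh ->
  (forall th, continuous h th) -> (forall th, continuous dh th) ->
  forall x y, continuity_2d_pt H x y.
Proof.
  intros HH Hs Hc Hdc x y.
  destruct (classic ((x, y) = (0, 0))) as [E|Hxy].
  - injection E as -> ->.
    destruct (continuity_ab_maj (fun th => Rabs (h th)) 0 (2 * PI)) as [m [Hm _]].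
    { pose proof PI_RGT_0; lra. }
    { intros c _. apply continuity_pt_filterlim.
      apply (continuous_comp h Rabs); [apply Hc|apply continuous_Rabs]. }
    set (M := Rabs (h m) + 1).
    assert (HM : 0 < M) by (pose proof (Rabs_pos (h m)); unfold M; lra).
    intros eps.
    assert (Hd : 0 < eps / (2 * M)) by (apply Rdiv_lt_0_compat; [apply eps|lra]).
    exists (mkposreal _ Hd). simpl. intros u v Hu Hv.
    rewrite (gauge_zero h H HH), Rminus_0_r. rewrite Rminus_0_r in Hu, Hv.
    destruct (polar_coords0 u v) as [t [th [Ht [Hth [Eu Ev]]]]].
    assert (Ht2 : t < 2 * (eps / (2 * M))).
    { apply Rabs_lt_between in Hu. apply Rabs_lt_between in Hv.
      pose proof (sin2_cos2 th) as SC. unfold Rsqr in SC.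
      assert (t ^ 2 = u ^ 2 + v ^ 2) by (rewrite Eu, Ev; nra).
      set (d := eps / (2 * M)) in *. clearbody d. nra. }
    rewrite Eu, Ev, HH by exact Ht.
    rewrite Rabs_mult, (Rabs_pos_eq t) by exact Ht.
    assert (Hb : Rabs (h th) <= M).
    { specialize (Hm th Hth). unfold M. lra. }
    apply Rle_lt_trans with (t * M). { apply Rmult_le_compat_l; lra. }
    apply Rmult_lt_compat_r with (r := M) in Ht2; [|exact HM].
    replace (2 * (eps / (2 * M)) * M) with (pos eps) in Ht2 by (field; lra). exact Ht2.
  - destruct (polar_coords x y Hxy) as [t [th [Ht [_ [-> ->]]]]].
    apply differentiable_continuity_pt. exists (grad_x h dh th), (grad_y h dh th).
    now apply gauge_differentiable.
Qed.

Lemma unit_ball_closure H x y : continuity_2d_pt H x y -> closure2 (unit_ball H) (x, y) -> H x y <= 1.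
Proof.
  intros Hc Hcl. apply Rnot_lt_le. intros Hlt. apply Hcl.
  destruct (Hc (mkposreal (H x y - 1) ltac:(lra))) as [d Hd].
  apply (proj1 (locally_2d_locally (fun u v => ~ unit_ball H (u, v)) x y)).
  exists d. intros u v Hu Hv. specialize (Hd u v Hu Hv). simpl in Hd.
  apply Rabs_lt_between' in Hd. unfold unit_ball; simpl. lra.
Qed.

Lemma unit_ball_interior H x y : continuity_2d_pt H x y -> H x y < 1 -> interior2 (unit_ball H) (x, y).
Proof.
  intros Hc Hlt.
  destruct (Hc (mkposreal (1 - H x y) ltac:(lra))) as [d Hd].
  assert (L : locally_2d (fun u v => unit_ball H (u, v)) x y).
  { exists d. intros u v Hu Hv. specialize (Hd u v Hu Hv). simpl in Hd.
    apply Rabs_lt_between' in Hd. unfold unit_ball; simpl. lra. }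
  apply locally_2d_locally in L. destruct L as [e He]. exists e. intros [u v] Hy.
  exact (He (u, v) Hy).
Qed.

(** The gradient in the direction of a point of the segment bounds the gauge from below
    along the whole segment. If the point had gauge 1, both ends would lie on the supporting
    line, which meets the ball in a single point. *)
Lemma gauge_strictly_convex h dh H : radial_gauge h H -> supported h dh ->
  (forall th, continuous h th) -> (forall th, continuous dh th) -> (forall th, 0 < h th) ->
  (forall ps th, h ps * cos (th - ps) + dh ps * sin (th - ps) = h th ->
     cos th = cos ps /\ sin th = sin ps) ->
  strictly_convex (unit_ball H).
Proof.
  intros HH Hs Hc Hdc Hp Heq [p1 p2] [q1 q2] Kp Kq Hpq t Ht. simpl.
  pose proof (gauge_continuous h dh H HH Hs Hc Hdc) as HC.
  apply unit_ball_closure in Kp; [|apply HC]. apply unit_ball_closure in Kq; [|apply HC].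
  set (m1 := (1 - t) * p1 + t * q1). set (m2 := (1 - t) * p2 + t * q2).
  apply unit_ball_interior; [apply HC|].
  destruct (polar_coords0 m1 m2) as [s [ps [Hs0 [_ [E1 E2]]]]].
  pose proof (gauge_grad_eq h dh H HH s ps Hs0) as EH. rewrite <- E1, <- E2 in EH.
  pose proof (gauge_support h dh H HH Hs ps p1 p2) as Sp.
  pose proof (gauge_support h dh H HH Hs ps q1 q2) as Sq.
  set (a := grad_x h dh ps) in *. set (b := grad_y h dh ps) in *.
  assert (EH' : H m1 m2 = (1 - t) * (a * p1 + b * p2) + t * (a * q1 + b * q2)).
  { rewrite EH. unfold m1, m2. ring. }
  destruct (Rlt_or_le (H m1 m2) 1) as [L|L]; [exact L|exfalso].
  assert (Ep : a * p1 + b * p2 = H p1 p2 /\ H p1 p2 = 1) by nra.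
  assert (Eq : a * q1 + b * q2 = H q1 q2 /\ H q1 q2 = 1) by nra.
  assert (Key : forall u v, a * u + b * v = H u v /\ H u v = 1 ->
     u = / h ps * cos ps /\ v = / h ps * sin ps).
  { intros u v [Eu Ev]. destruct (polar_coords0 u v) as [r [th [Hr [_ [-> ->]]]]].
    rewrite HH in Eu, Ev by exact Hr. unfold a, b in Eu. rewrite grad_test in Eu.
    assert (Hr0 : r <> 0) by (intros ->; lra).
    apply Rmult_eq_reg_l in Eu; [|exact Hr0].
    destruct (Heq ps th Eu) as [C1 C2]. rewrite C1, C2.
    assert (Eh : h th = h ps).
    { rewrite <- Eu, cos_minus, sin_minus, C1, C2.
      pose proof (sin2_cos2 ps) as SC. unfold Rsqr in SC.
      replace (cos ps * cos ps + sin ps * sin ps) with 1 by lra. ring. }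
    rewrite Eh in Ev. pose proof (Hp ps).
    replace r with (/ h ps); [now split|]. apply Rmult_eq_reg_r with (h ps); [|lra].
    rewrite Ev. field. lra. }
  destruct (Key _ _ Ep) as [-> ->]. destruct (Key _ _ Eq) as [-> ->]. now apply Hpq.
Qed.

Lemma strictly_convex_ext (K L : R * R -> Prop) :
  (forall p, K p <-> L p) -> strictly_convex K -> strictly_convex L.
Proof.
  intros E HK p q Hp Hq Hpq t Ht.
  assert (Ecl : forall p, closure2 L p -> closure2 K p).
  { intros z Hz Hl. apply Hz. revert Hl. apply filter_imp. intros w Hw Lw. apply Hw. now apply E. }
  pose proof (HK p q (Ecl p Hp) (Ecl q Hq) Hpq t Ht) as Hi.
  unfold interior2 in *. revert Hi. apply filter_imp. intros z. apply E.
Qed.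

Lemma polar_set_gauge h H rm p : radial_gauge h H -> (forall th, 0 < h th) ->
  (forall th, rm th = / h th) -> (unit_ball H p <-> polar_set rm p).
Proof.
  intros HH Hp Hr. destruct p as [x y]. unfold unit_ball, polar_set; simpl. split.
  - intros Hlt. destruct (polar_coords0 x y) as [t [th [Ht [Hth [-> ->]]]]].
    exists t, th. rewrite HH in Hlt by exact Ht. pose proof (Hp th).
    split; [|now split]. split; [exact Ht|]. rewrite Hr.
    apply Rmult_lt_reg_r with (h th); [exact H0|]. rewrite Rinv_l by lra. exact Hlt.
  - intros [t [th [[Ht Hlt] [_ E]]]]. injection E as -> ->. rewrite HH by exact Ht.
    rewrite Hr in Hlt. pose proof (Hp th).
    apply Rmult_lt_compat_r with (r := h th) in Hlt; [|exact H0].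
    rewrite Rinv_l in Hlt by lra. exact Hlt.
Qed.

(** * Radon curves *)

(** Radon curves: [radon_inv] says that conjugacy of directions is symmetric, and
    [radon_dual] that the dual gauge is [k] times the gauge turned by a quarter turn. *)
Record radon (h dh : R -> R) (k : R) : Prop := {
  radon_pos : forall th, 0 < h th;
  radon_deriv : forall th, is_derive h th (dh th);
  radon_cont : forall th, continuous dh th;
  radon_per : forall th, h (th + PI) = h th;
  radon_inv : forall th, conj_angle h dh (conj_angle h dh th) = th + PI;
  radon_kpos : 0 < k;
  radon_dual : forall th, k * h (conj_angle h dh th) * amp h dh th = 1 }.

Lemma derive_periodic (h dh : R -> R) (P : R) : (forall th, is_derive h th (dh th)) ->
  (forall th, h (th + P) = h th) -> forall th, dh (th + P) = dh th.
Proof.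
  intros Hd Hp th.
  assert (D1 : is_derive h th (dh (th + P))).
  { apply (is_derive_ext (fun x => h (x + P))); [exact Hp|].
    pose proof (Hd (th + P)) as D. auto_derive.
    - now exists (dh (th + P)).
    - derive_rw D. ring. }
  rewrite <- (is_derive_unique _ _ _ D1). now apply is_derive_unique.
Qed.

Lemma nangle_periodic (h dh : R -> R) (P : R) : (forall th, is_derive h th (dh th)) ->
  (forall th, h (th + P) = h th) -> forall th, nangle h dh (th + P) = nangle h dh th + P.
Proof.
  intros Hd Hp th. unfold nangle. rewrite Hp, (derive_periodic h dh P Hd Hp). ring.
Qed.

Lemma continuous_of_derive (h : R -> R) th l : is_derive h th l -> continuous h th.
Proof. intros D. apply (ex_derive_continuous h). now exists l. Qed.

Lemma nangle_continuous h dh th : 0 < h th -> continuous h th -> continuous dh th ->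
  continuous (nangle h dh) th.
Proof.
  intros Hp Hc Hd. unfold nangle. apply (continuous_plus (V := R_NormedModule)).
  - apply continuous_id.
  - apply (continuous_comp (fun t => dh t / h t) atan).
    + apply (continuous_mult (K := R_AbsRing)); [exact Hd|].
      apply continuous_Rinv_comp; [exact Hc|lra].
    + apply continuous_atan.
Qed.

(** Such a map is injective, and a decrease somewhere would make it take one value twice,
    because it grows without bound. *)
Lemma conj_increasing (T : R -> R) (P : R) : (forall x, continuous T x) ->
  (forall x, x < T x) -> (forall x, T (T x) = x + P) -> forall a b, a < b -> T a < T b.
Proof.
  intros Hc Hlt HT a b Hab.
  assert (inj : forall x y, T x = T y -> x = y).
  { intros x y E. pose proof (HT x). pose proof (HT y). rewrite E in H. lra. }
  apply Rnot_le_lt. intros [Hle|E]; [|pose proof (inj _ _ E); lra].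
  set (c := Rmax b (T a)).
  assert (Hcc : T a < T c).
  { pose proof (Rmax_r b (T a)). pose proof (Hlt c). fold c in H. lra. }
  assert (Hbc : b <= c) by apply Rmax_l.
  destruct (IVT_gen T b c (T a)) as [x [Hx Ex]].
  - intros x. apply continuity_pt_filterlim. apply Hc.
  - rewrite Rmin_left, Rmax_right by lra. lra.
  - rewrite Rmin_left, Rmax_right in Hx by lra. pose proof (inj _ _ Ex). lra.
Qed.

Lemma conj_nangle_increasing h dh :
  (forall th, 0 < h th) -> (forall th, continuous h th) -> (forall th, continuous dh th) ->
  (forall th, conj_angle h dh (conj_angle h dh th) = th + PI) ->
  forall a b, a < b -> nangle h dh a < nangle h dh b.
Proof.
  intros Hp Hc Hd Hi a b Hab.
  pose proof (conj_increasing (conj_angle h dh) PI) as Hinc.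
  assert (conj_angle h dh a < conj_angle h dh b).
  { apply Hinc; try exact Hi; try exact Hab.
    - intros x. unfold conj_angle. apply (continuous_plus (V := R_NormedModule)).
      + now apply nangle_continuous. + apply continuous_const.
    - intros x. apply conj_bounds. }
  unfold conj_angle in H. lra.
Qed.

Lemma sin_shift_PI_n (n : Z) :
  cos (IZR n * PI) <> 0 /\ forall x, sin (x + IZR n * PI) = cos (IZR n * PI) * sin x.
Proof.
  assert (Hs : sin (IZR n * PI) = 0) by (apply sin_eq_0_1; now exists n).
  split.
  - intros E. pose proof (sin2_cos2 (IZR n * PI)) as SC. unfold Rsqr in SC.
    rewrite Hs, E in SC. lra.
  - intros x. rewrite sin_plus, Hs. ring.
Qed.

(** Moving an angle by half turns changes both signs alike, so the angles may be taken
    at distance less than [PI], where this is the monotonicity of [N]. *)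
Lemma sign_sin_monotone (N : R -> R) :
  (forall a b, a < b -> N a < N b) -> (forall x, N (x + PI) = N x + PI) ->
  forall a b, sign (sin (N a - N b)) = sign (sin (a - b)).
Proof.
  intros Hi HP a b. pose proof PI_RGT_0 as HPI.
  destruct (shift_into PI b a HPI) as [n Hn].
  assert (EN : N (a + IZR n * PI) = N a + IZR n * PI).
  { pose proof (periodic_IZR (fun x => N x - x) PI) as Q. cbv beta in Q.
    specialize (Q ltac:(intros x; rewrite HP; ring) n a). lra. }
  destruct (sin_shift_PI_n n) as [Hc Hs].
  apply Rmult_eq_reg_l with (sign (cos (IZR n * PI))); [|now apply sign_neq_0].
  rewrite <- !sign_mult, <- !Hs.
  replace (N a - N b + IZR n * PI) with (N (a + IZR n * PI) - N b) by (rewrite EN; ring).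
  replace (a - b + IZR n * PI) with (a + IZR n * PI - b) by ring.
  set (a' := a + IZR n * PI) in *.
  destruct (Req_dec a' b) as [->|Hne].
  - now replace (N b - N b) with (b - b) by ring.
  - assert (L1 : N b < N a') by (apply Hi; lra).
    assert (L2 : N a' < N (b + PI)) by (apply Hi; lra).
    rewrite HP in L2.
    rewrite !sign_eq_1; [reflexivity| |]; apply sin_gt_0; lra.
Qed.

Section RadonConsequences.
Context (h dh : R -> R) (k : R) (HR : radon h dh k) (H : R -> R -> R) (HH : radial_gauge h H).

Lemma radon_hcont : forall th, continuous h th.
Proof. intros th. apply (continuous_of_derive h th (dh th)), (radon_deriv _ _ _ HR). Qed.

Lemma radon_nangle_increasing : forall a b, a < b -> nangle h dh a < nangle h dh b.
Proof.
  apply conj_nangle_increasing; try apply HR. apply radon_hcont.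
Qed.

Lemma radon_nangle_per : forall th, nangle h dh (th + PI) = nangle h dh th + PI.
Proof. apply nangle_periodic; apply HR. Qed.

Lemma radon_support ps th :
  h ps * cos (th - ps) + dh ps * sin (th - ps) <= h th /\
  (h ps * cos (th - ps) + dh ps * sin (th - ps) = h th -> cos th = cos ps /\ sin th = sin ps).
Proof.
  apply support; try apply HR. apply radon_nangle_increasing. apply radon_nangle_per.
Qed.

Lemma radon_supported : supported h dh.
Proof. intros ps th. apply radon_support. Qed.

Lemma radon_strictly_convex : strictly_convex (unit_ball H).
Proof.
  apply (gauge_strictly_convex h dh); try apply HR; try exact HH.
  - apply radon_supported. - apply radon_hcont. - intros ps th. apply radon_support.
Qed.

Lemma rotate_gauge t th : 0 <= t -> H (- (t * sin th)) (t * cos th) = t * h (th + PI / 2).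
Proof.
  intros Ht. rewrite <- HH by exact Ht. rewrite cos_plus, sin_plus, cos_PI2, sin_PI2.
  f_equal; ring.
Qed.

(** The supremum is attained at the boundary point whose normal has the direction of
    [(x, y)]; its angle is the conjugate of [ph + PI / 2] up to a half turn. *)
Lemma radon_dual_eq x y : dual H x y = k * H (- y) x.
Proof.
  destruct (polar_coords0 x y) as [t [ph [Ht [_ [-> ->]]]]].
  rewrite rotate_gauge by exact Ht.
  set (ps := conj_angle h dh (ph + PI / 2) - PI).
  assert (Eps : conj_angle h dh ps = ph + PI / 2).
  { assert (conj_angle h dh (ps + PI) = ph + PI / 2 + PI).
    { unfold ps. replace (conj_angle h dh (ph + PI / 2) - PI + PI)
        with (conj_angle h dh (ph + PI / 2)) by ring. apply HR. }
    unfold conj_angle in *. rewrite radon_nangle_per in H0. lra. }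
  assert (EN : nangle h dh ps = ph) by (unfold conj_angle in Eps; lra).
  pose proof (radon_pos _ _ _ HR ps) as Hps.
  pose proof (amp_pos h dh ps Hps) as Ap.
  pose proof (radon_dual _ _ _ HR ps) as Ed. rewrite Eps in Ed.
  assert (Ek : k * h (ph + PI / 2) = / amp h dh ps).
  { apply Rmult_eq_reg_r with (amp h dh ps); [|lra]. rewrite Ed. field. lra. }
  replace (k * (t * h (ph + PI / 2))) with (t * (k * h (ph + PI / 2))) by ring. rewrite Ek.
  unfold dual. rewrite (is_lub_Rbar_unique _ (Finite (t * / amp h dh ps))); [reflexivity|].
  assert (Hval : forall th, (t * cos ph * cos th + t * sin ph * sin th) / H (cos th) (sin th)
     = t * (cos (th - ph) / h th)).
  { intros th. replace (H (cos th) (sin th)) with (h th).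
    - rewrite cos_minus. field. pose proof (radon_pos _ _ _ HR th). lra.
    - pose proof (HH 1 th ltac:(lra)) as E. rewrite !Rmult_1_l in E. now symmetry. }
  split.
  - intros v [a [b [Eab ->]]]. simpl.
    destruct (circle_param a b Eab) as [th [_ [-> ->]]]. rewrite Hval.
    apply Rmult_le_compat_l; [exact Ht|].
    pose proof (radon_supported ps th) as S. rewrite amp_test, EN in S by exact Hps.
    pose proof (radon_pos _ _ _ HR th).
    apply Rmult_le_reg_r with (amp h dh ps * h th); [nra|].
    replace (cos (th - ph) / h th * (amp h dh ps * h th)) with (amp h dh ps * cos (th - ph))
      by (field; lra).
    replace (/ amp h dh ps * (amp h dh ps * h th)) with (h th) by (field; lra). exact S.
  - intros l Hl. apply Hl. exists (cos ps), (sin ps). split.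
    { pose proof (sin2_cos2 ps) as SC. unfold Rsqr in SC. nra. }
    rewrite Hval. f_equal.
    destruct (amp_cos_sin h dh ps Hps) as [E1 _]. rewrite EN in E1.
    replace (ps - ph) with (- (ph - ps)) by ring. rewrite cos_neg.
    replace (cos (ph - ps)) with (h ps / amp h dh ps) by (rewrite <- E1; field; lra).
    field. lra.
Qed.

Lemma radon_gauge_differentiable t th : 0 < t ->
  differentiable_pt_lim H (t * cos th) (t * sin th) (grad_x h dh th) (grad_y h dh th).
Proof.
  apply gauge_differentiable; try exact HH; try apply HR.
  - apply radon_supported. - apply radon_hcont.
Qed.

Lemma radon_dual_differentiable t th : 0 < t ->
  differentiable_pt_lim (dual H) (t * cos th) (t * sin th)
    (k * grad_y h dh (th + PI / 2)) (- (k * grad_x h dh (th + PI / 2))).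
Proof.
  intros Ht. pose proof (radon_gauge_differentiable t (th + PI / 2) Ht) as D.
  rewrite cos_plus, sin_plus, cos_PI2, sin_PI2 in D.
  replace (t * (cos th * 0 - sin th * 1)) with (- (t * sin th)) in D by ring.
  replace (t * (sin th * 0 + cos th * 1)) with (t * cos th) in D by ring.
  pose proof (radon_kpos _ _ _ HR) as Hk.
  intros eps.
  assert (He : 0 < eps / k) by (apply Rdiv_lt_0_compat; [apply eps|exact Hk]).
  destruct (D (mkposreal _ He)) as [d Hd]. exists d. intros u v Hu Hv.
  rewrite !radon_dual_eq.
  assert (E : Rabs (- v - - (t * sin th)) = Rabs (v - t * sin th)).
  { rewrite <- Rabs_Ropp. f_equal. ring. }
  specialize (Hd (- v) u ltac:(rewrite E; exact Hv) Hu). simpl in Hd. rewrite E in Hd.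
  rewrite (Rmax_comm (Rabs (v - _))) in Hd.
  match goal with |- Rabs ?z <= _ => replace z with
    (k * (H (- v) u - H (- (t * sin th)) (t * cos th) -
         (grad_x h dh (th + PI / 2) * (- v - - (t * sin th)) + grad_y h dh (th + PI / 2) * (u - t * cos th)))) by ring end.
  rewrite Rabs_mult, (Rabs_pos_eq k) by lra.
  apply Rmult_le_compat_l with (r := k) in Hd; [|lra].
  eapply Rle_trans; [exact Hd|]. right. field. lra.
Qed.

(** As the dual is a rotated multiple of [H], the left-hand side is a positive multiple of the
    sine of the difference of two normal angles. *)
Lemma radon_condition_S : condition_S H.
Proof.
  split.
  - intros x y Hxy. destruct (polar_coords x y Hxy) as [t [th [Ht [_ [-> ->]]]]]. split.
    + exists (grad_x h dh th), (grad_y h dh th). now apply radon_gauge_differentiable.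
    + eexists; eexists. now apply radon_dual_differentiable.
  - intros x1 x2 y1 y2.
    destruct (classic ((x1, x2) = (0, 0))) as [E|Hx].
    { injection E as -> ->. rewrite (gauge_zero h H HH). f_equal. ring. }
    destruct (classic ((y1, y2) = (0, 0))) as [E|Hy].
    { injection E as -> ->. rewrite radon_dual_eq, Ropp_0, (gauge_zero h H HH). f_equal. ring. }
    destruct (polar_coords x1 x2 Hx) as [t [th [Ht [_ [-> ->]]]]].
    destruct (polar_coords y1 y2 Hy) as [s [ph [Hs [_ [-> ->]]]]].
    destruct (differentiable_pt_lim_unique _ _ _ _ _ (radon_gauge_differentiable t th Ht)) as [E1 E2].
    destruct (differentiable_pt_lim_unique _ _ _ _ _ (radon_dual_differentiable s ph Hs)) as [E3 E4].
    unfold grad1, grad2. rewrite E1, E2, E3, E4.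
    rewrite radon_dual_eq, rotate_gauge, HH by lra.
    set (ps := ph + PI / 2).
    pose proof (radon_pos _ _ _ HR th) as P1. pose proof (radon_pos _ _ _ HR ps) as P2.
    pose proof (radon_kpos _ _ _ HR) as Hk.
    pose proof (amp_pos h dh th P1) as A1. pose proof (amp_pos h dh ps P2) as A2.
    (* the gradient at angle [a] is [amp a] times the unit vector of angle [nangle a] *)
    assert (Pol : forall a, grad_x h dh a = amp h dh a * cos (nangle h dh a) /\
                            grad_y h dh a = amp h dh a * sin (nangle h dh a)).
    { intros a. pose proof (radon_pos _ _ _ HR a) as Pa.
      destruct (amp_cos_sin h dh a Pa) as [F1 F2]. unfold grad_x, grad_y.
      rewrite <- F1, <- F2 at 1. rewrite <- F1 at 1. rewrite <- F2 at 1.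
      replace (nangle h dh a) with ((nangle h dh a - a) + a) at 3 6 by ring.
      rewrite cos_plus, sin_plus. split; ring. }
    destruct (Pol th) as [-> ->]. destruct (Pol ps) as [-> ->].
    match goal with |- sign ?L = sign ?Rr =>
      replace L with ((t * h th * (k * (s * h ps)) * k * amp h dh th * amp h dh ps)
                       * sin (nangle h dh ps - nangle h dh th));
      [|rewrite (sin_minus (nangle h dh ps)); ring];
      replace Rr with ((t * s) * sin (ps - th)) end.
    2:{ unfold ps. replace (ph + PI / 2 - th) with (PI / 2 - (th - ph)) by ring.
        rewrite sin_shift, cos_minus. ring. }
    rewrite !(sign_mult _ (sin _)).
    rewrite !(sign_eq_1 (_ * _)); [|nra|repeat apply Rmult_lt_0_compat; assumption].
    rewrite !Rmult_1_l. apply sign_sin_monotone.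
    - intros a b. apply radon_nangle_increasing.
    - apply radon_nangle_per.
Qed.

End RadonConsequences.

(** * Calculus relative to the quarter interval *)

Definition clamp (x : R) : R := Rmax 0 (Rmin (PI / 2) x).

Lemma clamp_quarter x : quarter (clamp x).
Proof.
  unfold quarter, clamp. pose proof PI_RGT_0. split; [apply Rmax_l|].
  apply Rmax_lub; [lra|apply Rmin_l].
Qed.

Lemma clamp_id x : quarter x -> clamp x = x.
Proof. intros [H1 H2]. unfold clamp. rewrite Rmin_right by lra. now rewrite Rmax_right. Qed.

Lemma clamp_low x : x <= 0 -> clamp x = 0.
Proof.
  intros Hx. pose proof PI_RGT_0. unfold clamp.
  rewrite Rmin_right by lra. now rewrite Rmax_left.
Qed.

Lemma clamp_high x : PI / 2 <= x -> clamp x = PI / 2.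
Proof.
  intros Hx. pose proof PI_RGT_0. unfold clamp.
  rewrite Rmin_left by lra. rewrite Rmax_right; lra.
Qed.

Lemma clamp_monotone x y : x <= y -> clamp x <= clamp y /\ x - clamp x <= y - clamp y.
Proof.
  intros Hxy. unfold clamp, Rmax, Rmin. pose proof PI_RGT_0.
  repeat destruct Rle_dec; lra.
Qed.

Lemma clamp_lipschitz x y : Rabs (clamp y - clamp x) <= Rabs (y - x).
Proof.
  destruct (Rle_or_lt x y) as [H|H].
  - destruct (clamp_monotone x y H). rewrite !Rabs_pos_eq; lra.
  - destruct (clamp_monotone y x ltac:(lra)). rewrite !Rabs_left1; lra.
Qed.

(** Composition with [clamp] turns one-sided continuity at the ends of the quarter into
    continuity on the line, as the mean value theorem requires. *)
Lemma continuous_clamp (f : R -> R) :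
  (forall x, quarter x -> continue_in f quarter x) ->
  forall x, continuous (fun y => f (clamp y)) x.
Proof.
  intros Hf x. apply continuity_pt_filterlim. intros eps Heps.
  destruct (Hf (clamp x) (clamp_quarter x) eps Heps) as [d [Hd H]].
  exists d. split; [exact Hd|]. intros y [_ Hy]. simpl in *. unfold R_dist in *.
  destruct (Req_dec (clamp y) (clamp x)) as [->|Hne].
  - rewrite Rminus_diag. now rewrite Rabs_R0.
  - apply H. split.
    + split; [apply clamp_quarter|]. intros E. now apply Hne.
    + eapply Rle_lt_trans; [apply clamp_lipschitz|exact Hy].
Qed.

Lemma is_derive_in_unique f x l1 l2 : quarter x ->
  is_derive_in quarter f x l1 -> is_derive_in quarter f x l2 -> l1 = l2.
Proof.
  intros [Hx1 Hx2] H1 H2. refine (single_limit _ _ _ _ _ _ H1 H2).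
  intros d Hd. pose proof PI_RGT_0 as HPI.
  destruct (Rlt_or_le x (PI / 2)) as [Hl|Hl].
  - set (m := Rmin (PI / 2 - x) d).
    assert (Hm : 0 < m) by (apply Rmin_glb_lt; lra).
    pose proof (Rmin_l (PI / 2 - x) d) as M1. pose proof (Rmin_r (PI / 2 - x) d) as M2.
    fold m in M1, M2.
    exists (x + m / 2). unfold D_x, quarter, R_dist.
    replace (x + m / 2 - x) with (m / 2) by ring. rewrite Rabs_pos_eq; lra.
  - set (m := Rmin (PI / 2) d).
    assert (Hm : 0 < m) by (apply Rmin_glb_lt; lra).
    pose proof (Rmin_l (PI / 2) d) as M1. pose proof (Rmin_r (PI / 2) d) as M2.
    fold m in M1, M2.
    exists (x - m / 2). unfold D_x, quarter, R_dist.
    replace (x - m / 2 - x) with (- (m / 2)) by ring. rewrite Rabs_Ropp, Rabs_pos_eq; lra.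
Qed.

Lemma Derive_in_unique f x l : quarter x -> is_derive_in quarter f x l -> Derive_in quarter f x = l.
Proof.
  intros Hx Hl. unfold Derive_in. apply (iota_unique (V := R_CompleteNormedModule)); [|exact Hl].
  intros y Hy. now apply (is_derive_in_unique f x).
Qed.

Lemma is_derive_in_of_global f g (D : R -> Prop) x l : D x -> (forall y, D y -> f y = g y) ->
  is_derive g x l -> is_derive_in D f x l.
Proof.
  intros Dx E Hg. apply is_derive_Reals in Hg. intros eps Heps.
  destruct (Hg eps Heps) as [d Hd]. exists d. split; [apply d|].
  intros y [[Dy Hne] Hy]. simpl in *. unfold R_dist in *.
  rewrite !E by assumption. specialize (Hd (y - x) ltac:(lra) Hy).
  replace (x + (y - x)) with y in Hd by ring. exact Hd.
Qed.

Lemma is_derive_in_interior f x l : 0 < x < PI / 2 -> is_derive_in quarter f x l -> is_derive f x l.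
Proof.
  intros Hx Hf. apply is_derive_Reals. intros eps Heps.
  destruct (Hf eps Heps) as [d [Hd H]].
  assert (Hm : 0 < Rmin d (Rmin x (PI / 2 - x))) by (repeat apply Rmin_glb_lt; lra).
  exists (mkposreal _ Hm). simpl. intros e He He2.
  pose proof (Rmin_l d (Rmin x (PI / 2 - x))). pose proof (Rmin_r d (Rmin x (PI / 2 - x))).
  pose proof (Rmin_l x (PI / 2 - x)). pose proof (Rmin_r x (PI / 2 - x)).
  specialize (H (x + e)). simpl in H. unfold R_dist in H.
  replace (x + e - x) with e in H by ring. apply H. split; [|lra].
  assert (Hb : Rabs e < Rmin x (PI / 2 - x)) by lra. apply Rabs_lt_between in Hb.
  unfold D_x, quarter. lra.
Qed.

Lemma is_derive_primitive (G : R -> R) x : (forall x, continuous G x) ->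
  is_derive (fun x => RInt G 0 x) x (G x).
Proof.
  intros Gc. apply (is_derive_RInt G (fun x => RInt G 0 x) 0 x); [|apply Gc].
  exists (mkposreal 1 Rlt_0_1). intros y _. apply (RInt_correct (V := R_CompleteNormedModule)).
  apply (ex_RInt_continuous (V := R_CompleteNormedModule)). intros z _. apply Gc.
Qed.

(** Integrate an extension of the derivative, and compare on the quarter by the mean value
    theorem. *)
Lemma extend_primitive (f G : R -> R) :
  (forall x, continuous G x) -> (forall x, quarter x -> is_derive_in quarter f x (G x)) ->
  (forall x, is_derive (fun x => f 0 + RInt G 0 x) x (G x)) /\
  (forall x, quarter x -> f 0 + RInt G 0 x = f x).
Proof.
  intros Gc Hf. set (F := fun x => f 0 + RInt G 0 x).
  assert (DF : forall x, is_derive F x (G x)).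
  { intros x. unfold F. replace (G x) with (0 + G x) by ring.
    apply (is_derive_plus (K := R_AbsRing) (V := R_NormedModule)); [apply (is_derive_const (K := R_AbsRing) (V := R_NormedModule))|].
    now apply is_derive_primitive. }
  split; [exact DF|]. intros x Hx.
  assert (Cf : forall y, continuous (fun z => f (clamp z)) y).
  { apply continuous_clamp. intros y Hy. eapply cont_deriv.
    apply (Hf y Hy). }
  set (g := fun y => F y - f (clamp y)).
  destruct (MVT_gen g 0 x (fun _ => 0)) as [c [_ Hc]].
  - destruct Hx as [Hx1 Hx2]. rewrite Rmin_left, Rmax_right by lra. intros y Hy.
    unfold g. replace 0 with (G y - G y) by ring.
    apply (is_derive_minus (K := R_AbsRing) (V := R_NormedModule)); [apply DF|].
    apply (is_derive_ext_loc f).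
    + assert (Hm : 0 < Rmin y (x - y)) by (apply Rmin_glb_lt; lra).
      exists (mkposreal _ Hm). intros z Hz. change (Rabs (z - y) < Rmin y (x - y)) in Hz.
      pose proof (Rmin_l y (x - y)). pose proof (Rmin_r y (x - y)).
      apply Rabs_lt_between' in Hz. rewrite clamp_id; [reflexivity|]. unfold quarter; lra.
    + apply is_derive_in_interior; [lra|]. apply Hf. unfold quarter; lra.
  - intros y _. apply continuity_pt_filterlim.
    apply (continuous_minus (V := R_NormedModule)); [|apply Cf].
    apply (continuous_of_derive F y (G y)), DF.
  - assert (Q0 : quarter 0) by (unfold quarter; pose proof PI_RGT_0; lra).
    unfold g, F in Hc. rewrite (clamp_id x Hx), (clamp_id 0 Q0), RInt_point in Hc.
    unfold zero in Hc; simpl in Hc. lra.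
Qed.

(** Extend the second derivative by constants and integrate twice. *)
Lemma C2_extension (r : R -> R) : C_n_in quarter 2 r ->
  exists r0 r1 r2 : R -> R,
    (forall x, is_derive r0 x (r1 x)) /\ (forall x, is_derive r1 x (r2 x)) /\
    (forall x, continuous r2 x) /\
    (forall x, quarter x -> r0 x = r x /\ r1 x = d_quarter 1 r x /\ r2 x = d_quarter 2 r x).
Proof.
  intros [Hd Hc].
  assert (D : forall k x, (k < 2)%nat -> quarter x ->
     is_derive_in quarter (Derive_n_in quarter k r) x (Derive_n_in quarter (S k) r x)).
  { intros k x Hk Hx. destruct (Hd k x Hk Hx) as [l Hl]. simpl.
    now rewrite (Derive_in_unique _ x l Hx Hl). }
  set (r2 := fun x => d_quarter 2 r (clamp x)).
  assert (C2 : forall x, continuous r2 x) by (apply continuous_clamp; exact Hc).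
  destruct (extend_primitive (d_quarter 1 r) r2 C2) as [D1 E1].
  { intros x Hx. unfold r2. rewrite (clamp_id x Hx). apply (D 1%nat x); [lia|exact Hx]. }
  set (r1 := fun x => d_quarter 1 r 0 + RInt r2 0 x) in *.
  assert (C1 : forall x, continuous r1 x).
  { intros x. apply (continuous_of_derive r1 x (r2 x)), D1. }
  destruct (extend_primitive r r1 C1) as [D0 E0].
  { intros x Hx. unfold r1. rewrite (E1 x Hx). apply (D 0%nat x); [lia|exact Hx]. }
  exists (fun x => r 0 + RInt r1 0 x), r1, r2.
  split; [exact D0|split; [exact D1|split; [exact C2|]]].
  intros x Hx. split; [now apply E0|split; [now apply E1|]]. unfold r2. now rewrite clamp_id.
Qed.

(** * Intervals are not null *)

(** The supremum of the points reached from [a] can be passed unless it is [b]. *)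
Lemma interval_induction (P : R -> R -> Prop) (a b : R) : a <= b ->
  (forall x, a <= x <= b -> exists d, 0 < d /\ forall u v, x - d < u -> u <= v -> v < x + d -> P u v) ->
  (forall u v w, u <= v -> v <= w -> P u v -> P v w -> P u w) -> P a b.
Proof.
  intros Hab Hloc Hcat.
  set (E := fun x => a <= x <= b /\ P a x).
  assert (Ea : E a).
  { split; [lra|]. destruct (Hloc a ltac:(lra)) as [d [Hd HP]]. apply HP; lra. }
  destruct (completeness E) as [s [Hub Hlub]].
  { exists b. intros x [Hx _]. lra. } { now exists a. }
  assert (Hs : a <= s <= b).
  { split; [now apply Hub|]. apply Hlub. intros x [Hx _]. lra. }
  destruct (Hloc s Hs) as [d [Hd HP]].
  assert (Hx : exists x, E x /\ s - d < x).
  { apply NNPP. intros Hno. assert (s <= s - d); [|lra]. apply Hlub. intros x Ex.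
    apply Rnot_lt_le. intros Hlt. apply Hno. now exists x. }
  destruct Hx as [x [Ex Hxd]]. pose proof (Hub x Ex) as Hxs. destruct Ex as [Hx Px].
  assert (Step : forall y, x <= y -> y < s + d -> P a y).
  { intros y H1 H2. apply (Hcat a x y); try lra; [exact Px|]. apply HP; lra. }
  destruct (Rlt_or_le b (s + d)) as [L|L]; [apply Step; lra|].
  exfalso. assert (Ey : E (s + d / 2)) by (split; [lra|apply Step; lra]).
  pose proof (Hub _ Ey). lra.
Qed.

Section Cover.
Context (a b : nat -> R) (Hab : forall n, a n <= b n).

(** Length of the part of the [n]-th interval to the left of [x]. *)
Definition covered (n : nat) (x : R) : R := Rmax 0 (Rmin (b n) x - a n).

Lemma covered_bounds n x y : x <= y -> 0 <= covered n y - covered n x <= b n - a n.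
Proof.
  intros Hxy. pose proof (Hab n). unfold covered, Rmax, Rmin. repeat destruct Rle_dec; lra.
Qed.

Lemma covered_inside n x y : a n <= x -> x <= y -> y <= b n -> covered n y - covered n x = y - x.
Proof. intros. unfold covered, Rmax, Rmin. repeat destruct Rle_dec; lra. Qed.

Definition covered_sum (m : nat) (x : R) : R := sum_f_R0 (fun n => covered n x) m.

Lemma covered_sum_bounds m x y : x <= y ->
  0 <= covered_sum m y - covered_sum m x <= sum_f_R0 (fun n => b n - a n) m.
Proof.
  intros Hxy. unfold covered_sum. induction m as [|m IH]; simpl.
  - now apply covered_bounds.
  - pose proof (covered_bounds (S m) x y Hxy). lra.
Qed.

Lemma covered_sum_ge n m x y : (n <= m)%nat -> x <= y ->
  covered n y - covered n x <= covered_sum m y - covered_sum m x.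
Proof.
  intros Hnm Hxy. unfold covered_sum. induction m as [|m IH]; simpl.
  - assert (n = 0%nat) as -> by lia. lra.
  - destruct (Nat.eq_dec n (S m)) as [->|Hne].
    + pose proof (covered_sum_bounds m x y Hxy) as Q. unfold covered_sum in Q. lra.
    + specialize (IH ltac:(lia)). pose proof (covered_bounds (S m) x y Hxy). lra.
Qed.

Lemma covered_sum_mono m m' x y : (m <= m')%nat -> x <= y ->
  covered_sum m y - covered_sum m x <= covered_sum m' y - covered_sum m' x.
Proof.
  intros Hm Hxy. induction Hm as [|m' Hm IH]; [lra|].
  unfold covered_sum in *. simpl. pose proof (covered_bounds (S m') x y Hxy). lra.
Qed.

(** Close to each point a single interval suffices, and the bounds add up under
    concatenation. *)
Lemma cover_length (c d : R) : c <= d -> (forall x, c <= x <= d -> exists n, a n < x < b n) ->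
  exists m, d - c <= sum_f_R0 (fun n => b n - a n) m.
Proof.
  intros Hcd Hcov.
  assert (HP : exists m, d - c <= covered_sum m d - covered_sum m c).
  { apply (interval_induction (fun u v => exists m, v - u <= covered_sum m v - covered_sum m u));
      [exact Hcd| |].
    - intros x Hx. destruct (Hcov x Hx) as [n Hn].
      exists (Rmin (x - a n) (b n - x)). split; [apply Rmin_glb_lt; lra|].
      intros u v Hu Huv Hv. pose proof (Rmin_l (x - a n) (b n - x)).
      pose proof (Rmin_r (x - a n) (b n - x)). exists n.
      pose proof (covered_sum_ge n n u v ltac:(lia) Huv).
      rewrite covered_inside in H1 by lra. exact H1.
    - intros u v w Huv Hvw [m1 H1] [m2 H2]. exists (max m1 m2).
      pose proof (covered_sum_mono m1 (max m1 m2) u v ltac:(lia) Huv).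
      pose proof (covered_sum_mono m2 (max m1 m2) v w ltac:(lia) Hvw). lra. }
  destruct HP as [m Hm]. exists m. pose proof (covered_sum_bounds m c d Hcd). lra.
Qed.

End Cover.

(** Intervals of total length at most a quarter of [d - c] cannot cover the middle half. *)
Lemma interval_not_null (A : R -> Prop) (c d : R) : c < d -> (forall x, c < x < d -> A x) -> ~ null_set A.
Proof.
  intros Hcd HA HN. set (e := (d - c) / 4).
  destruct (HN e ltac:(unfold e; lra)) as [a [b [Hab [Hcov [Hex Hser]]]]].
  destruct (cover_length a b Hab (c + e) (d - e)) as [m Hm].
  - unfold e; lra.
  - intros x Hx. apply Hcov, HA. unfold e in Hx. lra.
  - assert (sum_f_R0 (fun n => b n - a n) m <= Series (fun n => b n - a n)).
    { rewrite <- sum_n_Reals.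
      apply (is_lim_seq_incr_compare (sum_n (fun n => b n - a n))).
      - apply (Series_correct _ Hex).
      - intros n. rewrite sum_Sn. unfold plus; simpl. pose proof (Hab (S n)). lra. }
    unfold e in *. lra.
Qed.

(** * The construction in polar coordinates *)

(** The bound on the displacement makes the intermediate value theorem applicable at
    every height. *)
Lemma increasing_inverse (T : R -> R) (C : R) : (forall x, continuous T x) ->
  (forall a b, a < b -> T a < T b) -> (forall x, x <= T x <= x + C) ->
  exists s : R -> R, (forall y, T (s y) = y) /\ (forall x, s (T x) = x) /\
    (forall y, continuous s y).
Proof.
  intros Hc Hi Hb.
  assert (Tc : continuity T) by (intros x; apply continuity_pt_filterlim, Hc).
  assert (HC : 0 <= C) by (pose proof (Hb 0); lra).
  assert (Hy : forall y, Rmin (T (y - C)) (T y) <= y <= Rmax (T (y - C)) (T y)).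
  { intros y. pose proof (Hb (y - C)). pose proof (Hb y). split.
    - apply Rle_trans with (T (y - C)); [apply Rmin_l|lra].
    - apply Rle_trans with (T y); [lra|apply Rmax_r]. }
  pose (s := fun y => proj1_sig (IVT_gen T (y - C) y y Tc (Hy y))).
  assert (Ts : forall y, T (s y) = y).
  { intros y. exact (proj2 (proj2_sig (IVT_gen T (y - C) y y Tc (Hy y)))). }
  assert (inj : forall x y, T x = T y -> x = y).
  { intros x y E. destruct (Rtotal_order x y) as [L|[L|L]]; [|exact L|];
      pose proof (Hi _ _ L); lra. }
  assert (lt_inv : forall x y, T x < T y -> x < y).
  { intros x y L. destruct (Rtotal_order x y) as [L'|[L'|L']]; [exact L'| |].
    - subst; lra. - pose proof (Hi _ _ L'). lra. }
  exists s. split; [exact Ts|]. split; [intros x; apply inj, Ts|].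
  intros y. apply continuity_pt_filterlim. intros eps Heps.
  pose proof (Hi (s y) (s y + eps) ltac:(lra)). pose proof (Hi (s y - eps) (s y) ltac:(lra)).
  rewrite Ts in *.
  exists (Rmin (T (s y + eps) - y) (y - T (s y - eps))).
  split; [apply Rmin_glb_lt; lra|]. intros z [_ Hz]. simpl in *. unfold R_dist in *.
  pose proof (Rmin_l (T (s y + eps) - y) (y - T (s y - eps))).
  pose proof (Rmin_r (T (s y + eps) - y) (y - T (s y - eps))).
  apply Rabs_lt_between in Hz. apply Rabs_lt_between'.
  split; apply lt_inv; rewrite Ts; lra.
Qed.

(** The representative of [x] in the interval from 0 to [PI] used by [rtilde]. *)
Definition residue (x : R) : R := x - PI * IZR (Int_part (x / PI)).

Lemma residue_bounds x : 0 <= residue x < PI.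
Proof.
  unfold residue. destruct (base_Int_part (x / PI)) as [H1 H2]. pose proof PI_RGT_0.
  assert (E : x = PI * (x / PI)) by (field; lra).
  set (n := IZR (Int_part (x / PI))) in *. nra.
Qed.

Lemma residue_eq x n : 0 <= x - IZR n * PI < PI -> residue x = x - IZR n * PI.
Proof.
  intros H. unfold residue. pose proof PI_RGT_0.
  rewrite <- (Int_part_spec (x / PI) n); [ring|].
  assert (E : x = x / PI * PI) by (field; lra). nra.
Qed.

Lemma residue_periodic x : residue (x + PI) = residue x.
Proof.
  pose proof (residue_bounds x). unfold residue in H.
  rewrite (residue_eq (x + PI) (Int_part (x / PI) + 1)).
  - unfold residue. rewrite plus_IZR. ring.
  - rewrite plus_IZR. replace (x + PI - (IZR (Int_part (x / PI)) + 1) * PI)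
      with (x - PI * IZR (Int_part (x / PI))) by ring. exact H.
Qed.

(** On two consecutive periods the periodization is a sum of two translates. *)
Lemma periodize_continuous (f : R -> R) : (forall x, continuous f x) ->
  (forall x, x <= 0 -> f x = 0) -> (forall x, PI <= x -> f x = 0) ->
  forall x, continuous (fun y => f (residue y)) x.
Proof.
  intros Hc H0 H1 x. pose proof PI_RGT_0 as HPI.
  pose proof (residue_bounds x) as Hr. unfold residue in Hr.
  set (n := Int_part (x / PI)) in *.
  set (g := fun y => f (y - IZR n * PI) + f (y - IZR (n - 1) * PI)).
  assert (Hg : continuous g x).
  { unfold g. apply (continuous_plus (V := R_NormedModule));
      apply (continuous_comp (fun y => y - _) f); try apply Hc;
      apply (continuous_minus (V := R_NormedModule));
      try apply continuous_id; apply continuous_const. }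
  apply (continuous_ext_loc _ g); [|exact Hg].
  assert (Hm : 0 < PI - (x - PI * IZR n)) by lra.
  exists (mkposreal _ (Rmin_pos _ _ HPI Hm)). intros y Hy.
  change (Rabs (y - x) < Rmin PI (PI - (x - PI * IZR n))) in Hy.
  pose proof (Rmin_l PI (PI - (x - PI * IZR n))).
  pose proof (Rmin_r PI (PI - (x - PI * IZR n))).
  apply Rabs_lt_between' in Hy. change (g y = f (residue y) :> R). unfold g.
  assert (E1 : IZR (n - 1) = IZR n - 1) by (rewrite minus_IZR; ring).
  destruct (Rle_or_lt (IZR n * PI) y) as [L|L].
  - rewrite (residue_eq y n) by lra. rewrite (H1 (y - IZR (n - 1) * PI)) by (rewrite E1; lra). ring.
  - rewrite (residue_eq y (n - 1)) by (rewrite E1; lra). rewrite (H0 (y - IZR n * PI)) by lra. ring.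
Qed.

Lemma zero_derive_constant (f df : R -> R) (a b : R) : a <= b ->
  (forall x, a <= x <= b -> is_derive f x (df x)) -> (forall x, a <= x <= b -> df x = 0) ->
  f b = f a.
Proof.
  intros Hab Hd H0. destruct (MVT_gen f a b df) as [c [Hc E]];
    rewrite ?Rmin_left, ?Rmax_right in * by exact Hab.
  - intros x Hx. apply Hd. lra.
  - intros x Hx. apply continuity_pt_filterlim. apply (continuous_of_derive f x (df x)), Hd, Hx.
  - rewrite H0 in E by exact Hc. lra.
Qed.

Section Construction.
Context (r : R -> R) (rs : R) (Hpos : pos_on_quarter r)
  (Hae : ae_in quarter (curvature_ineq r)) (Hrs : 1 <= rs) (Hb : boundary_cond r rs)
  (r0 r1 r2 : R -> R)
  (D0 : forall x, is_derive r0 x (r1 x)) (D1 : forall x, is_derive r1 x (r2 x))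
  (Cr2 : forall x, continuous r2 x)
  (Eq : forall x, quarter x -> r0 x = r x /\ r1 x = d_quarter 1 r x /\ r2 x = d_quarter 2 r x).

Lemma quarter_r0_pos x : quarter x -> 0 < r0 x.
Proof. intros Hx. destruct (Eq x Hx) as [-> _]. now apply Hpos. Qed.

Lemma quarter_0 : quarter 0.
Proof. unfold quarter. pose proof PI_RGT_0. lra. Qed.

Lemma quarter_PI2 : quarter (PI / 2).
Proof. unfold quarter. pose proof PI_RGT_0. lra. Qed.

Lemma boundary_values : r0 0 = 1 /\ r0 (PI / 2) = rs /\ r1 0 = 0 /\ r1 (PI / 2) = 0.
Proof.
  destruct (Eq 0 quarter_0) as [-> [-> _]]. destruct (Eq (PI / 2) quarter_PI2) as [-> [-> _]].
  exact Hb.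
Qed.

(** The logarithmic derivative of [r], continued by 0 since [r'] vanishes at both ends. *)
Definition slope (x : R) : R := r1 (clamp x) / r0 (clamp x).

Lemma slope_quarter x : quarter x -> slope x = r1 x / r0 x.
Proof. intros Hx. unfold slope. now rewrite clamp_id. Qed.

Lemma slope_low x : x <= 0 -> slope x = 0.
Proof.
  intros Hx. unfold slope. rewrite (clamp_low x Hx).
  destruct boundary_values as [_ [_ [-> _]]]. unfold Rdiv. ring.
Qed.

Lemma slope_high x : PI / 2 <= x -> slope x = 0.
Proof.
  intros Hx. unfold slope. rewrite (clamp_high x Hx).
  destruct boundary_values as [_ [_ [_ ->]]]. unfold Rdiv. ring.
Qed.

Lemma continuous_global_clamp (f : R -> R) x : (forall x, continuous f x) ->
  continuous (fun y => f (clamp y)) x.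
Proof.
  intros Hf. apply (continuous_comp clamp f); [|apply Hf].
  intros P [e He]. exists e. intros y Hy. apply He.
  change (Rabs (clamp y - clamp x) < e). change (Rabs (y - x) < e) in Hy.
  pose proof (clamp_lipschitz x y). lra.
Qed.

Lemma slope_continuous x : continuous slope x.
Proof.
  unfold slope. apply (continuous_mult (K := R_AbsRing)).
  - apply continuous_global_clamp. intros y. apply (continuous_of_derive r1 y (r2 y)), D1.
  - apply continuous_Rinv_comp.
    + apply continuous_global_clamp. intros y. apply (continuous_of_derive r0 y (r1 y)), D0.
    + pose proof (quarter_r0_pos (clamp x) (clamp_quarter x)). lra.
Qed.

(** Continuation of [tau] to the line by translations, so that its inverse is defined
    everywhere. *)
Definition tau_ext (x : R) : R := PI / 2 + x - atan (slope x).

Lemma tau_ext_quarter x : quarter x -> tau r x = tau_ext x.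
Proof.
  intros Hx. unfold tau, tau_ext. rewrite (slope_quarter x Hx).
  destruct (Eq x Hx) as [-> [-> _]]. reflexivity.
Qed.

Lemma tau_ext_clamp x : tau_ext x = tau_ext (clamp x) + (x - clamp x).
Proof. unfold tau_ext, slope. rewrite (clamp_id (clamp x) (clamp_quarter x)). ring. Qed.

Lemma tau_ext_continuous x : continuous tau_ext x.
Proof.
  unfold tau_ext. apply (continuous_minus (V := R_NormedModule)).
  - apply (continuous_plus (V := R_NormedModule)); [apply continuous_const|apply continuous_id].
  - apply (continuous_comp slope atan); [apply slope_continuous|apply continuous_atan].
Qed.

(** Equal to [tau_ext] on the quarter, but differentiable also at its ends. *)
Definition tau_loc (x : R) : R := PI / 2 + x - atan (r1 x / r0 x).
Definition curv (x : R) : R := r0 x ^ 2 + 2 * r1 x ^ 2 - r0 x * r2 x.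

Lemma tau_loc_quarter x : quarter x -> tau_loc x = tau_ext x.
Proof. intros Hx. unfold tau_loc, tau_ext. now rewrite slope_quarter. Qed.

Lemma tau_loc_derive x : 0 < r0 x -> is_derive tau_loc x (curv x / (r0 x ^ 2 + r1 x ^ 2)).
Proof.
  intros Hx. unfold tau_loc, curv. pose proof (D0 x) as E0. pose proof (D1 x) as E1.
  auto_derive. { repeat split; try (eexists; eassumption). lra. }
  derive_rw E0. derive_rw E1. field. pose proof (pow2_ge_0 (r1 x)). repeat split; nra.
Qed.

(** An interval is not null, so the inequality that holds almost everywhere holds somewhere
    in it. *)
Lemma curv_dense a b : 0 <= a -> a < b -> b <= PI / 2 -> exists x, a < x < b /\ 0 < curv x.
Proof.
  intros Ha Hab Hbb. apply NNPP. intros Hno. apply (interval_not_null _ a b Hab) in Hae; [easy|].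
  intros x Hx. assert (Qx : quarter x) by (unfold quarter; lra). split; [exact Qx|].
  intros Hcu. apply Hno. exists x. split; [exact Hx|].
  destruct (Eq x Qx) as [E0 [E1 E2]]. unfold curvature_ineq in Hcu. unfold curv.
  rewrite E0, E1, E2. lra.
Qed.

Lemma curv_continuous x : continuous curv x.
Proof.
  assert (C0 : continuous r0 x) by apply (continuous_of_derive r0 x (r1 x)), D0.
  assert (C1 : continuous r1 x) by apply (continuous_of_derive r1 x (r2 x)), D1.
  unfold curv. apply (continuous_ext (fun x => r0 x * r0 x + 2 * (r1 x * r1 x) - r0 x * r2 x)).
  { intros y. change (r0 y * r0 y + 2 * (r1 y * r1 y) - r0 y * r2 y = r0 y ^ 2 + 2 * r1 y ^ 2 - r0 y * r2 y :> R). ring. }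
  apply (continuous_minus (V := R_NormedModule)); [apply (continuous_plus (V := R_NormedModule))|];
    repeat apply (continuous_mult (K := R_AbsRing)); try assumption; try apply Cr2.
  apply continuous_const.
Qed.

(** A negative value at a point of the quarter would persist on an interval of the quarter. *)
Lemma curv_nonneg x : quarter x -> 0 <= curv x.
Proof.
  intros [Hx1 Hx2]. apply Rnot_lt_le. intros Hn. pose proof PI_RGT_0 as HPI.
  destruct (curv_continuous x _ (locally_ball _ (mkposreal (- curv x) ltac:(lra)))) as [d Hd].
  assert (Hn' : forall y, Rabs (y - x) < d -> curv y < 0).
  { intros y Hy. specialize (Hd y Hy). change (Rabs (curv y - curv x) < - curv x) in Hd.
    apply Rabs_lt_between' in Hd. lra. }
  assert (Hdp := cond_pos d).
  assert (HI : exists a b, 0 <= a /\ a < b /\ b <= PI / 2 /\ x - d < a /\ b < x + d).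
  { destruct (Rlt_or_le x (PI / 2)) as [L|L].
    - exists x, (Rmin (PI / 2) (x + d / 2)).
      pose proof (Rmin_l (PI / 2) (x + d / 2)). pose proof (Rmin_r (PI / 2) (x + d / 2)).
      assert (x < Rmin (PI / 2) (x + d / 2)) by (apply Rmin_glb_lt; lra). lra.
    - exists (Rmax 0 (x - d / 2)), x.
      pose proof (Rmax_l 0 (x - d / 2)). pose proof (Rmax_r 0 (x - d / 2)).
      assert (Rmax 0 (x - d / 2) < x) by (apply Rmax_lub_lt; lra). lra. }
  destruct HI as [a [b [Ha [Hab [Hbb [Hl Hr]]]]]].
  destruct (curv_dense a b Ha Hab Hbb) as [y [Hy Hcy]].
  assert (curv y < 0); [|lra]. apply Hn'. apply Rabs_lt_between'. lra.
Qed.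

Lemma tau_ext_le a b : quarter a -> quarter b -> a <= b -> tau_ext a <= tau_ext b.
Proof.
  intros Qa Qb Hab. rewrite <- !tau_loc_quarter by assumption.
  destruct Qa as [A1 A2], Qb as [B1 B2].
  destruct (MVT_gen tau_loc a b (fun x => curv x / (r0 x ^ 2 + r1 x ^ 2))) as [c [Hc E]];
    rewrite ?Rmin_left, ?Rmax_right in * by exact Hab.
  - intros x Hx. apply tau_loc_derive, quarter_r0_pos. unfold quarter; lra.
  - intros x Hx. apply continuity_pt_filterlim.
    apply (continuous_of_derive tau_loc x (curv x / (r0 x ^ 2 + r1 x ^ 2))).
    apply tau_loc_derive, quarter_r0_pos. unfold quarter; lra.
  - assert (Qc : quarter c) by (unfold quarter; lra).
    pose proof (curv_nonneg c Qc). pose proof (quarter_r0_pos c Qc).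
    pose proof (pow2_ge_0 (r1 c)).
    assert (0 <= curv c / (r0 c ^ 2 + r1 c ^ 2)).
    { apply Rmult_le_pos; [exact H|]. apply Rlt_le, Rinv_0_lt_compat. nra. }
    nra.
Qed.

(** If [tau] took equal values at two points it would be constant between them, and its
    derivative would vanish on a whole interval. *)
Lemma tau_ext_lt a b : quarter a -> quarter b -> a < b -> tau_ext a < tau_ext b.
Proof.
  intros Qa Qb Hab. pose proof (tau_ext_le a b Qa Qb ltac:(lra)) as Hle.
  destruct Hle as [Hlt|E]; [exact Hlt|exfalso].
  destruct (curv_dense a b ltac:(apply Qa) Hab ltac:(apply Qb)) as [x [Hx Hcx]].
  assert (Qx : forall y, a < y < b -> quarter y).
  { intros y Hy. destruct Qa, Qb. unfold quarter; lra. }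
  assert (Z : is_derive tau_loc x 0).
  { apply (is_derive_ext_loc (fun _ => tau_ext a)).
    - assert (Hm : 0 < Rmin (x - a) (b - x)) by (apply Rmin_glb_lt; lra).
      exists (mkposreal _ Hm). intros y Hy. change (Rabs (y - x) < Rmin (x - a) (b - x)) in Hy.
      pose proof (Rmin_l (x - a) (b - x)). pose proof (Rmin_r (x - a) (b - x)).
      apply Rabs_lt_between' in Hy. assert (Hy' : a < y < b) by lra.
      rewrite tau_loc_quarter by (apply Qx, Hy').
      pose proof (tau_ext_le a y Qa (Qx y Hy') ltac:(lra)).
      pose proof (tau_ext_le y b (Qx y Hy') Qb ltac:(lra)). lra.
    - apply (is_derive_const (K := R_AbsRing) (V := R_NormedModule)). }
  pose proof (quarter_r0_pos x (Qx x Hx)) as Hp.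
  pose proof (tau_loc_derive x Hp) as W.
  pose proof (is_derive_unique _ _ _ Z) as U1. pose proof (is_derive_unique _ _ _ W) as U2.
  rewrite U1 in U2. pose proof (pow2_ge_0 (r1 x)).
  assert (0 < curv x / (r0 x ^ 2 + r1 x ^ 2)) by (apply Rdiv_lt_0_compat; [exact Hcx|nra]).
  lra.
Qed.

Lemma tau_ext_increasing a b : a < b -> tau_ext a < tau_ext b.
Proof.
  intros Hab. rewrite (tau_ext_clamp a), (tau_ext_clamp b).
  destruct (clamp_monotone a b ltac:(lra)) as [[L|E] H2].
  - pose proof (tau_ext_lt (clamp a) (clamp b) (clamp_quarter a) (clamp_quarter b) L). lra.
  - rewrite E in *. lra.
Qed.

Lemma tau_ext_0 : tau_ext 0 = PI / 2.
Proof. unfold tau_ext. rewrite slope_low, atan_0 by lra. ring. Qed.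

Lemma tau_ext_PI2 : tau_ext (PI / 2) = PI.
Proof. unfold tau_ext. rewrite slope_high, atan_0 by lra. field. Qed.

Context (s : R -> R) (Ts : forall y, tau_ext (s y) = y) (sT : forall x, s (tau_ext x) = x)
  (sc : forall y, continuous s y).

Lemma inverse_le x y : x <= tau_ext y -> s x <= y.
Proof.
  intros Hxy. apply Rnot_lt_le. intros L. apply tau_ext_increasing in L. rewrite Ts in L. lra.
Qed.

Lemma inverse_ge x y : tau_ext y <= x -> y <= s x.
Proof.
  intros Hxy. apply Rnot_lt_le. intros L. apply tau_ext_increasing in L. rewrite Ts in L. lra.
Qed.

Lemma inverse_quarter x : PI / 2 <= x <= PI -> quarter (s x).
Proof.
  intros Hx. split.
  - apply inverse_ge. rewrite tau_ext_0. lra.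
  - apply inverse_le. rewrite tau_ext_PI2. lra.
Qed.

(** The prescribed logarithmic derivative of the radius over one period: the first term is
    supported in the first quarter and the second one, where [s] is the inverse of [tau], in
    the second quarter. *)
Definition logder0 (x : R) : R := slope x - slope (s x).

Definition logder (x : R) : R := logder0 (residue x).

Lemma logder_continuous x : continuous logder x.
Proof.
  apply periodize_continuous.
  - intros y. unfold logder0. apply (continuous_minus (V := R_NormedModule)).
    + apply slope_continuous.
    + apply (continuous_comp s slope); [apply sc|apply slope_continuous].
  - intros y Hy. unfold logder0. pose proof PI_RGT_0.
    rewrite !slope_low; [ring| |exact Hy]. apply inverse_le. rewrite tau_ext_0. lra.
  - intros y Hy. unfold logder0. pose proof PI_RGT_0.
    rewrite !slope_high; [ring| |lra]. apply inverse_ge. rewrite tau_ext_PI2. lra.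
Qed.

Lemma logder_period x : logder (x + PI) = logder x.
Proof. unfold logder. now rewrite residue_periodic. Qed.

Lemma logder_first x : quarter x -> logder x = r1 x / r0 x.
Proof.
  intros Hx. pose proof PI_RGT_0. unfold logder. destruct Hx as [H1 H2].
  rewrite (residue_eq x 0) by lra. replace (x - 0 * PI) with x by ring.
  unfold logder0. rewrite (slope_low (s x)).
  - rewrite slope_quarter by (unfold quarter; lra). ring.
  - apply inverse_le. rewrite tau_ext_0. exact H2.
Qed.

(** The end [PI] of the second quarter has residue 0, and both sides vanish there. *)
Lemma logder_second x : quarter x -> logder (tau_ext x) = - (r1 x / r0 x).
Proof.
  intros Hx. pose proof PI_RGT_0 as HPI. rewrite <- (slope_quarter x Hx).
  pose proof (tau_ext_le 0 x quarter_0 Hx ltac:(apply Hx)) as L1. rewrite tau_ext_0 in L1.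
  pose proof (tau_ext_le x (PI / 2) Hx quarter_PI2 ltac:(apply Hx)) as L2. rewrite tau_ext_PI2 in L2.
  destruct L2 as [L2|L2].
  - unfold logder. rewrite (residue_eq (tau_ext x) 0) by lra.
    replace (tau_ext x - 0 * PI) with (tau_ext x) by ring.
    unfold logder0. rewrite sT. rewrite (slope_high (tau_ext x)) by lra. ring.
  - assert (Ex : x = PI / 2) by (rewrite <- (sT x), <- (sT (PI / 2)), L2, tau_ext_PI2; reflexivity).
    rewrite L2. replace PI with (0 + PI) at 1 by ring. rewrite logder_period.
    rewrite (logder_first 0 quarter_0). destruct boundary_values as [_ [_ [-> _]]].
    rewrite (slope_high x) by lra. unfold Rdiv. ring.
Qed.

(** Logarithm of the radius. *)
Definition loglen (x : R) : R := RInt logder 0 x.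

Lemma loglen_derive x : is_derive loglen x (logder x).
Proof. apply is_derive_primitive. apply logder_continuous. Qed.

Definition radial (x : R) : R := exp (- loglen x).
Definition dradial (x : R) : R := - logder x * exp (- loglen x).

Lemma loglen_0 : loglen 0 = 0.
Proof. unfold loglen. now rewrite RInt_point. Qed.

Lemma radial_pos x : 0 < radial x.
Proof. apply exp_pos. Qed.

Lemma radial_derive x : is_derive radial x (dradial x).
Proof.
  unfold radial, dradial. pose proof (loglen_derive x) as D. auto_derive.
  - eexists; exact D. - derive_rw D. ring.
Qed.

Lemma radial_continuous x : continuous radial x.
Proof. apply (continuous_of_derive radial x (dradial x)), radial_derive. Qed.

Lemma dradial_continuous x : continuous dradial x.
Proof.
  unfold dradial. apply (continuous_mult (K := R_AbsRing)).
  - apply (continuous_opp (V := R_NormedModule)), logder_continuous.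
  - apply radial_continuous.
Qed.

Lemma radial_amp x : amp radial dradial x = radial x * sqrt (1 + logder x ^ 2).
Proof.
  unfold amp. replace (radial x) with (sqrt (radial x ^ 2)) at 2.
  - rewrite <- sqrt_mult; [|apply pow2_ge_0|pose proof (pow2_ge_0 (logder x)); lra].
    f_equal. unfold dradial. fold (radial x). ring.
  - apply sqrt_pow2. left. apply radial_pos.
Qed.

Lemma radial_nangle x : nangle radial dradial x = x - atan (logder x).
Proof.
  unfold nangle, dradial. fold (radial x). pose proof (radial_pos x).
  replace (- logder x * radial x / radial x) with (- logder x) by (field; lra).
  rewrite atan_opp. ring.
Qed.

Lemma conj_first x : quarter x -> conj_angle radial dradial x = tau_ext x.
Proof.
  intros Hx. unfold conj_angle. rewrite radial_nangle, (logder_first x Hx).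
  unfold tau_ext. rewrite (slope_quarter x Hx). ring.
Qed.

Lemma conj_second x : quarter x -> conj_angle radial dradial (tau_ext x) = x + PI.
Proof.
  intros Hx. unfold conj_angle. rewrite radial_nangle, (logder_second x Hx), atan_opp.
  unfold tau_ext. rewrite (slope_quarter x Hx). field.
Qed.

(** The product [r0 * radial] has derivative 0 on the quarter. *)
Lemma radial_first x : quarter x -> radial x = / r0 x.
Proof.
  intros Hx. pose proof (quarter_r0_pos x Hx) as Hp.
  set (f := fun y => r0 y * radial y).
  assert (E : f x = f 0).
  { apply (zero_derive_constant f (fun y => r1 y * radial y + r0 y * dradial y)); [apply Hx| |].
    - intros y _. unfold f. pose proof (D0 y) as E0. pose proof (radial_derive y) as E1.
      auto_derive. { split; [eexists; exact E0|]. split; [eexists; exact E1|easy]. }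
      derive_rw E0. derive_rw E1. ring.
    - intros y Hy. assert (Qy : quarter y) by (destruct Hx; unfold quarter; lra).
      unfold dradial. rewrite (logder_first y Qy). fold (radial y).
      pose proof (quarter_r0_pos y Qy). field. lra. }
  unfold f in E. destruct boundary_values as [B0 _]. rewrite B0 in E.
  unfold radial at 2 in E. rewrite loglen_0, Ropp_0, exp_0 in E.
  apply Rmult_eq_reg_l with (r0 x); [|lra]. rewrite E. field. lra.
Qed.

(** The square of the product has derivative 0 on the quarter: the logarithmic derivative of
    [radial] at [tau] cancels the one of the norm of the gradient. *)
Lemma radial_second x : quarter x ->
  rs * radial (tau_ext x) * amp radial dradial x = 1.
Proof.
  intros Hx. pose proof PI_RGT_0 as HPI.
  set (f := fun y => radial (tau_loc y) ^ 2 * ((r0 y ^ 2 + r1 y ^ 2) / r0 y ^ 4)).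
  set (T' := fun y => curv y / (r0 y ^ 2 + r1 y ^ 2)).
  set (df := fun y => 2 * radial (tau_loc y) * (dradial (tau_loc y) * T' y) *
       ((r0 y ^ 2 + r1 y ^ 2) / r0 y ^ 4) + radial (tau_loc y) ^ 2 *
       ((2 * r0 y * r1 y + 2 * r1 y * r2 y) / r0 y ^ 4
        - 4 * (r0 y ^ 2 + r1 y ^ 2) * r1 y / r0 y ^ 5)).
  assert (E : f x = f 0).
  { apply (zero_derive_constant f df); [apply Hx| |].
    - intros y Hy. assert (Qy : quarter y) by (destruct Hx; unfold quarter; lra).
      pose proof (quarter_r0_pos y Qy) as Hp.
      pose proof (D0 y) as E0. pose proof (D1 y) as E1.
      pose proof (tau_loc_derive y Hp) as ET. fold (T' y) in ET.
      pose proof (radial_derive (tau_loc y)) as ER.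
      unfold f, df. auto_derive.
      { repeat split; try (eexists; eassumption). apply Rgt_not_eq.
        repeat apply Rmult_lt_0_compat; lra. }
      derive_rw E0. derive_rw E1. derive_rw ET. derive_rw ER. field. lra.
    - intros y Hy. assert (Qy : quarter y) by (destruct Hx; unfold quarter; lra).
      pose proof (quarter_r0_pos y Qy) as Hp.
      unfold df, dradial. fold (radial (tau_loc y)).
      rewrite (tau_loc_quarter y Qy), (logder_second y Qy). unfold T', curv.
      pose proof (pow2_ge_0 (r1 y)). field. repeat split; nra. }
  destruct boundary_values as [B0 [Bs [B1 _]]].
  unfold f in E. rewrite !tau_loc_quarter in E by (assumption || apply quarter_0).
  rewrite B0, B1, tau_ext_0, (radial_first (PI / 2) quarter_PI2), Bs in E.
  assert (Ha : amp radial dradial x ^ 2 = (r0 x ^ 2 + r1 x ^ 2) / r0 x ^ 4).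
  { rewrite amp_sqr. unfold dradial. fold (radial x).
    rewrite (logder_first x Hx), (radial_first x Hx).
    pose proof (quarter_r0_pos x Hx). field. lra. }
  rewrite <- Ha in E.
  pose proof (radial_pos (tau_ext x)) as P1. pose proof (amp_pos radial dradial x (radial_pos x)) as P2.
  set (P := radial (tau_ext x) * amp radial dradial x).
  assert (HP : 0 < P) by (apply Rmult_lt_0_compat; assumption).
  assert (E2 : (rs * P) ^ 2 = 1).
  { unfold P. transitivity (rs ^ 2 * (radial (tau_ext x) ^ 2 * amp radial dradial x ^ 2)); [ring|].
    rewrite E. field. lra. }
  replace (rs * radial (tau_ext x) * amp radial dradial x) with (rs * P) by (unfold P; ring).
  assert (0 < rs * P) by (apply Rmult_lt_0_compat; lra). nra.
Qed.

(** The norm of the gradient at [PI / 2] is [1 / rs], so [radial_second] gives the radius at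
    its conjugate [PI]. *)
Lemma loglen_PI : loglen PI = 0.
Proof.
  pose proof (radial_second (PI / 2) quarter_PI2) as E. rewrite tau_ext_PI2 in E.
  rewrite radial_amp, (logder_first _ quarter_PI2), (radial_first _ quarter_PI2) in E.
  destruct boundary_values as [_ [Bs [_ B1]]]. rewrite Bs, B1 in E.
  replace (1 + (0 / rs) ^ 2) with 1 in E by (field; lra). rewrite sqrt_1 in E.
  replace (rs * radial PI * (/ rs * 1)) with (radial PI) in E by (field; lra).
  unfold radial in E. rewrite <- exp_0 in E. apply exp_inv in E. lra.
Qed.

Lemma radial_period x : radial (x + PI) = radial x.
Proof.
  unfold radial. f_equal. f_equal.
  set (f := fun y => loglen (y + PI) - loglen y).
  assert (Df : forall y, is_derive f y ((fun _ => 0) y)).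
  { intros y. unfold f. pose proof (loglen_derive y) as E0. pose proof (loglen_derive (y + PI)) as E1.
    auto_derive. { split; [eexists; exact E1|]. split; [eexists; exact E0|easy]. }
    derive_rw E0. derive_rw E1. rewrite logder_period. ring. }
  assert (F0 : f 0 = 0).
  { unfold f. rewrite Rplus_0_l, loglen_PI, loglen_0. ring. }
  assert (Fx : f x = f 0).
  { destruct (Rle_or_lt 0 x) as [L|L].
    - now apply (zero_derive_constant f (fun _ => 0)).
    - symmetry. apply (zero_derive_constant f (fun _ => 0)); [lra|intros; apply Df|easy]. }
  unfold f in Fx, F0. lra.
Qed.

Lemma radial_nangle_period x : nangle radial dradial (x + PI) = nangle radial dradial x + PI.
Proof. apply nangle_periodic; [exact radial_derive|exact radial_period]. Qed.

Lemma conj_period x : conj_angle radial dradial (x + PI) = conj_angle radial dradial x + PI.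
Proof. unfold conj_angle. rewrite radial_nangle_period. ring. Qed.

Lemma half_turn_cases x : 0 <= x <= PI -> quarter x \/ exists e, quarter e /\ x = tau_ext e.
Proof.
  intros Hx. destruct (Rle_or_lt x (PI / 2)) as [L|L].
  - left. unfold quarter; lra.
  - right. exists (s x). split; [apply inverse_quarter; lra|]. now rewrite Ts.
Qed.

(** Both identities hold on the first quarter by construction; on the second one they are the
    same identities read at the conjugate angle. *)
Lemma radial_radon : radon radial dradial rs.
Proof.
  constructor.
  - exact radial_pos.
  - exact radial_derive.
  - exact dradial_continuous.
  - exact radial_period.
  - assert (Q : forall x, 0 <= x <= PI ->
      conj_angle radial dradial (conj_angle radial dradial x) = x + PI).
    { intros x Hx. destruct (half_turn_cases x Hx) as [Qx|[e [Qe ->]]].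
      - rewrite (conj_first x Qx). now apply conj_second.
      - rewrite (conj_second e Qe), conj_period, (conj_first e Qe). reflexivity. }
    intros x. destruct (shift_into PI 0 x PI_RGT_0) as [n Hn].
    pose proof (periodic_IZR (fun x => conj_angle radial dradial (conj_angle radial dradial x) - x) PI)
      as W. cbv beta in W. specialize (W ltac:(intros z; rewrite !conj_period; ring) n x).
    rewrite Q in W by lra. lra.
  - lra.
  - assert (Pa : forall x, amp radial dradial (x + PI) = amp radial dradial x).
    { intros x. rewrite !radial_amp, radial_period, logder_period. reflexivity. }
    assert (Q : forall x, 0 <= x <= PI ->
      rs * radial (conj_angle radial dradial x) * amp radial dradial x = 1).
    { intros x Hx. destruct (half_turn_cases x Hx) as [Qx|[e [Qe ->]]].
      - rewrite (conj_first x Qx). now apply radial_second.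
      - rewrite (conj_second e Qe), radial_period. rewrite <- (radial_second e Qe).
        rewrite !radial_amp, (logder_second e Qe), (logder_first e Qe).
        replace ((- (r1 e / r0 e)) ^ 2) with ((r1 e / r0 e) ^ 2) by ring. ring. }
    intros x. destruct (shift_into PI 0 x PI_RGT_0) as [n Hn].
    pose proof (periodic_IZR (fun x => rs * radial (conj_angle radial dradial x) * amp radial dradial x) PI)
      as W. cbv beta in W.
    specialize (W ltac:(intros z; rewrite conj_period, radial_period, Pa; reflexivity) n x).
    rewrite Q in W by lra. now symmetry.
Qed.

Lemma tau_inv_eq x : PI / 2 <= x <= PI -> tau_inv r x = s x.
Proof.
  intros Hx. unfold tau_inv. apply (iota_unique (V := R_CompleteNormedModule)).
  - intros y [Qy Ey]. rewrite tau_ext_quarter in Ey by exact Qy. now rewrite <- Ey, sT.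
  - pose proof (inverse_quarter x Hx) as Qs. split; [exact Qs|].
    now rewrite tau_ext_quarter.
Qed.

Lemma rtilde_radial x : rtilde r rs x = / radial x.
Proof.
  assert (E : radial x = radial (residue x)).
  { unfold residue. pose proof (periodic_IZR radial PI radial_period (- Int_part (x / PI)) x) as W.
    rewrite opp_IZR in W. rewrite <- W. f_equal. ring. }
  rewrite E. unfold rtilde. fold (residue x). pose proof (residue_bounds x) as Hr.
  destruct Rle_dec as [L|L].
  - assert (Q : quarter (residue x)) by (unfold quarter; lra).
    rewrite (radial_first _ Q), Rinv_inv. now destruct (Eq _ Q).
  - assert (Hx : PI / 2 <= residue x <= PI) by lra.
    pose proof (inverse_quarter _ Hx) as Q.
    unfold rtilde_second. rewrite (tau_inv_eq _ Hx).
    pose proof (radial_second _ Q) as W. rewrite Ts in W.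
    destruct (Eq _ Q) as [E0 [E1 _]]. rewrite <- E0, <- E1.
    set (e := s (residue x)) in *. pose proof (quarter_r0_pos e Q) as Hp.
    assert (Ha : amp radial dradial e = sqrt (r0 e ^ 2 + r1 e ^ 2) / r0 e ^ 2).
    { rewrite radial_amp, (radial_first e Q), (logder_first e Q).
      replace (1 + (r1 e / r0 e) ^ 2) with ((r0 e ^ 2 + r1 e ^ 2) / r0 e ^ 2) by (field; lra).
      rewrite sqrt_div_alt by nra. rewrite sqrt_pow2 by lra. field. lra. }
    rewrite Ha in W. pose proof (radial_pos (residue x)).
    apply Rmult_eq_reg_l with (radial (residue x)); [|lra]. rewrite Rinv_r by lra.
    rewrite <- W. field. lra.
Qed.

End Construction.

(** The inverse of the radius obtained by integration is the required [h]. *)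
Lemma radon_of_quarter (r : R -> R) (rs : R) :
  pos_on_quarter r -> C_n_in quarter 2 r -> ae_in quarter (curvature_ineq r) ->
  1 <= rs -> boundary_cond r rs ->
  (forall eta, quarter eta -> PI / 2 <= tau r eta <= PI) /\
  (forall theta, PI / 2 <= theta <= PI -> exists! eta, quarter eta /\ tau r eta = theta) /\
  exists h dh, radon h dh rs /\ forall th, rtilde r rs th = / h th.
Proof.
  intros Hpos HC2 Hae Hrs Hb.
  destruct (C2_extension r HC2) as [r0 [r1 [r2 [D0 [D1 [Cr2 Eq]]]]]].
  pose proof (tau_ext_increasing r Hpos Hae r0 r1 r2 D0 D1 Cr2 Eq) as Hi.
  destruct (increasing_inverse (tau_ext r0 r1) PI) as [s [Ts [sT sc]]].
  - intros x. eapply tau_ext_continuous; eassumption.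
  - exact Hi.
  - intros x. unfold tau_ext. pose proof (atan_bound (slope r0 r1 x)). lra.
  - split; [|split].
    + intros e He. rewrite (tau_ext_quarter r r0 r1 r2 Eq e He).
      pose proof (tau_ext_0 r rs Hb r0 r1 r2 Eq) as E0.
      pose proof (tau_ext_PI2 r rs Hb r0 r1 r2 Eq) as E1. destruct He as [He1 He2].
      split.
      * destruct He1 as [L|<-]; [apply Hi in L|]; lra.
      * destruct He2 as [L| ->]; [apply Hi in L|]; lra.
    + intros th Hth. exists (s th).
      assert (Q : quarter (s th)) 
        by exact (inverse_quarter r rs Hpos Hae Hb r0 r1 r2 D0 D1 Cr2 Eq s Ts th Hth).
      split.
      * split; [exact Q|]. rewrite (tau_ext_quarter r r0 r1 r2 Eq _ Q). apply Ts.
      * intros e [Qe Ee]. rewrite (tau_ext_quarter r r0 r1 r2 Eq _ Qe) in Ee. now rewrite <- Ee.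
    + exists (radial r0 r1 s), (dradial r0 r1 s). split.
      * exact (radial_radon r rs Hpos Hae Hrs Hb r0 r1 r2 D0 D1 Cr2 Eq s Ts sT sc).
      * exact (rtilde_radial r rs Hpos Hae Hrs Hb r0 r1 r2 D0 D1 Cr2 Eq s Ts sT sc).
Qed.

(** * Derivatives along circles and rays *)

Lemma locally_punctured x y : (x, y) <> (0, 0) -> locally_2d (fun u v => (u, v) <> (0, 0)) x y.
Proof.
  intros Hxy. destruct (Req_dec x 0) as [Hx|Hx].
  - assert (Hy : y <> 0) by (intros ->; apply Hxy; now rewrite Hx).
    exists (mkposreal _ (Rabs_pos_lt y Hy)). intros u v _ Hv E. injection E as _ ->.
    simpl in Hv. rewrite Rminus_0_l, Rabs_Ropp in Hv. lra.
  - exists (mkposreal _ (Rabs_pos_lt x Hx)). intros u v Hu _ E. injection E as -> _.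
    simpl in Hu. rewrite Rminus_0_l, Rabs_Ropp in Hu. lra.
Qed.

(** Continuous partial derivatives suffice, and they exist near every nonzero point. *)
Lemma C1_differentiable F x y : C_n_punctured 1 F -> (x, y) <> (0, 0) ->
  differentiable_pt_lim F x y (partial_derive 1 0 F x y) (partial_derive 0 1 F x y).
Proof.
  intros HF Hxy. apply filterdiff_differentiable_pt_lim.
  destruct (HF x y Hxy) as [_ [_ [Ey [[Cx _] _]]]].
  apply (is_derive_filterdiff F x y (fun u v => Derive (fun z => F z v) u)).
  - apply (proj1 (locally_2d_locally (fun u v => is_derive (fun z => F z v) u (Derive (fun z => F z v) u)) x y)).
    apply locally_2d_impl with (2 := locally_punctured x y Hxy).
    apply locally_2d_forall. intros u v Huv. apply Derive_correct.
    now destruct (HF u v Huv) as [_ [Ex _]].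
  - apply Derive_correct. exact Ey.
  - apply continuity_2d_pt_filterlim in Cx. exact Cx.
Qed.

Lemma partial_punctured n p q m H : C_n_punctured n H -> (p + q + m <= n)%nat ->
  C_n_punctured m (partial_derive p q H).
Proof.
  intros HH Hm x y Hxy. apply ex_diff_n_m with (n := (n - (p + q))%nat); [lia|].
  apply ex_diff_n_deriv; [lia|]. now apply HH.
Qed.

(** By the symmetry of second derivatives the derivative in [y] of a mixed partial derivative
    is again one of the form [partial_derive p q]. *)
Lemma partial_differentiable n p q H x y : C_n_punctured n H -> (p + q < n)%nat ->
  (x, y) <> (0, 0) ->
  differentiable_pt_lim (partial_derive p q H) x y
    (partial_derive (S p) q H x y) (partial_derive p (S q) H x y).
Proof.
  intros HH Hpq Hxy.
  assert (E : partial_derive p (S q) H x y = partial_derive 0 1 (partial_derive p q H) x y).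
  { symmetry. apply (Derive_partial_derive p q H x y).
    apply locally_2d_impl with (2 := locally_punctured x y Hxy).
    apply locally_2d_forall. intros u v Huv. apply ex_diff_n_m with (n := n); [lia|].
    now apply HH. }
  rewrite E. apply (C1_differentiable (partial_derive p q H)); [|exact Hxy].
  apply (partial_punctured n); [exact HH|lia].
Qed.

Definition polar_partial (H : R -> R -> R) (p q : nat) (t th : R) : R :=
  partial_derive p q H (t * cos th) (t * sin th).

Lemma polar_partial_angle n p q H t th : C_n_punctured n H -> (p + q < n)%nat -> 0 < t ->
  is_derive (polar_partial H p q t) th
    (t * (- sin th * polar_partial H (S p) q t th + cos th * polar_partial H p (S q) t th)).
Proof.
  intros HH Hpq Ht. apply is_derive_Reals.
  pose proof (partial_differentiable n p q H _ _ HH Hpq (polar_nonzero t th Ht)) as D.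
  unfold polar_partial.
  replace (t * _) with
    (partial_derive (S p) q H (t * cos th) (t * sin th) * (t * - sin th)
     + partial_derive p (S q) H (t * cos th) (t * sin th) * (t * cos th)) by ring.
  apply (derivable_pt_lim_comp_2d (partial_derive p q H) (fun th => t * cos th) (fun th => t * sin th)).
  - exact D.
  - apply derivable_pt_lim_scal, derivable_pt_lim_cos.
  - apply derivable_pt_lim_scal, derivable_pt_lim_sin.
Qed.

Lemma polar_partial_ray n p q H t th : C_n_punctured n H -> (p + q < n)%nat -> 0 < t ->
  is_derive (fun t => polar_partial H p q t th) t
    (cos th * polar_partial H (S p) q t th + sin th * polar_partial H p (S q) t th).
Proof.
  intros HH Hpq Ht. apply is_derive_Reals.
  pose proof (partial_differentiable n p q H _ _ HH Hpq (polar_nonzero t th Ht)) as D.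
  unfold polar_partial.
  replace (cos th * _ + _) with
    (partial_derive (S p) q H (t * cos th) (t * sin th) * cos th
     + partial_derive p (S q) H (t * cos th) (t * sin th) * sin th) by ring.
  apply (derivable_pt_lim_comp_2d (partial_derive p q H) (fun t => t * cos th) (fun t => t * sin th)).
  - exact D.
  - replace (cos th) with (1 * cos th) by ring.
    apply is_derive_Reals. auto_derive; [easy|ring].
  - apply is_derive_Reals. auto_derive; [easy|ring].
Qed.

Lemma polar_partial_continuous n p q H t th : C_n_punctured n H -> (p + q <= n)%nat -> 0 < t ->
  continuous (polar_partial H p q t) th.
Proof.
  intros HH Hpq Ht.
  pose proof (partial_punctured n p q 0 H HH ltac:(lia) _ _ (polar_nonzero t th Ht)) as [C _].
  intros P [e He]. destruct (C e) as [d Hd].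
  assert (C1 : continuous (fun th => t * cos th) th).
  { apply (continuous_mult (K := R_AbsRing)); [apply continuous_const|apply continuous_cos]. }
  assert (C2 : continuous (fun th => t * sin th) th).
  { apply (continuous_mult (K := R_AbsRing)); [apply continuous_const|apply continuous_sin]. }
  pose proof (C1 _ (locally_ball _ d)) as L1. pose proof (C2 _ (locally_ball _ d)) as L2.
  change (locally th (fun s => P (polar_partial H p q t s))).
  apply (filter_imp (fun s => Rabs (t * cos s - t * cos th) < d /\ Rabs (t * sin s - t * sin th) < d)).
  - intros s [B1 B2]. apply He. exact (Hd _ _ B1 B2).
  - apply filter_and; [exact L1|exact L2].
Qed.

(** The gauge along the unit circle and its first three derivatives there, in terms of the
    partial derivatives of [H]. *)
Definition circ0 (H : R -> R -> R) (th : R) : R := polar_partial H 0 0 1 th.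
Definition circ1 (H : R -> R -> R) (th : R) : R :=
  - sin th * polar_partial H 1 0 1 th + cos th * polar_partial H 0 1 1 th.
Definition circ2 (H : R -> R -> R) (th : R) : R :=
  - cos th * polar_partial H 1 0 1 th - sin th * polar_partial H 0 1 1 th
  + sin th * sin th * polar_partial H 2 0 1 th
  - 2 * (sin th * cos th) * polar_partial H 1 1 1 th
  + cos th * cos th * polar_partial H 0 2 1 th.
Definition circ3 (H : R -> R -> R) (th : R) : R :=
  sin th * polar_partial H 1 0 1 th - cos th * polar_partial H 0 1 1 th
  + 3 * (sin th * cos th) * polar_partial H 2 0 1 th
  + 3 * (sin th * sin th - cos th * cos th) * polar_partial H 1 1 1 th
  - 3 * (sin th * cos th) * polar_partial H 0 2 1 th
  - sin th * (sin th * sin th) * polar_partial H 3 0 1 th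
  + 3 * (sin th * sin th * cos th) * polar_partial H 2 1 1 th
  - 3 * (sin th * (cos th * cos th)) * polar_partial H 1 2 1 th
  + cos th * (cos th * cos th) * polar_partial H 0 3 1 th.

Lemma circ0_derive H th : C_n_punctured 1 H -> is_derive (circ0 H) th (circ1 H th).
Proof.
  intros HH. pose proof (polar_partial_angle 1 0 0 H 1 th HH ltac:(lia) Rlt_0_1) as D.
  rewrite Rmult_1_l in D. exact D.
Qed.

Lemma circ1_derive H th : C_n_punctured 2 H -> is_derive (circ1 H) th (circ2 H th).
Proof.
  intros HH. pose proof (polar_partial_angle 2 1 0 H 1 th HH ltac:(lia) Rlt_0_1) as D10.
  pose proof (polar_partial_angle 2 0 1 H 1 th HH ltac:(lia) Rlt_0_1) as D01.
  unfold circ1, circ2. auto_derive.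
  - repeat split; eexists; eassumption.
  - derive_rw D10. derive_rw D01. ring.
Qed.

Lemma circ2_derive H th : C_n_punctured 3 H -> is_derive (circ2 H) th (circ3 H th).
Proof.
  intros HH. pose proof (polar_partial_angle 3 1 0 H 1 th HH ltac:(lia) Rlt_0_1) as D10.
  pose proof (polar_partial_angle 3 0 1 H 1 th HH ltac:(lia) Rlt_0_1) as D01.
  pose proof (polar_partial_angle 3 2 0 H 1 th HH ltac:(lia) Rlt_0_1) as D20.
  pose proof (polar_partial_angle 3 1 1 H 1 th HH ltac:(lia) Rlt_0_1) as D11.
  pose proof (polar_partial_angle 3 0 2 H 1 th HH ltac:(lia) Rlt_0_1) as D02.
  unfold circ2, circ3. auto_derive.
  - repeat split; eexists; eassumption.
  - derive_rw D10. derive_rw D01. derive_rw D20. derive_rw D11. derive_rw D02. ring.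
Qed.

(** Reduces continuity of an arithmetic expression to its atoms, following its syntax. *)
Ltac continuous_arith :=
  lazymatch goal with
  | |- continuous (fun _ => ?c) _ => apply continuous_const
  | |- continuous (fun x => cos x) _ => apply continuous_cos
  | |- continuous (fun x => sin x) _ => apply continuous_sin
  | |- continuous (fun x => - @?f x) _ =>
      apply (continuous_opp (V := R_NormedModule) f); continuous_arith
  | |- continuous (fun x => @?f x + @?g x) _ =>
      apply (continuous_plus (V := R_NormedModule) f g); continuous_arith
  | |- continuous (fun x => @?f x - @?g x) _ =>
      apply (continuous_minus (V := R_NormedModule) f g); continuous_arith
  | |- continuous (fun x => @?f x * @?g x) _ =>
      apply (continuous_mult (K := R_AbsRing) f g); continuous_arith
  | |- _ => idtac
  end.

Lemma circ2_continuous H th : C_n_punctured 2 H -> continuous (circ2 H) th.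
Proof.
  intros HH.
  assert (C : forall p q, (p + q <= 2)%nat -> continuous (polar_partial H p q 1) th).
  { intros p q Hpq. now apply (polar_partial_continuous 2 p q H 1 th HH Hpq), Rlt_0_1. }
  unfold circ2. continuous_arith; apply C; lia.
Qed.

Lemma circ3_continuous H th : C_n_punctured 3 H -> continuous (circ3 H) th.
Proof.
  intros HH.
  assert (C : forall p q, (p + q <= 3)%nat -> continuous (polar_partial H p q 1) th).
  { intros p q Hpq. now apply (polar_partial_continuous 3 p q H 1 th HH Hpq), Rlt_0_1. }
  unfold circ3. continuous_arith; apply C; lia.
Qed.

Lemma punctured_le n m H : (m <= n)%nat -> C_n_punctured n H -> C_n_punctured m H.
Proof. intros Hmn HH x y Hxy. apply ex_diff_n_m with (n := n); [exact Hmn|]. now apply HH. Qed.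

(** * Homogeneity *)

Section Homogeneous.
Context (H : R -> R -> R) (Hh : pos_homogeneous H) (He : even2 H).

Lemma circ_gauge : radial_gauge (circ0 H) H.
Proof.
  intros t th Ht. destruct Hh as [H0 [_ Ht']]. unfold circ0, polar_partial, partial_derive.
  simpl. rewrite !Rmult_1_l. destruct Ht as [Ht|<-].
  - now apply Ht'. - rewrite !Rmult_0_l. exact H0.
Qed.

Lemma circ_pos th : 0 < circ0 H th.
Proof.
  destruct Hh as [_ [Hp _]]. unfold circ0, polar_partial, partial_derive. simpl.
  apply Hp, polar_nonzero, Rlt_0_1.
Qed.

Lemma circ_per th : circ0 H (th + PI) = circ0 H th.
Proof.
  unfold circ0, polar_partial, partial_derive. simpl. rewrite neg_cos, neg_sin.
  rewrite <- (He (1 * cos th) (1 * sin th)). f_equal; ring.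
Qed.

Context (HC1 : C_n_punctured 1 H).

Lemma circ0_continuous th : continuous (circ0 H) th.
Proof. apply (continuous_of_derive _ _ (circ1 H th)), circ0_derive, HC1. Qed.

(** Differentiating [H (t e) = t h] along the circle and along the ray gives the two
    components of the gradient, which do not depend on [t]. *)
Lemma polar_gradient t th : 0 < t ->
  polar_partial H 1 0 t th = grad_x (circ0 H) (circ1 H) th /\
  polar_partial H 0 1 t th = grad_y (circ0 H) (circ1 H) th.
Proof.
  intros Ht.
  pose proof (polar_partial_angle 1 0 0 H t th HC1 ltac:(lia) Ht) as Da.
  pose proof (polar_partial_ray 1 0 0 H t th HC1 ltac:(lia) Ht) as Dr.
  assert (Ea : is_derive (polar_partial H 0 0 t) th (t * circ1 H th)).
  { apply (is_derive_ext (fun x => t * circ0 H x)).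
    - intros x. symmetry. apply (circ_gauge t x). lra.
    - pose proof (circ0_derive H th HC1) as D. auto_derive; [eexists; exact D|].
      derive_rw D. ring. }
  assert (Er : is_derive (fun t => polar_partial H 0 0 t th) t (circ0 H th)).
  { apply (is_derive_ext_loc (fun x => x * circ0 H th)).
    - exists (mkposreal t Ht). intros x Hx. change (Rabs (x - t) < t) in Hx.
      apply Rabs_lt_between' in Hx. symmetry. apply (circ_gauge x th). lra.
    - auto_derive; [easy|ring]. }
  apply is_derive_unique in Da, Dr, Ea, Er. rewrite Ea in Da. rewrite Er in Dr.
  assert (Da' : circ1 H th = - sin th * polar_partial H 1 0 t th + cos th * polar_partial H 0 1 t th)
    by (apply Rmult_eq_reg_l with t; [exact Da|lra]).
  unfold grad_x, grad_y. rewrite Dr, Da'.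
  pose proof (sin2_cos2 th) as SC. unfold Rsqr in SC.
  set (a := polar_partial H 1 0 t th). set (b := polar_partial H 0 1 t th).
  split; [replace a with (a * (sin th * sin th + cos th * cos th)) at 1 by (rewrite SC; ring)
         |replace b with (b * (sin th * sin th + cos th * cos th)) at 1 by (rewrite SC; ring)]; ring.
Qed.

Lemma homogeneous_differentiable t th : 0 < t ->
  differentiable_pt_lim H (t * cos th) (t * sin th)
    (grad_x (circ0 H) (circ1 H) th) (grad_y (circ0 H) (circ1 H) th).
Proof.
  intros Ht. destruct (polar_gradient t th Ht) as [<- <-].
  apply (partial_differentiable 1 0 0 H); [exact HC1|lia|now apply polar_nonzero].
Qed.

(** * Supporting lines from strict convexity *)

(** Shrinking a point of gauge 1 slightly brings it into the ball. *)
Lemma level_one_closure x y : H x y = 1 -> closure2 (unit_ball H) (x, y).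
Proof.
  intros E Hl.
  pose proof (proj2 (locally_2d_locally (fun u v => ~ unit_ball H (u, v)) x y)) as L.
  destruct L as [d Hd].
  { destruct Hl as [e Hl]. exists e. intros [u v] Huv. exact (Hl (u, v) Huv). }
  set (m := Rmax (Rabs x) (Rabs y) + 1).
  assert (Hm : 0 < m).
  { pose proof (Rabs_pos x). pose proof (Rmax_l (Rabs x) (Rabs y)). unfold m. lra. }
  set (e := Rmin (/ 2) (d / m)).
  assert (He0 : 0 < e).
  { apply Rmin_glb_lt; [lra|]. apply Rdiv_lt_0_compat; [apply d|exact Hm]. }
  assert (He1 : e <= / 2) by apply Rmin_l.
  assert (Hed : e * m <= d).
  { apply Rle_trans with (d / m * m); [|right; field; lra].
    apply Rmult_le_compat_r; [lra|apply Rmin_r]. }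
  assert (Near : forall z, Rabs z <= Rmax (Rabs x) (Rabs y) -> Rabs ((1 - e) * z - z) < d).
  { intros z Hz. replace ((1 - e) * z - z) with (- (e * z)) by ring.
    rewrite Rabs_Ropp, Rabs_mult, (Rabs_pos_eq e) by lra.
    apply Rlt_le_trans with (e * m); [|exact Hed]. apply Rmult_lt_compat_l; [exact He0|].
    unfold m. lra. }
  apply (Hd ((1 - e) * x) ((1 - e) * y)).
  - apply Near, Rmax_l. - apply Near, Rmax_r.
  - unfold unit_ball; simpl. destruct Hh as [_ [_ Ht]]. rewrite Ht, E by lra. lra.
Qed.

(** Between two boundary points the gauge is less than 1, so at either of them its
    directional derivative towards the other is nonpositive. *)
Lemma supported_of_strictly_convex : strictly_convex (unit_ball H) ->
  supported (circ0 H) (circ1 H).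
Proof.
  intros Hsc ps th.
  pose proof (circ_pos ps) as P1. pose proof (circ_pos th) as P2.
  set (h := circ0 H) in *. set (dh := circ1 H).
  set (t := / h ps). set (u := / h th).
  assert (Ht : 0 < t) by (apply Rinv_0_lt_compat; exact P1).
  assert (Hu : 0 < u) by (apply Rinv_0_lt_compat; exact P2).
  set (p1 := t * cos ps). set (p2 := t * sin ps).
  set (q1 := u * cos th). set (q2 := u * sin th).
  assert (Ep : H p1 p2 = 1).
  { unfold p1, p2. rewrite (circ_gauge t ps) by lra. fold h. unfold t. field. lra. }
  assert (Eq : H q1 q2 = 1).
  { unfold q1, q2. rewrite (circ_gauge u th) by lra. fold h. unfold u. field. lra. }
  pose proof (homogeneous_differentiable t ps Ht) as D. fold h dh p1 p2 in D.
  pose proof (grad_test h dh ps t ps) as Gp. pose proof (grad_test h dh ps u th) as Gq.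
  fold p1 p2 in Gp. fold q1 q2 in Gq.
  replace (ps - ps) with 0 in Gp by ring. rewrite cos_0, sin_0 in Gp.
  replace (t * (h ps * 1 + dh ps * 0)) with 1 in Gp by (unfold t; field; lra).
  set (a := grad_x h dh ps) in *. set (b := grad_y h dh ps) in *.
  apply Rmult_le_reg_l with u; [exact Hu|]. rewrite <- Gq.
  replace (u * h th) with 1 by (unfold u; field; lra).
  destruct (classic ((p1, p2) = (q1, q2))) as [E|Hne].
  { injection E as <- <-. lra. }
  pose proof (derivable_pt_lim_comp_2d H (fun s => (1 - s) * p1 + s * q1)
    (fun s => (1 - s) * p2 + s * q2) 0 a b (q1 - p1) (q2 - p2)) as Dl. cbv beta in Dl.
  replace ((1 - 0) * p1 + 0 * q1) with p1 in Dl by ring.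
  replace ((1 - 0) * p2 + 0 * q2) with p2 in Dl by ring.
  specialize (Dl D).
  assert (Dl' := Dl ltac:(apply is_derive_Reals; auto_derive; [easy|ring])
     ltac:(apply is_derive_Reals; auto_derive; [easy|ring])). clear Dl.
  set (l := a * (q1 - p1) + b * (q2 - p2)) in *.
  assert (Hl : l <= 0).
  { apply Rnot_lt_le. intros Hl. destruct (Dl' l Hl) as [d Hd].
    set (e := Rmin (/ 2) (d / 2)).
    assert (Hdp := cond_pos d).
    assert (He0 : 0 < e) by (apply Rmin_glb_lt; lra).
    assert (He1 : e <= / 2) by apply Rmin_l. assert (He2 : e <= d / 2) by apply Rmin_r.
    specialize (Hd e ltac:(lra) ltac:(rewrite Rabs_pos_eq; lra)).
    rewrite Rplus_0_l in Hd.
    replace ((1 - 0) * p1 + 0 * q1) with p1 in Hd by ring.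
    replace ((1 - 0) * p2 + 0 * q2) with p2 in Hd by ring.
    rewrite Ep in Hd. apply Rabs_lt_between' in Hd.
    pose proof (Hsc (p1, p2) (q1, q2) (level_one_closure _ _ Ep) (level_one_closure _ _ Eq)
      Hne e ltac:(lra)) as Hi. simpl in Hi. apply locally_singleton in Hi.
    unfold unit_ball in Hi. simpl in Hi.
    set (z := H ((1 - e) * p1 + e * q1) ((1 - e) * p2 + e * q2)) in *.
    assert (0 < (z - 1) / e) by lra.
    assert (z - 1 = (z - 1) / e * e) by (field; lra). nra. }
  unfold l in Hl. lra.
Qed.

(** * The dual gauge, and the sign condition as an involution *)

Lemma dual_bounds x y M : (forall th, (x * cos th + y * sin th) / circ0 H th <= M) ->
  dual H x y <= M /\ forall th, (x * cos th + y * sin th) / circ0 H th <= dual H x y.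
Proof.
  intros HM. unfold dual. set (E := fun v => _).
  assert (EH : forall th, H (cos th) (sin th) = circ0 H th).
  { intros th. pose proof (circ_gauge 1 th ltac:(lra)) as W. now rewrite !Rmult_1_l in W. }
  assert (InE : forall th, E ((x * cos th + y * sin th) / circ0 H th)).
  { intros th. exists (cos th), (sin th). rewrite EH. split; [|reflexivity].
    pose proof (sin2_cos2 th) as SC. unfold Rsqr in SC. nra. }
  assert (UbE : is_ub_Rbar E M).
  { intros v [a [b [Eab ->]]]. destruct (circle_param a b Eab) as [th [_ [-> ->]]].
    rewrite EH. apply HM. }
  destruct (Lub_Rbar_correct E) as [Hub Hlub]. specialize (Hlub M UbE).
  pose proof (Hub _ (InE 0)) as H0.
  destruct (Lub_Rbar E) as [l| |]; try easy. simpl in *. split; [exact Hlub|].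
  intros th. exact (Hub _ (InE th)).
Qed.

(** The quotients are bounded because they depend continuously and periodically on the angle. *)
Lemma dual_lower x y th : (x * cos th + y * sin th) / circ0 H th <= dual H x y.
Proof.
  set (f := fun th => (x * cos th + y * sin th) / circ0 H th).
  assert (Cf : forall th, continuous f th).
  { intros a. unfold f. apply (continuous_mult (K := R_AbsRing)); [continuous_arith|].
    apply continuous_Rinv_comp; [apply circ0_continuous|]. pose proof (circ_pos a). lra. }
  destruct (continuity_ab_maj f 0 (2 * PI)) as [m [Hm _]].
  { pose proof PI_RGT_0. lra. }
  { intros c _. apply continuity_pt_filterlim, Cf. }
  apply (dual_bounds x y (f m)). intros a.
  assert (Pf : forall z, f (z + 2 * PI) = f z).
  { intros z. unfold f. replace (z + 2 * PI) with (z + PI + PI) by ring.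
    rewrite !circ_per, !neg_cos, !neg_sin. f_equal. ring. }
  destruct (shift_into (2 * PI) 0 a) as [n Hn]. { pose proof PI_RGT_0. lra. }
  rewrite <- (periodic_IZR f _ Pf n a : f _ = (x * cos a + y * sin a) / circ0 H a).
  apply Hm. lra.
Qed.

Lemma derive_at_minimum f x l : is_derive f x l -> (forall y, f x <= f y) -> l = 0.
Proof.
  intros D Hm. apply is_derive_Reals in D.
  assert (pr : derivable_pt f x) by (exists l; exact D).
  rewrite <- (derive_pt_eq_0 f x l pr D).
  apply (deriv_minimum f (x - 1) (x + 1) x pr); intros; try lra. apply Hm.
Qed.

(** The dual gauge is touched from below at the gradient for angle [ps] by the linear
    function of the boundary point of that angle, which is therefore its gradient. *)
Lemma dual_gradient ps : supported (circ0 H) (circ1 H) ->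
  (forall x y, (x, y) <> (0, 0) -> differentiable_pt (dual H) x y) ->
  let a := grad_x (circ0 H) (circ1 H) ps in
  let b := grad_y (circ0 H) (circ1 H) ps in
  dual H a b = 1 /\ grad1 (dual H) a b = cos ps / circ0 H ps
  /\ grad2 (dual H) a b = sin ps / circ0 H ps.
Proof.
  intros Hs Hd a b. set (h := circ0 H) in *. set (dh := circ1 H) in *.
  pose proof (circ_pos ps : 0 < h ps) as Hp.
  assert (Et : forall th, a * cos th + b * sin th = h ps * cos (th - ps) + dh ps * sin (th - ps)).
  { intros th. pose proof (grad_test h dh ps 1 th) as G. rewrite !Rmult_1_l in G. exact G. }
  assert (E0 : a * cos ps + b * sin ps = h ps).
  { rewrite Et. replace (ps - ps) with 0 by ring. rewrite cos_0, sin_0. ring. }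
  assert (E1 : dual H a b = 1).
  { apply Rle_antisym.
    - apply (dual_bounds a b 1). intros th. rewrite Et. pose proof (circ_pos th : 0 < h th).
      apply Rmult_le_reg_r with (h th); [exact H0|]. fold h. rewrite Rmult_1_l.
      replace (_ / h th * h th) with (h ps * cos (th - ps) + dh ps * sin (th - ps)) by (field; lra).
      apply Hs.
    - pose proof (dual_lower a b ps) as L. fold h in L. rewrite E0 in L.
      replace (h ps / h ps) with 1 in L by (field; lra). exact L. }
  assert (Hne : (a, b) <> (0, 0)).
  { intros E. injection E as E2 E3. rewrite E2, E3 in E0. lra. }
  destruct (Hd a b Hne) as [lx [ly D]].
  destruct (differentiable_pt_lim_unique _ _ _ _ _ D) as [U1 U2].
  unfold grad1, grad2. rewrite U1, U2. split; [exact E1|].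
  assert (L : forall x y, (x * cos ps + y * sin ps) / h ps <= dual H x y).
  { intros x y. apply dual_lower. }
  assert (Emin : 1 - (a * cos ps + b * sin ps) / h ps = 0) by (rewrite E0; field; lra).
  split.
  - assert (Dx : is_derive (fun u => dual H u b) a lx).
    { apply is_derive_Reals. pose proof (derivable_pt_lim_comp_2d (dual H) (fun u => u) (fun _ => b) a
        lx ly 1 0 D) as W. replace (lx * 1 + ly * 0) with lx in W by ring.
      apply W; [apply derivable_pt_lim_id|apply derivable_pt_lim_const]. }
    assert (lx - cos ps / h ps = 0); [|lra].
    apply (derive_at_minimum (fun u => dual H u b - (u * cos ps + b * sin ps) / h ps) a).
    + auto_derive; [eexists; exact Dx|]. derive_rw Dx. field. lra.
    + intros u. rewrite E1, Emin. pose proof (L u b). lra.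
  - assert (Dy : is_derive (fun v => dual H a v) b ly).
    { apply is_derive_Reals. pose proof (derivable_pt_lim_comp_2d (dual H) (fun _ => a) (fun v => v) b
        lx ly 0 1 D) as W. replace (lx * 0 + ly * 1) with ly in W by ring.
      apply W; [apply derivable_pt_lim_const|apply derivable_pt_lim_id]. }
    assert (ly - sin ps / h ps = 0); [|lra].
    apply (derive_at_minimum (fun v => dual H a v - (a * cos ps + v * sin ps) / h ps) b).
    + auto_derive; [eexists; exact Dy|]. derive_rw Dy. field. lra.
    + intros v. rewrite E1, Emin. pose proof (L a v). lra.
Qed.

(** Testing the sign condition in the conjugate direction makes one side vanish, and the
    angle of the twice conjugate direction is then determined by its a priori bounds. *)
Lemma conj_involution_of_S : supported (circ0 H) (circ1 H) -> condition_S H ->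
  forall th, conj_angle (circ0 H) (circ1 H) (conj_angle (circ0 H) (circ1 H) th) = th + PI.
Proof.
  intros Hs [Hd HS] th. set (h := circ0 H) in *. set (dh := circ1 H) in *.
  set (ps := conj_angle h dh th).
  assert (Hdd : forall x y, (x, y) <> (0, 0) -> differentiable_pt (dual H) x y)
    by (intros x y Hxy; now apply Hd).
  destruct (dual_gradient ps Hs Hdd) as [E1 [E2 E3]]. fold h dh in E1, E2, E3.
  pose proof (differentiable_pt_lim_unique _ _ _ _ _ (homogeneous_differentiable 1 th Rlt_0_1)) as [E4 E5].
  fold h dh in E4, E5. rewrite !Rmult_1_l in E4, E5.
  pose proof (circ_gauge 1 th ltac:(lra)) as E6. rewrite !Rmult_1_l in E6. fold h in E6.
  specialize (HS (cos th) (sin th) (grad_x h dh ps) (grad_y h dh ps)).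
  rewrite E1, E2, E3, E6 in HS. unfold grad1, grad2 in HS. rewrite E4, E5 in HS.
  pose proof (circ_pos th : 0 < h th) as P1. pose proof (circ_pos ps : 0 < h ps) as P2.
  pose proof (grad_test h dh th 1 ps) as G1. pose proof (grad_test h dh ps 1 th) as G2.
  rewrite !Rmult_1_l in G1, G2.
  rewrite amp_test in G1, G2 by assumption.
  pose proof (amp_pos h dh ps P2) as A2.
  assert (Z : cos (ps - nangle h dh th) = 0).
  { unfold ps, conj_angle. replace (nangle h dh th + PI / 2 - nangle h dh th) with (PI / 2) by ring.
    apply cos_PI2. }
  rewrite Z, Rmult_0_r in G1.
  replace (cos th * grad_x h dh ps + sin th * grad_y h dh ps)
    with (amp h dh ps * cos (th - nangle h dh ps)) in HS by (rewrite <- G2; ring).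
  match type of HS with sign ?L = _ => replace L with 0 in HS end.
  2:{ transitivity (h th / h ps * (grad_x h dh th * cos ps + grad_y h dh th * sin ps)).
      - rewrite G1. ring. - field. lra. }
  rewrite sign_0 in HS.
  assert (Zc : cos (th - nangle h dh ps) = 0).
  { destruct (Req_dec (cos (th - nangle h dh ps)) 0) as [E|Hne]; [exact E|exfalso].
    apply (sign_neq_0 (amp h dh ps * cos (th - nangle h dh ps))); [|now symmetry].
    apply Rmult_integral_contrapositive. split; [lra|exact Hne]. }
  pose proof (conj_bounds h dh th) as B1. fold ps in B1. pose proof (conj_bounds h dh ps) as B2.
  set (om := conj_angle h dh ps) in *.
  assert (Zs : sin (om - th) = 0).
  { unfold om, conj_angle. replace (nangle h dh ps + PI / 2 - th) with (PI / 2 - (th - nangle h dh ps))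
      by ring. rewrite sin_shift. exact Zc. }
  destruct (Rtotal_order (om - th) PI) as [L|[L|L]]; [|lra|]; exfalso.
  - pose proof (sin_gt_0 (om - th) ltac:(lra) L). lra.
  - pose proof (sin_lt_0 (om - th) ltac:(lra) ltac:(lra)). lra.
Qed.

End Homogeneous.

(** * Smooth Radon curves *)

Lemma derive_chain_in (n : nat) (F : nat -> R -> R) :
  (forall k x, (k < n)%nat -> is_derive (F k) x (F (S k) x)) ->
  forall k x, (k <= n)%nat -> quarter x -> Derive_n_in quarter k (F 0%nat) x = F k x.
Proof.
  intros HF k. induction k as [|k IH]; intros x Hk Hx; [reflexivity|]. simpl.
  apply Derive_in_unique; [exact Hx|].
  apply (is_derive_in_of_global _ (F k)); [exact Hx| |apply HF; lia].
  intros y Hy. apply IH; [lia|exact Hy].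
Qed.

Lemma C_n_in_of_chain (n : nat) (F : nat -> R -> R) :
  (forall k x, (k < n)%nat -> is_derive (F k) x (F (S k) x)) ->
  (forall x, continuous (F n) x) -> C_n_in quarter n (F 0%nat).
Proof.
  intros HF Hc. pose proof (derive_chain_in n F HF) as E. split.
  - intros k x Hk Hx. exists (F (S k) x).
    apply (is_derive_in_of_global _ (F k)); [exact Hx| |now apply HF].
    intros y Hy. apply E; [lia|exact Hy].
  - intros x Hx eps Heps.
    pose proof (proj2 (continuity_pt_filterlim (F n) x) (Hc x)) as C.
    destruct (C eps Heps) as [d [Hd H]]. exists d. split; [exact Hd|].
    intros y [[Qy Hne] Hy]. rewrite !E by (lia || assumption).
    apply H. split; [|exact Hy]. split; [exact I|exact Hne].
Qed.

Lemma ae_of_everywhere (D P : R -> Prop) : (forall x, D x -> P x) -> ae_in D P.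
Proof.
  intros HP eps Heps. exists (fun _ => 0), (fun _ => 0). split; [intros _; lra|]. split.
  - intros x [Dx Nx]. destruct (Nx (HP x Dx)).
  - assert (E : is_series (fun n : nat => 0 - 0) 0).
    { apply (is_lim_seq_ext (fun _ => 0) (sum_n (fun _ : nat => 0 - 0)) 0); [|apply is_lim_seq_const].
      intros n. induction n as [|n IH]; [rewrite sum_O; ring|].
      rewrite sum_Sn, <- IH. unfold plus; simpl. ring. }
    split; [now exists 0|]. rewrite (is_series_unique _ _ E). lra.
Qed.

Lemma is_derive_quarter_agree (f g df dg : R -> R) :
  (forall x, is_derive f x (df x)) -> (forall x, is_derive g x (dg x)) ->
  (forall x, quarter x -> f x = g x) -> forall x, quarter x -> df x = dg x.
Proof.
  intros Df Dg E x Hx. apply (is_derive_in_unique f x); [exact Hx| |].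
  - now apply (is_derive_in_of_global f f).
  - now apply (is_derive_in_of_global f g).
Qed.

(** On the quarter, the conjugate angles and the norms of the gradients agree; duality then
    gives [h] at the conjugate angles, which fill the second quarter. *)
Lemma radon_unique (h dh g dg : R -> R) (k : R) : radon h dh k -> radon g dg k ->
  conj_angle h dh 0 = PI / 2 -> (forall x, quarter x -> g x = h x) -> forall x, g x = h x.
Proof.
  intros Rh Rg C0 E.
  assert (Ed : forall x, quarter x -> dg x = dh x).
  { apply (is_derive_quarter_agree g h); [apply Rg|apply Rh|exact E]. }
  assert (CP : conj_angle h dh (PI / 2) = PI).
  { rewrite <- C0. rewrite (radon_inv _ _ _ Rh). ring. }
  assert (Cinc : forall a b, a < b -> conj_angle h dh a < conj_angle h dh b).
  { intros a b Hab. unfold conj_angle. pose proof (radon_nangle_increasing h dh k Rh a b Hab). lra. }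
  assert (Cper : forall x, conj_angle h dh (x + PI) = conj_angle h dh x + PI).
  { intros x. unfold conj_angle. rewrite (radon_nangle_per h dh k Rh). ring. }
  assert (H2 : forall y, PI / 2 <= y <= PI -> g y = h y).
  { intros y Hy. set (x := conj_angle h dh y - PI).
    assert (Ex : conj_angle h dh x = y).
    { pose proof (Cper x) as W. unfold x at 1 in W.
      replace (conj_angle h dh y - PI + PI) with (conj_angle h dh y) in W by ring.
      rewrite (radon_inv _ _ _ Rh) in W. lra. }
    assert (Qx : quarter x).
    { split; apply Rnot_lt_le; intros L; apply Cinc in L; rewrite Ex in L; lra. }
    assert (Ec : conj_angle g dg x = y).
    { rewrite <- Ex. unfold conj_angle, nangle. now rewrite (E x Qx), (Ed x Qx). }
    pose proof (radon_dual _ _ _ Rh x) as W1. pose proof (radon_dual _ _ _ Rg x) as W2.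
    rewrite Ex in W1. rewrite Ec in W2.
    replace (amp g dg x) with (amp h dh x) in W2 by (unfold amp; now rewrite (E x Qx), (Ed x Qx)).
    pose proof (radon_kpos _ _ _ Rh). pose proof (amp_pos h dh x (radon_pos _ _ _ Rh x)).
    apply Rmult_eq_reg_l with (k * amp h dh x); [nra|]. apply Rgt_not_eq. nra. }
  intros x. destruct (shift_into PI 0 x PI_RGT_0) as [n Hn].
  rewrite <- (periodic_IZR g PI (radon_per _ _ _ Rg) n x).
  rewrite <- (periodic_IZR h PI (radon_per _ _ _ Rh) n x).
  destruct (Rle_or_lt (x + IZR n * PI) (PI / 2)); [apply E; unfold quarter|apply H2]; lra.
Qed.

Lemma rtilde_quarter r rs x : quarter x -> rtilde r rs x = r x.
Proof.
  intros [H1 H2]. pose proof PI_RGT_0. unfold rtilde. fold (residue x).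
  rewrite (residue_eq x 0) by lra. replace (x - 0 * PI) with x by ring.
  destruct Rle_dec; [reflexivity|lra].
Qed.

Section Smooth.
Context (h h1 h2 : R -> R)
  (Hp : forall x, 0 < h x) (Hper : forall x, h (x + PI) = h x)
  (D0 : forall x, is_derive h x (h1 x)) (D1 : forall x, is_derive h1 x (h2 x))
  (C2 : forall x, continuous h2 x).

(** Angular speed of the normal; the factor [h + h2] has the sign of the curvature. *)
Definition nspeed (x : R) : R := h x * (h x + h2 x) / (h x ^ 2 + h1 x ^ 2).

Lemma norm_pos x : 0 < h x ^ 2 + h1 x ^ 2.
Proof. pose proof (Hp x). pose proof (pow2_ge_0 (h1 x)). nra. Qed.

Lemma smooth_h_continuous x : continuous h x.
Proof. apply (continuous_of_derive h x (h1 x)), D0. Qed.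

Lemma smooth_h1_continuous x : continuous h1 x.
Proof. apply (continuous_of_derive h1 x (h2 x)), D1. Qed.

Lemma nangle_derive x : is_derive (nangle h h1) x (nspeed x).
Proof.
  unfold nangle, nspeed. pose proof (D0 x) as E0. pose proof (D1 x) as E1. pose proof (Hp x).
  auto_derive. { repeat split; try (eexists; eassumption). lra. }
  derive_rw E0. derive_rw E1. pose proof (norm_pos x). field. repeat split; nra.
Qed.

Lemma conj_derive x : is_derive (conj_angle h h1) x (nspeed x).
Proof.
  unfold conj_angle. pose proof (nangle_derive x) as E.
  auto_derive; [eexists; exact E|]. derive_rw E. ring.
Qed.

Lemma smooth_nangle_per x : nangle h h1 (x + PI) = nangle h h1 x + PI.
Proof. now apply nangle_periodic. Qed.

Lemma nangle_increasing_of_curvature : (forall x, 0 < h x + h2 x) ->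
  forall a b, a < b -> nangle h h1 a < nangle h h1 b.
Proof.
  intros Hc a b Hab.
  destruct (MVT_gen (nangle h h1) a b nspeed) as [c [_ E]].
  - intros x _. apply nangle_derive.
  - intros x _. apply continuity_pt_filterlim.
    apply (continuous_of_derive _ x (nspeed x)), nangle_derive.
  - assert (0 < nspeed c); [|nra]. unfold nspeed.
    pose proof (Hp c). pose proof (Hc c). pose proof (norm_pos c).
    apply Rdiv_lt_0_compat; nra.
Qed.

Lemma smooth_supported : (forall x, 0 < h x + h2 x) -> supported h h1.
Proof.
  intros Hc ps th.
  apply (support h h1 Hp D0 Hper (nangle_increasing_of_curvature Hc) smooth_nangle_per ps th).
Qed.

Context (Hinv : forall x, conj_angle h h1 (conj_angle h h1 x) = x + PI).

(** The chain rule, applied to the involution. *)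
Lemma nspeed_inverse x : nspeed (conj_angle h h1 x) * nspeed x = 1.
Proof.
  set (T := conj_angle h h1).
  assert (E : is_derive (fun y => T (T y)) x (nspeed (T x) * nspeed x)).
  { pose proof (conj_derive x) as E0. pose proof (conj_derive (T x)) as E1. fold T in E0, E1.
    auto_derive. { split; [eexists; exact E1|]. split; [eexists; exact E0|easy]. }
    derive_rw E0. derive_rw E1. ring. }
  assert (E' : is_derive (fun y => T (T y)) x 1).
  { apply (is_derive_ext (fun y => y + PI)).
    - intros y. symmetry. apply Hinv.
    - auto_derive; [easy|ring]. }
  apply is_derive_unique in E, E'. now rewrite <- E, E'.
Qed.

(** The angular speed of the normal is invertible, so it does not vanish. *)
Lemma curvature_pos x : 0 < h x + h2 x.
Proof.
  assert (Hinc : increasing (nangle h h1)).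
  { intros a b [L|<-]; [|lra]. left.
    apply conj_nangle_increasing; try assumption.
    - apply smooth_h_continuous. - apply smooth_h1_continuous. }
  assert (pr : derivable (nangle h h1)).
  { intros y. exists (nspeed y). apply is_derive_Reals, nangle_derive. }
  pose proof (nonneg_derivative_0 _ pr Hinc x) as Hn.
  rewrite (derive_pt_eq_0 _ x (nspeed x)) in Hn by apply is_derive_Reals, nangle_derive.
  pose proof (nspeed_inverse x) as Hs.
  assert (Hs' : 0 < nspeed x) by (destruct Hn as [L|E]; [exact L|rewrite <- E in Hs; lra]).
  pose proof (norm_pos x) as HN. pose proof (Hp x).
  unfold nspeed in Hs'.
  apply Rmult_lt_compat_r with (r := h x ^ 2 + h1 x ^ 2) in Hs'; [|exact HN].
  replace (h x * (h x + h2 x) / (h x ^ 2 + h1 x ^ 2) * (h x ^ 2 + h1 x ^ 2))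
    with (h x * (h x + h2 x)) in Hs' by (field; lra). nra.
Qed.

Context (B0 : h 0 = 1) (B1 : h1 0 = 0) (Hmax : forall x, h x <= 1).

Lemma conj_0 : conj_angle h h1 0 = PI / 2.
Proof. unfold conj_angle, nangle. rewrite B0, B1. unfold Rdiv at 1. rewrite Rmult_0_l, atan_0. ring. Qed.

Lemma conj_PI2 : conj_angle h h1 (PI / 2) = PI.
Proof. rewrite <- conj_0 at 1. rewrite Hinv. ring. Qed.

Lemma h1_PI2 : h1 (PI / 2) = 0.
Proof.
  pose proof conj_PI2 as E. unfold conj_angle, nangle in E.
  assert (A : atan (h1 (PI / 2) / h (PI / 2)) = 0) by lra.
  assert (h1 (PI / 2) / h (PI / 2) = 0).
  { rewrite <- (tan_atan (h1 (PI / 2) / h (PI / 2))), A. apply tan_0. }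
  pose proof (Hp (PI / 2)).
  replace (h1 (PI / 2)) with (h1 (PI / 2) / h (PI / 2) * h (PI / 2)) by (field; lra).
  rewrite H. ring.
Qed.

(** The angles between the radius and the normal at conjugate angles are opposite. *)
Lemma logder_conj x :
  h1 (conj_angle h h1 x) / h (conj_angle h h1 x) = - (h1 x / h x).
Proof.
  pose proof (Hinv x) as E. unfold conj_angle at 1, nangle at 1 in E.
  set (y := conj_angle h h1 x) in *.
  assert (A : atan (h1 y / h y) = atan (- (h1 x / h x))).
  { rewrite atan_opp. unfold y at 1 in E. unfold conj_angle, nangle in E. fold y in E.
    unfold y, conj_angle, nangle in *. lra. }
  rewrite <- (tan_atan (h1 y / h y)), A. apply tan_atan.
Qed.

(** The squared product has derivative 0 by [logder_conj], and its value at 0 is the square of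
    [h (PI / 2)]. *)
Lemma smooth_dual x : / h (PI / 2) * h (conj_angle h h1 x) * amp h h1 x = 1.
Proof.
  set (T := conj_angle h h1).
  set (f := fun y => h (T y) ^ 2 * (h y ^ 2 + h1 y ^ 2)).
  set (df := fun y => 2 * h (T y) * (h1 (T y) * nspeed y) * (h y ^ 2 + h1 y ^ 2)
      + h (T y) ^ 2 * (2 * h y * h1 y + 2 * h1 y * h2 y)).
  assert (Df : forall y, is_derive f y (df y)).
  { intros y. unfold f, df. pose proof (D0 y) as E0. pose proof (D1 y) as E1.
    pose proof (conj_derive y) as ET. fold T in ET. pose proof (D0 (T y)) as E2.
    auto_derive. { repeat split; eexists; eassumption. }
    derive_rw E0. derive_rw E1. derive_rw ET. derive_rw E2. ring. }
  assert (Z : forall y, df y = 0).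
  { intros y. unfold df. pose proof (logder_conj y) as L. fold T in L.
    pose proof (Hp y). pose proof (Hp (T y)). pose proof (norm_pos y).
    replace (h1 (T y)) with (- (h1 y / h y) * h (T y)) by (rewrite <- L; field; lra).
    unfold nspeed. field. split; lra. }
  assert (Fx : f x = f 0).
  { destruct (Rle_or_lt 0 x) as [L|L].
    - now apply (zero_derive_constant f df).
    - symmetry. apply (zero_derive_constant f df); [lra|intros; apply Df|intros; apply Z]. }
  unfold f in Fx. unfold T in Fx. rewrite conj_0, B0, B1 in Fx. rewrite <- amp_sqr in Fx.
  fold T in Fx. pose proof (Hp (PI / 2)) as P. pose proof (Hp (T x)) as P1.
  pose proof (amp_pos h h1 x (Hp x)) as P2.
  set (q := h (T x) * amp h h1 x).
  assert (Eq : q ^ 2 = h (PI / 2) ^ 2).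
  { unfold q. rewrite Rpow_mult_distr, Fx. ring. }
  assert (0 < q) by (apply Rmult_lt_0_compat; assumption).
  assert (q = h (PI / 2)) by nra.
  rewrite Rmult_assoc. fold q. rewrite H0. field. lra.
Qed.

Lemma smooth_radon : radon h h1 (/ h (PI / 2)).
Proof.
  constructor; try assumption.
  - apply smooth_h1_continuous.
  - apply Rinv_0_lt_compat, Hp.
  - apply smooth_dual.
Qed.

(** The radius [1 / h] and its derivatives. *)
Definition rad0 (x : R) : R := / h x.
Definition rad1 (x : R) : R := - h1 x / h x ^ 2.
Definition rad2 (x : R) : R := - h2 x / h x ^ 2 + 2 * h1 x ^ 2 / h x ^ 3.

Lemma rad0_derive x : is_derive rad0 x (rad1 x).
Proof.
  unfold rad0, rad1. pose proof (D0 x) as E0. pose proof (Hp x).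
  auto_derive. { split; [eexists; exact E0|]. lra. } derive_rw E0. field. lra.
Qed.

Lemma rad1_derive x : is_derive rad1 x (rad2 x).
Proof.
  unfold rad1, rad2. pose proof (D0 x) as E0. pose proof (D1 x) as E1. pose proof (Hp x).
  auto_derive. { repeat split; try (eexists; eassumption). apply Rgt_not_eq.
    repeat apply Rmult_lt_0_compat; lra. }
  derive_rw E0. derive_rw E1. field. lra.
Qed.

Lemma Rinv_pow_continuous n x : continuous (fun y => / h y ^ n) x.
Proof.
  apply continuous_Rinv_comp.
  - induction n as [|n IH]; [apply continuous_const|].
    apply (continuous_mult (K := R_AbsRing) h); [apply smooth_h_continuous|exact IH].
  - apply pow_nonzero. pose proof (Hp x). lra.
Qed.

Lemma rad2_continuous x : continuous rad2 x.
Proof.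
  pose proof (smooth_h1_continuous x). pose proof (Rinv_pow_continuous 2 x).
  pose proof (Rinv_pow_continuous 3 x). pose proof (C2 x).
  apply (continuous_ext (fun y => - h2 y * / h y ^ 2 + 2 * (h1 y * h1 y) * / h y ^ 3)).
  { intros y. change (- h2 y * / h y ^ 2 + 2 * (h1 y * h1 y) * / h y ^ 3
      = - h2 y / h y ^ 2 + 2 * h1 y ^ 2 / h y ^ 3 :> R).
    unfold Rdiv. ring. }
  continuous_arith; assumption.
Qed.

Lemma rad_C2 : C_n_in quarter 2 rad0.
Proof.
  apply (C_n_in_of_chain 2 (fun k => match k with 0%nat => rad0 | 1%nat => rad1 | _ => rad2 end)).
  - intros [|[|k]] x Hk; [apply rad0_derive|apply rad1_derive|lia].
  - apply rad2_continuous.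
Qed.

Lemma rad_d x : quarter x -> d_quarter 1 rad0 x = rad1 x /\ d_quarter 2 rad0 x = rad2 x.
Proof.
  intros Hx.
  pose proof (derive_chain_in 2 (fun k => match k with 0%nat => rad0 | 1%nat => rad1 | _ => rad2 end)) as E.
  cbv beta in E. split; [apply (E ltac:(intros [|[|k]] y Hk; [apply rad0_derive|apply rad1_derive|lia]) 1%nat x)
    |apply (E ltac:(intros [|[|k]] y Hk; [apply rad0_derive|apply rad1_derive|lia]) 2%nat x)]; lia || exact Hx.
Qed.

Lemma rad_curvature x : quarter x -> curvature_ineq rad0 x.
Proof.
  intros Hx. unfold curvature_ineq. destruct (rad_d x Hx) as [-> ->].
  unfold rad0, rad1, rad2. pose proof (Hp x) as P. pose proof (curvature_pos x) as Q.
  assert (0 < (h x + h2 x) / h x ^ 3).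
  { apply Rdiv_lt_0_compat; [exact Q|]. now apply pow_lt. }
  apply Rlt_0_minus.
  replace (_ - _) with ((h x + h2 x) / h x ^ 3) by (field; lra). exact H.
Qed.

Lemma rad_boundary : boundary_cond rad0 (/ h (PI / 2)).
Proof.
  unfold boundary_cond.
  destruct (rad_d 0 quarter_0) as [-> _]. destruct (rad_d (PI / 2) quarter_PI2) as [-> _].
  unfold rad0, rad1. rewrite B0, B1, h1_PI2, Rinv_1. unfold Rdiv. repeat split; ring.
Qed.

Lemma rad_rs : 1 <= / h (PI / 2).
Proof. rewrite <- Rinv_1. apply Rinv_le_contravar; [apply Hp|apply Hmax]. Qed.

Lemma rad_pos : pos_on_quarter rad0.
Proof. intros x _. apply Rinv_0_lt_compat, Hp. Qed.

(** The construction from the quarter yields a Radon curve with the same first quarter and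
    the same constant, so [radon_unique] applies. *)
Lemma rtilde_rad x : rtilde rad0 (/ h (PI / 2)) x = / h x.
Proof.
  assert (Hae : ae_in quarter (curvature_ineq rad0)) by (apply ae_of_everywhere, rad_curvature).
  destruct (radon_of_quarter rad0 (/ h (PI / 2)) rad_pos rad_C2 Hae rad_rs rad_boundary)
    as [_ [_ [g [dg [Hg Eg]]]]].
  rewrite Eg. f_equal.
  apply (radon_unique h h1 g dg (/ h (PI / 2)) smooth_radon Hg conj_0).
  intros y Hy. pose proof (Eg y) as E. rewrite (rtilde_quarter _ _ _ Hy) in E.
  unfold rad0 in E. rewrite <- (Rinv_inv (g y)), <- E. apply Rinv_inv.
Qed.

End Smooth.

(** * Third derivatives *)

Section Third.
Context (h h1 h2 h3 : R -> R)
  (Hp : forall x, 0 < h x)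
  (D0 : forall x, is_derive h x (h1 x)) (D1 : forall x, is_derive h1 x (h2 x))
  (D2 : forall x, is_derive h2 x (h3 x)) (C3 : forall x, continuous h3 x).

Definition rad3 (x : R) : R :=
  - h3 x / h x ^ 2 + 6 * h1 x * h2 x / h x ^ 3 - 6 * h1 x ^ 3 / h x ^ 4.

Lemma rad2_derive x : is_derive (rad2 h h1 h2) x (rad3 x).
Proof.
  unfold rad2, rad3. pose proof (D0 x) as E0. pose proof (D1 x) as E1. pose proof (D2 x) as E2.
  pose proof (Hp x).
  auto_derive. { repeat split; try (eexists; eassumption); apply Rgt_not_eq;
    repeat apply Rmult_lt_0_compat; lra. }
  derive_rw E0. derive_rw E1. derive_rw E2. field. lra.
Qed.

Lemma rad3_continuous x : continuous rad3 x.
Proof.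
  pose proof (continuous_of_derive h1 x _ (D1 x)) as K1.
  pose proof (continuous_of_derive h2 x _ (D2 x)) as K2. pose proof (C3 x) as K3.
  pose proof (Rinv_pow_continuous h h1 Hp D0 2 x). pose proof (Rinv_pow_continuous h h1 Hp D0 3 x).
  pose proof (Rinv_pow_continuous h h1 Hp D0 4 x).
  apply (continuous_ext (fun y => - h3 y * / h y ^ 2 + 6 * (h1 y * h2 y) * / h y ^ 3
    - 6 * (h1 y * (h1 y * h1 y)) * / h y ^ 4)).
  { intros y. change (- h3 y * / h y ^ 2 + 6 * (h1 y * h2 y) * / h y ^ 3
    - 6 * (h1 y * (h1 y * h1 y)) * / h y ^ 4
      = - h3 y / h y ^ 2 + 6 * h1 y * h2 y / h y ^ 3 - 6 * h1 y ^ 3 / h y ^ 4 :> R).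
    unfold Rdiv. ring. }
  continuous_arith; assumption.
Qed.

Definition rad_chain (k : nat) : R -> R :=
  match k with
  | 0%nat => rad0 h | 1%nat => rad1 h h1 | 2%nat => rad2 h h1 h2 | _ => rad3
  end.

Lemma rad_chain_derive k x : (k < 3)%nat -> is_derive (rad_chain k) x (rad_chain (S k) x).
Proof.
  intros Hk. destruct k as [|[|[|k]]]; [| | |lia].
  - now apply rad0_derive. - now apply rad1_derive. - apply rad2_derive.
Qed.

Lemma rad_C3 : C_n_in quarter 3 (rad0 h).
Proof. apply (C_n_in_of_chain 3 rad_chain rad_chain_derive rad3_continuous). Qed.

Lemma rad_d3 x : quarter x -> d_quarter 3 (rad0 h) x = rad3 x.
Proof. intros Hx. apply (derive_chain_in 3 rad_chain rad_chain_derive 3%nat x); [lia|exact Hx]. Qed.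

Context (Hinv : forall x, conj_angle h h1 (conj_angle h h1 x) = x + PI)
  (B0 : h 0 = 1) (B1 : h1 0 = 0).

(** The other terms of the derivative have the factor [h1 x]. *)
Lemma nspeed_derive x : h1 x = 0 -> is_derive (nspeed h h1 h2) x (h3 x / h x).
Proof.
  intros Z. unfold nspeed. pose proof (D0 x) as E0. pose proof (D1 x) as E1. pose proof (D2 x) as E2.
  pose proof (Hp x).
  auto_derive. { repeat split; try (eexists; eassumption). rewrite Z. apply Rgt_not_eq. nra. }
  derive_rw E0. derive_rw E1. derive_rw E2. rewrite Z. field. lra.
Qed.

(** The identity [nspeed_inverse] and its derivative, read at 0, whose conjugate is [PI / 2]. *)
Lemma rad_compat :
  d_quarter 2 (rad0 h) (PI / 2)
    = - (/ h (PI / 2) * d_quarter 2 (rad0 h) 0) / (1 - d_quarter 2 (rad0 h) 0) /\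
  d_quarter 3 (rad0 h) (PI / 2)
    = - (/ h (PI / 2) * d_quarter 3 (rad0 h) 0) / (1 - d_quarter 2 (rad0 h) 0) ^ 3.
Proof.
  pose proof (h1_PI2 h h1 Hp Hinv B0 B1) as Z1.
  pose proof (conj_0 h h1 B0 B1) as T0.
  destruct (rad_d h h1 h2 Hp D0 D1 0 quarter_0) as [_ ->].
  destruct (rad_d h h1 h2 Hp D0 D1 (PI / 2) quarter_PI2) as [_ ->].
  rewrite (rad_d3 0 quarter_0), (rad_d3 (PI / 2) quarter_PI2).
  pose proof (nspeed_inverse h h1 h2 Hp D0 D1 Hinv) as I.
  pose proof (I 0) as I0. rewrite T0 in I0.
  pose proof (conj_derive h h1 h2 Hp D0 D1 0) as ET.
  pose proof (nspeed_derive 0 B1) as S0. pose proof (nspeed_derive (PI / 2) Z1) as S1.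
  set (T := conj_angle h h1) in *.
  assert (E : is_derive (fun y => nspeed h h1 h2 (T y) * nspeed h h1 h2 y) 0
     (h3 (PI / 2) / h (PI / 2) * nspeed h h1 h2 0 * nspeed h h1 h2 0
      + nspeed h h1 h2 (PI / 2) * (h3 0 / h 0))).
  { rewrite <- T0 in S1 |- *. auto_derive.
    { split; [eexists; exact S1|]. split; [eexists; exact ET|]. split; [eexists; exact S0|easy]. }
    derive_rw S1. derive_rw ET. derive_rw S0. ring. }
  assert (E' : is_derive (fun y => nspeed h h1 h2 (T y) * nspeed h h1 h2 y) 0 0).
  { apply (is_derive_ext (fun _ => 1)).
    - intros y. symmetry. apply I.
    - apply (is_derive_const (K := R_AbsRing) (V := R_NormedModule)). }
  apply is_derive_unique in E, E'. rewrite E' in E.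
  pose proof (curvature_pos h h1 h2 Hp D0 D1 Hinv 0) as Cp. rewrite B0 in Cp.
  pose proof (Hp (PI / 2)) as P.
  unfold nspeed in I0, E. unfold rad2, rad3. rewrite B0, B1, Z1 in *.
  set (m := h (PI / 2)) in *. set (a := h2 0) in *. set (b := h2 (PI / 2)) in *.
  set (c := h3 0) in *. set (d := h3 (PI / 2)) in *.
  replace (m * (m + b) / (m ^ 2 + 0 ^ 2)) with ((m + b) / m) in * by (field; repeat split; nra).
  replace (1 * (1 + a) / (1 ^ 2 + 0 ^ 2)) with (1 + a) in * by (field; repeat split; nra).
  assert (Em : (m + b) / m = / (1 + a)).
  { apply Rmult_eq_reg_r with (1 + a); [|lra]. rewrite I0. field. lra. }
  assert (Eb : b = - m * a / (1 + a)).
  { replace b with (m * ((m + b) / m) - m) by (field; lra). rewrite Em. field. lra. }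
  rewrite Em in E.
  assert (Ed : d = - m * c / (1 + a) ^ 3).
  { assert (E2 : d / m * (1 + a) * (1 + a) = - (/ (1 + a) * (c / 1))) by lra.
    replace d with (d / m * (1 + a) * (1 + a) * m / (1 + a) ^ 2) by (field; lra).
    rewrite E2. field. lra. }
  rewrite Eb, Ed. split; field; lra.
Qed.

End Third.

(** * Hoelder functions on the quarter *)

(** The bound on the values is included so that the class is stable under products. *)
Definition holder_quarter (alpha : R) (f : R -> R) : Prop :=
  exists C, 0 <= C /\ (forall x, quarter x -> Rabs (f x) <= C) /\
    forall x y, quarter x -> quarter y -> x <> y ->
      Rabs (f x - f y) <= C * Rpower (Rabs (x - y)) alpha.

Lemma Rpower_nonneg x a : 0 <= Rpower x a.
Proof. left. apply exp_pos. Qed.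

Lemma holder_quarter_plus alpha f g : holder_quarter alpha f -> holder_quarter alpha g ->
  holder_quarter alpha (fun x => f x + g x).
Proof.
  intros [C [HC [Bf Hf]]] [D [HD [Bg Hg]]]. exists (C + D). split; [lra|]. split.
  - intros x Hx. eapply Rle_trans; [apply Rabs_triang|]. specialize (Bf x Hx). specialize (Bg x Hx). lra.
  - intros x y Hx Hy Hne. replace (f x + g x - (f y + g y)) with ((f x - f y) + (g x - g y)) by ring.
    eapply Rle_trans; [apply Rabs_triang|].
    specialize (Hf x y Hx Hy Hne). specialize (Hg x y Hx Hy Hne). lra.
Qed.

Lemma holder_quarter_mult alpha f g : holder_quarter alpha f -> holder_quarter alpha g ->
  holder_quarter alpha (fun x => f x * g x).
Proof.
  intros [C [HC [Bf Hf]]] [D [HD [Bg Hg]]]. exists (2 * (C * D)).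
  assert (HCD : 0 <= C * D) by (apply Rmult_le_pos; assumption). split; [lra|]. split.
  - intros x Hx. rewrite Rabs_mult. specialize (Bf x Hx). specialize (Bg x Hx).
    apply Rle_trans with (C * D); [|lra]. apply Rmult_le_compat; try apply Rabs_pos; assumption.
  - intros x y Hx Hy Hne.
    replace (f x * g x - f y * g y) with ((f x - f y) * g x + f y * (g x - g y)) by ring.
    eapply Rle_trans; [apply Rabs_triang|]. rewrite !Rabs_mult.
    specialize (Hf x y Hx Hy Hne). specialize (Hg x y Hx Hy Hne).
    specialize (Bf y Hy). specialize (Bg x Hx).
    set (P := Rpower _ _) in *. assert (HP : 0 <= P) by apply Rpower_nonneg.
    assert (Rabs (f x - f y) * Rabs (g x) <= (C * P) * D)
      by (apply Rmult_le_compat; try apply Rabs_pos; assumption).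
    assert (Rabs (f y) * Rabs (g x - g y) <= C * (D * P))
      by (apply Rmult_le_compat; try apply Rabs_pos; assumption).
    lra.
Qed.

Lemma holder_quarter_ext alpha f g : (forall x, f x = g x) -> holder_quarter alpha f ->
  holder_quarter alpha g.
Proof.
  intros E [C [HC [B Hf]]]. exists C. split; [exact HC|]. split.
  - intros x Hx. rewrite <- E. now apply B.
  - intros x y Hx Hy Hne. rewrite <- !E. now apply Hf.
Qed.

Lemma quarter_bounded (f : R -> R) : (forall x, continuous f x) ->
  exists B, 0 <= B /\ forall x, quarter x -> Rabs (f x) <= B.
Proof.
  intros Hc. destruct (continuity_ab_maj (fun x => Rabs (f x)) 0 (PI / 2)) as [m [Hm _]].
  - pose proof PI_RGT_0. lra.
  - intros c _. apply continuity_pt_filterlim.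
    apply (continuous_comp f Rabs); [apply Hc|apply continuous_Rabs].
  - exists (Rabs (f m)). split; [apply Rabs_pos|exact Hm].
Qed.

(** Local Hoelder bounds concatenate, because powers of lengths are monotone. *)
Lemma holder_quarter_of_local alpha f : 0 < alpha ->
  (forall x, continuous f x) ->
  (forall x, exists d C, 0 < d /\ forall u v, Rabs (u - x) < d -> Rabs (v - x) < d -> u <> v ->
     Rabs (f u - f v) <= C * Rpower (Rabs (u - v)) alpha) ->
  holder_quarter alpha f.
Proof.
  intros Ha Hc Hloc.
  set (P := fun a b => exists C, 0 <= C /\ forall u v, a <= u -> u < v -> v <= b ->
     Rabs (f u - f v) <= C * Rpower (v - u) alpha).
  assert (HP : P 0 (PI / 2)).
  { apply interval_induction.
    - pose proof PI_RGT_0. lra.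
    - intros x _. destruct (Hloc x) as [d [C [Hd H]]]. exists d. split; [exact Hd|].
      intros a b H1 H2 H3. exists (Rabs C). split; [apply Rabs_pos|].
      intros u v Hu Huv Hv.
      assert (Hu' : Rabs (u - x) < d) by (apply Rabs_lt_between'; lra).
      assert (Hv' : Rabs (v - x) < d) by (apply Rabs_lt_between'; lra).
      specialize (H u v Hu' Hv' ltac:(lra)).
      rewrite (Rabs_minus_sym u v), (Rabs_pos_eq (v - u)) in H by lra.
      eapply Rle_trans; [exact H|]. apply Rmult_le_compat_r; [apply Rpower_nonneg|apply Rle_abs].
    - intros a m b Ham Hmb [C1 [HC1 H1]] [C2 [HC2 H2]]. exists (C1 + C2). split; [lra|].
      intros u v Hu Huv Hv.
      assert (Mono : forall p q, 0 < p -> p <= q -> Rpower p alpha <= Rpower q alpha).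
      { intros p q Hp Hpq. apply Rle_Rpower_l; lra. }
      pose proof (Rpower_nonneg (v - u) alpha) as N.
      destruct (Rle_or_lt v m) as [L1|L1].
      { specialize (H1 u v Hu Huv L1). nra. }
      destruct (Rle_or_lt m u) as [L2|L2].
      { specialize (H2 u v L2 Huv Hv). nra. }
      specialize (H1 u m Hu L2 ltac:(lra)). specialize (H2 m v ltac:(lra) L1 Hv).
      pose proof (Mono (m - u) (v - u) ltac:(lra) ltac:(lra)) as M1.
      pose proof (Mono (v - m) (v - u) ltac:(lra) ltac:(lra)) as M2.
      replace (f u - f v) with ((f u - f m) + (f m - f v)) by ring.
      eapply Rle_trans; [apply Rabs_triang|]. nra. }
  destruct HP as [C [HC H]].
  destruct (quarter_bounded f Hc) as [B [HB0 HB]]. exists (C + B). split; [lra|]. split.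
  - intros x Hx. specialize (HB x Hx). lra.
  - intros x y [X1 X2] [Y1 Y2] Hne.
    pose proof (Rpower_nonneg (Rabs (x - y)) alpha) as N.
    destruct (Rtotal_order x y) as [L|[L|L]]; [|easy|].
    + specialize (H x y X1 L Y2). rewrite (Rabs_minus_sym x y), (Rabs_pos_eq (y - x)) in * by lra. nra.
    + specialize (H y x Y1 L X2). rewrite (Rabs_minus_sym (f x)).
      rewrite (Rabs_pos_eq (x - y)) in * by lra. nra.
Qed.

(** Distances up to 2 suffice, as the quarter has length less than 2. *)
Lemma dist_le_Rpower alpha t : 0 < alpha <= 1 -> 0 < t <= 2 -> t <= 2 * Rpower t alpha.
Proof.
  intros Ha Ht. rewrite <- (Rpower_1 t) at 1 by lra.
  replace 1 with ((1 - alpha) + alpha) by ring. rewrite Rpower_plus.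
  apply Rmult_le_compat_r; [apply Rpower_nonneg|].
  apply Rle_trans with (Rpower 2 (1 - alpha)); [apply Rle_Rpower_l; lra|].
  rewrite <- (Rpower_1 2) at 2 by lra. apply Rle_Rpower; lra.
Qed.

Lemma holder_quarter_of_C1 alpha f df : 0 < alpha <= 1 ->
  (forall x, is_derive f x (df x)) -> (forall x, continuous df x) -> holder_quarter alpha f.
Proof.
  intros Ha Df Cdf.
  assert (Cf : forall x, continuous f x) by (intros x; apply (continuous_of_derive f x (df x)), Df).
  destruct (quarter_bounded f Cf) as [B [HB0 HB]]. destruct (quarter_bounded df Cdf) as [L [HL0 HL]].
  exists (B + 2 * L). split; [lra|]. split.
  - intros x Hx. specialize (HB x Hx). lra.
  - intros x y Hx Hy Hne.
    destruct (MVT_gen f y x df) as [c [Hc E]].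
    + intros z _. apply Df.
    + intros z _. apply continuity_pt_filterlim, Cf.
    + assert (Qc : quarter c).
      { destruct Hx, Hy. unfold quarter. revert Hc. unfold Rmin, Rmax. destruct Rle_dec; lra. }
      rewrite E, Rabs_mult. specialize (HL c Qc).
      assert (Hd : 0 < Rabs (x - y) <= 2).
      { split; [apply Rabs_pos_lt; lra|]. destruct Hx, Hy. pose proof PI_4.
        apply Rabs_le. lra. }
      pose proof (dist_le_Rpower alpha _ Ha Hd). pose proof (Rpower_nonneg (Rabs (x - y)) alpha).
      apply Rle_trans with (L * (2 * Rpower (Rabs (x - y)) alpha)); [|nra].
      apply Rmult_le_compat; try apply Rabs_pos; assumption.
Qed.

Lemma cos_lipschitz u v : Rabs (cos u - cos v) <= Rabs (u - v).
Proof.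
  destruct (MVT_gen cos v u (fun x => - sin x)) as [c [_ E]].
  - intros x _. auto_derive; [easy|ring].
  - intros x _. apply continuity_cos.
  - rewrite E, Rabs_mult. rewrite <- (Rmult_1_l (Rabs (u - v))) at 2.
    apply Rmult_le_compat_r; [apply Rabs_pos|]. rewrite Rabs_Ropp. apply Rabs_le.
    pose proof (SIN_bound c). lra.
Qed.

Lemma sin_lipschitz u v : Rabs (sin u - sin v) <= Rabs (u - v).
Proof.
  destruct (MVT_gen sin v u cos) as [c [_ E]].
  - intros x _. auto_derive; [easy|ring].
  - intros x _. apply continuity_sin.
  - rewrite E, Rabs_mult. rewrite <- (Rmult_1_l (Rabs (u - v))) at 2.
    apply Rmult_le_compat_r; [apply Rabs_pos|]. apply Rabs_le.
    pose proof (COS_bound c). lra.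
Qed.

Lemma norm2_circle u v : norm2 (cos u - cos v) (sin u - sin v) <= 2 * Rabs (u - v).
Proof.
  unfold norm2. rewrite <- (sqrt_pow2 (2 * Rabs (u - v))).
  2:{ pose proof (Rabs_pos (u - v)). lra. }
  apply sqrt_le_1_alt.
  pose proof (cos_lipschitz u v) as Hc. pose proof (sin_lipschitz u v) as Hs.
  rewrite <- (pow2_abs (cos u - cos v)), <- (pow2_abs (sin u - sin v)).
  pose proof (Rabs_pos (cos u - cos v)). pose proof (Rabs_pos (sin u - sin v)). nra.
Qed.

(** The unit circle is traversed with Lipschitz coordinates. *)
Lemma polar_partial_holder n alpha p q H a : (p + q = n)%nat -> 0 < alpha <= 1 ->
  C_n_alpha_loc_punctured n alpha H ->
  holder_quarter alpha (fun x => polar_partial H p q 1 (x + a)).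
Proof.
  intros Hpq Ha [HC Hh]. apply holder_quarter_of_local; [lra| |].
  - intros x. apply (continuous_comp (fun x => x + a) (polar_partial H p q 1)).
    + apply (continuous_plus (V := R_NormedModule)); [apply continuous_id|apply continuous_const].
    + apply (polar_partial_continuous n); [exact HC|lia|lra].
  - intros x.
    destruct (Hh p q Hpq _ _ (polar_nonzero 1 (x + a) Rlt_0_1)) as [d [C H0]].
    exists (d / 2), (Rabs C * Rpower 2 alpha). pose proof (cond_pos d). split; [lra|].
    assert (Near : forall u, Rabs (u - x) < d / 2 ->
      norm2 (1 * cos (u + a) - 1 * cos (x + a)) (1 * sin (u + a) - 1 * sin (x + a)) < d).
    { intros u Hu. rewrite !Rmult_1_l. eapply Rle_lt_trans; [apply norm2_circle|].
      replace (u + a - (x + a)) with (u - x) by ring. lra. }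
    intros u v Hu Hv Hne.
    destruct (classic ((1 * cos (u + a), 1 * sin (u + a)) = (1 * cos (v + a), 1 * sin (v + a)))) as [E|E].
    + injection E as E1 E2. unfold polar_partial. rewrite E1, E2, Rminus_diag, Rabs_R0.
      repeat apply Rmult_le_pos; try apply Rabs_pos; apply Rpower_nonneg.
    + specialize (H0 _ _ _ _ (Near u Hu) (Near v Hv) E). unfold polar_partial.
      eapply Rle_trans; [exact H0|].
      assert (Hn : 0 < norm2 (1 * cos (u + a) - 1 * cos (v + a)) (1 * sin (u + a) - 1 * sin (v + a))).
      { apply sqrt_lt_R0.
        set (p1 := 1 * cos (u + a)) in *. set (p2 := 1 * sin (u + a)) in *.
        set (q1 := 1 * cos (v + a)) in *. set (q2 := 1 * sin (v + a)) in *.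
        destruct (Req_dec p1 q1) as [E1|E1]; [destruct (Req_dec p2 q2) as [E2|E2]|].
        - now rewrite E1, E2 in E.
        - assert (0 < (p2 - q2) ^ 2) by (apply pow2_gt_0; lra). pose proof (pow2_ge_0 (p1 - q1)). lra.
        - assert (0 < (p1 - q1) ^ 2) by (apply pow2_gt_0; lra). pose proof (pow2_ge_0 (p2 - q2)). lra. }
      rewrite Rmult_assoc.
      apply Rle_trans with (Rabs C * Rpower (norm2 (1 * cos (u + a) - 1 * cos (v + a))
        (1 * sin (u + a) - 1 * sin (v + a))) alpha).
      { apply Rmult_le_compat_r; [apply Rpower_nonneg|apply Rle_abs]. }
      apply Rmult_le_compat_l; [apply Rabs_pos|].
      rewrite Rpower_mult_distr by (try lra; apply Rabs_pos_lt; lra).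
      apply Rle_Rpower_l; [lra|]. split; [exact Hn|]. rewrite !Rmult_1_l.
      eapply Rle_trans; [apply norm2_circle|]. right. do 2 f_equal. ring.
Qed.

(** * Similarities *)

(** The value at a point does not depend on the polar coordinates chosen for it. *)
Lemma gauge_exists (h : R -> R) : (forall th, h (th + PI) = h th) ->
  exists H, radial_gauge h H.
Proof.
  intros Hper.
  exists (fun x y => iota (fun v => exists t th, 0 <= t /\ x = t * cos th /\ y = t * sin th /\ v = t * h th)).
  intros t th Ht. apply (iota_unique (V := R_CompleteNormedModule)).
  - intros v [s [ph [Hs [E1 [E2 ->]]]]].
    pose proof (sin2_cos2 th) as SC1. pose proof (sin2_cos2 ph) as SC2. unfold Rsqr in SC1, SC2.
    assert (Est : s = t).
    { assert (s ^ 2 = t ^ 2); [|nra].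
      transitivity ((s * cos ph) ^ 2 + (s * sin ph) ^ 2).
      - transitivity (s ^ 2 * (sin ph * sin ph + cos ph * cos ph)); [rewrite SC2; ring|ring].
      - rewrite <- E1, <- E2.
        transitivity (t ^ 2 * (sin th * sin th + cos th * cos th)); [ring|rewrite SC1; ring]. }
    subst s. destruct Ht as [Ht|<-]; [|now rewrite !Rmult_0_l].
    apply Rmult_eq_reg_l in E1; [|lra]. apply Rmult_eq_reg_l in E2; [|lra].
    f_equal. symmetry. apply same_direction; try assumption.
    intros x. replace (x + 2 * PI) with (x + PI + PI) by ring. now rewrite !Hper.
  - exists t, th. repeat split. exact Ht.
Qed.

Lemma polar_set_ray (h rm : R -> R) : (forall th, 0 < h th) -> (forall th, h (th + PI) = h th) ->
  (forall th, rm th = / h th) -> forall t th, 0 <= t ->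
  (polar_set rm (t * cos th, t * sin th) <-> t * h th < 1).
Proof.
  intros Hp Hper Hr t th Ht. destruct (gauge_exists h Hper) as [H HH].
  rewrite <- (polar_set_gauge h H rm _ HH Hp Hr). unfold unit_ball; simpl. now rewrite HH.
Qed.

Lemma rotate_polar s t ph th :
  s * (cos ph * (t * cos th) - sin ph * (t * sin th)) = s * t * cos (th + ph) /\
  s * (sin ph * (t * cos th) + cos ph * (t * sin th)) = s * t * sin (th + ph).
Proof. rewrite cos_plus, sin_plus. split; ring. Qed.

Lemma similar_of_shift (H : R -> R -> R) (h g rm : R -> R) (s a : R) :
  radial_gauge h H -> 0 < s -> (forall th, 0 < g th) -> (forall th, g (th + PI) = g th) ->
  (forall th, rm th = / g th) -> (forall th, h th = s * g (th + a)) ->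
  similar_to (unit_ball H) (polar_set rm).
Proof.
  intros HH Hs Hg Hper Hr E. exists a, s. split; [exact Hs|]. intros x y.
  destruct (polar_coords0 x y) as [t [th [Ht [_ [-> ->]]]]].
  destruct (rotate_polar s t a th) as [-> ->].
  rewrite (polar_set_ray g rm Hg Hper Hr) by nra.
  unfold unit_ball; simpl. rewrite HH, E by exact Ht.
  replace (t * (s * g (th + a))) with (s * t * g (th + a)) by ring. tauto.
Qed.

(** On each ray the unit balls determine the gauges. *)
Lemma shift_of_similar (H : R -> R -> R) (h g rm : R -> R) :
  radial_gauge h H -> (forall th, 0 < h th) -> (forall th, 0 < g th) ->
  (forall th, g (th + PI) = g th) -> (forall th, rm th = / g th) ->
  similar_to (unit_ball H) (polar_set rm) ->
  exists s a, 0 < s /\ forall th, h th = s * g (th + a).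
Proof.
  intros HH Hh Hg Hper Hr [a [s [Hs E]]]. exists s, a. split; [exact Hs|]. intros th.
  assert (W : forall t, 0 <= t -> (t * h th < 1 <-> t * (s * g (th + a)) < 1)).
  { intros t Ht. specialize (E (t * cos th) (t * sin th)).
    destruct (rotate_polar s t a th) as [E1 E2]. rewrite E1, E2 in E.
    rewrite (polar_set_ray g rm Hg Hper Hr) in E by nra.
    unfold unit_ball in E; simpl in E. rewrite HH in E by exact Ht. rewrite E.
    replace (t * (s * g (th + a))) with (s * t * g (th + a)) by ring. tauto. }
  pose proof (Hh th) as P1. assert (P2 : 0 < s * g (th + a)) by (apply Rmult_lt_0_compat; [exact Hs|apply Hg]).
  set (p := h th) in *. set (q := s * g (th + a)) in *.
  pose proof (Rinv_0_lt_compat _ P1) as I1. pose proof (Rinv_0_lt_compat _ P2) as I2.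
  pose proof (Rinv_l p ltac:(lra)) as L1. pose proof (Rinv_l q ltac:(lra)) as L2.
  destruct (Rtotal_order p q) as [L|[L|L]]; [|exact L|]; exfalso.
  - assert (/ q * q < 1); [|lra]. apply W; [lra|]. rewrite <- L2. apply Rmult_lt_compat_l; lra.
  - assert (/ p * p < 1); [|lra]. apply W; [lra|]. rewrite <- L1. apply Rmult_lt_compat_l; lra.
Qed.

Lemma conj_shift (g dg : R -> R) s a x : 0 < s -> 0 < g (x + a) ->
  conj_angle (fun y => s * g (y + a)) (fun y => s * dg (y + a)) x = conj_angle g dg (x + a) - a.
Proof.
  intros Hs Hg. unfold conj_angle, nangle.
  replace (s * dg (x + a) / (s * g (x + a))) with (dg (x + a) / g (x + a)) by (field; lra). ring.
Qed.

Lemma derive_shift (f df : R -> R) s a x : is_derive f (x + a) (df (x + a)) ->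
  is_derive (fun y => s * f (y + a)) x (s * df (x + a)).
Proof. intros D. auto_derive; [eexists; exact D|]. derive_rw D. ring. Qed.

Lemma continuous_shift (f : R -> R) s a x : continuous f (x + a) ->
  continuous (fun y => s * f (y + a)) x.
Proof.
  intros C. apply (continuous_mult (K := R_AbsRing)); [apply continuous_const|].
  apply (continuous_comp (fun y => y + a) f); [|exact C].
  apply (continuous_plus (V := R_NormedModule)); [apply continuous_id|apply continuous_const].
Qed.

Lemma radon_shift (g dg : R -> R) k s a : 0 < s -> radon g dg k ->
  radon (fun x => s * g (x + a)) (fun x => s * dg (x + a)) (k / s ^ 2).
Proof.
  intros Hs HR. pose proof (radon_pos _ _ _ HR) as Hp.
  constructor.
  - intros x. apply Rmult_lt_0_compat; [exact Hs|apply Hp].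
  - intros x. apply derive_shift, HR.
  - intros x. apply continuous_shift, HR.
  - intros x. replace (x + PI + a) with (x + a + PI) by ring. now rewrite (radon_per _ _ _ HR).
  - intros x. rewrite !conj_shift by (try exact Hs; apply Hp).
    replace (conj_angle g dg (x + a) - a + a) with (conj_angle g dg (x + a)) by ring.
    rewrite (radon_inv _ _ _ HR). ring.
  - apply Rdiv_lt_0_compat; [apply HR|now apply pow_lt].
  - intros x. rewrite conj_shift by (try exact Hs; apply Hp).
    replace (conj_angle g dg (x + a) - a + a) with (conj_angle g dg (x + a)) by ring.
    rewrite <- (radon_dual _ _ _ HR (x + a)).
    assert (Ea : amp (fun x => s * g (x + a)) (fun x => s * dg (x + a)) x = s * amp g dg (x + a)).
    { unfold amp. rewrite <- (sqrt_pow2 s) at 3 by lra. rewrite <- sqrt_mult.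
      - f_equal. ring. - apply pow2_ge_0.
      - pose proof (pow2_ge_0 (g (x + a))). pose proof (pow2_ge_0 (dg (x + a))). lra. }
    rewrite Ea. field. lra.
Qed.

Lemma radon_ext (h dh g dg : R -> R) k : (forall x, h x = g x) -> (forall x, is_derive h x (dh x)) ->
  radon g dg k -> radon h dh k.
Proof.
  intros E Dh HR.
  assert (Ed : forall x, dh x = dg x).
  { intros x. rewrite <- (is_derive_unique _ _ _ (Dh x)).
    rewrite (Derive_ext h g x E). apply is_derive_unique, HR. }
  assert (Ec : forall x, conj_angle h dh x = conj_angle g dg x).
  { intros x. unfold conj_angle, nangle. now rewrite E, Ed. }
  constructor.
  - intros x. rewrite E. apply HR. - exact Dh.
  - intros x. apply (continuous_ext dg); [intros y; symmetry; apply Ed|apply HR].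
  - intros x. rewrite !E. apply HR.
  - intros x. rewrite !Ec. apply HR. - apply HR.
  - intros x. rewrite Ec, E. unfold amp. rewrite E, Ed. apply HR.
Qed.

(** * The set built from a quarter *)

(** The radius is that of a Radon curve, so all the conclusions are properties of
    Radon curves. *)
Lemma quarter_construction (r : R -> R) (rs : R) :
  pos_on_quarter r -> C_n_in quarter 2 r -> ae_in quarter (curvature_ineq r) ->
  1 <= rs -> boundary_cond r rs ->
  (forall eta, quarter eta -> PI / 2 <= tau r eta <= PI) /\
  (forall theta, PI / 2 <= theta <= PI -> exists! eta, quarter eta /\ tau r eta = theta) /\
  class_C1 (rtilde r rs) /\ strictly_convex (polar_set (rtilde r rs)) /\
  (exists H, polar_gauge (rtilde r rs) H /\ condition_S H).
Proof.
  intros Hpos HC2 Hae Hrs Hb.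
  destruct (radon_of_quarter r rs Hpos HC2 Hae Hrs Hb) as [T1 [T2 [h [dh [HR E]]]]].
  split; [exact T1|]. split; [exact T2|].
  pose proof (radon_pos _ _ _ HR) as Hp.
  destruct (gauge_exists h (radon_per _ _ _ HR)) as [H HH].
  split; [|split].
  - assert (D : forall x, is_derive (rtilde r rs) x (- dh x / h x ^ 2)).
    { intros x. apply (is_derive_ext (fun y => / h y)); [intros y; symmetry; apply E|].
      pose proof (radon_deriv _ _ _ HR x) as Dh. pose proof (Hp x).
      auto_derive; [split; [eexists; exact Dh|lra]|]. derive_rw Dh. field. lra. }
    intros x. split; [eexists; apply D|].
    apply (continuous_ext (fun y => - dh y * / (h y * h y))).
    { intros y. rewrite (is_derive_unique _ _ _ (D y)). pose proof (Hp y).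
      change (- dh y * / (h y * h y) = - dh y / h y ^ 2 :> R). field. lra. }
    pose proof (radon_hcont h dh rs HR x) as Ch.
    apply (continuous_mult (K := R_AbsRing)).
    + apply (continuous_opp (V := R_NormedModule)), HR.
    + apply continuous_Rinv_comp; [now apply (continuous_mult (K := R_AbsRing))|].
      pose proof (Hp x). apply Rgt_not_eq. now apply Rmult_lt_0_compat.
  - apply (strictly_convex_ext (unit_ball H)).
    + intros p. now apply (polar_set_gauge h).
    + now apply (radon_strictly_convex h dh rs HR).
  - exists H. split.
    + intros t th Ht _. rewrite HH, E by exact Ht. unfold Rdiv. now rewrite Rinv_inv.
    + now apply (radon_condition_S h dh rs HR).
Qed.

(** * Gauges satisfying the sign condition *)

Lemma max_angle (h : R -> R) : (forall x, continuous h x) -> (forall x, h (x + PI) = h x) ->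
  exists a, forall x, h x <= h a.
Proof.
  intros Hc Hper. destruct (continuity_ab_maj h 0 PI) as [a [Ha _]].
  - pose proof PI_RGT_0. lra.
  - intros c _. apply continuity_pt_filterlim, Hc.
  - exists a. intros x. destruct (shift_into PI 0 x PI_RGT_0) as [n Hn].
    rewrite <- (periodic_IZR h PI Hper n x). apply Ha. lra.
Qed.

Section Normalize.
Context (H : R -> R -> R) (Hh : pos_homogeneous H) (He : even2 H) (HC : C_n_punctured 2 H)
  (Hinv : forall x, conj_angle (circ0 H) (circ1 H) (conj_angle (circ0 H) (circ1 H) x) = x + PI)
  (a : R) (Ha : forall x, circ0 H x <= circ0 H a).

(** Rotation and scaling that bring the maximum of the gauge on the unit circle, attained at
    the angle [a], to the value 1 at angle 0. *)
Definition nrm (f : R -> R) (x : R) : R := / circ0 H a * f (x + a).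

Lemma nrm_scale_pos : 0 < / circ0 H a.
Proof. apply Rinv_0_lt_compat, circ_pos, Hh. Qed.

Lemma nrm_pos x : 0 < nrm (circ0 H) x.
Proof. apply Rmult_lt_0_compat; [apply nrm_scale_pos|apply circ_pos, Hh]. Qed.

Lemma nrm_per x : nrm (circ0 H) (x + PI) = nrm (circ0 H) x.
Proof. unfold nrm. replace (x + PI + a) with (x + a + PI) by ring. now rewrite circ_per. Qed.

Lemma nrm_derive0 x : is_derive (nrm (circ0 H)) x (nrm (circ1 H) x).
Proof. apply derive_shift, circ0_derive. now apply (punctured_le 2); [lia|]. Qed.

Lemma nrm_derive1 x : is_derive (nrm (circ1 H)) x (nrm (circ2 H) x).
Proof. now apply derive_shift, circ1_derive. Qed.

Lemma nrm_continuous2 x : continuous (nrm (circ2 H)) x.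
Proof. now apply continuous_shift, circ2_continuous. Qed.

Lemma nrm_inv x : conj_angle (nrm (circ0 H)) (nrm (circ1 H))
  (conj_angle (nrm (circ0 H)) (nrm (circ1 H)) x) = x + PI.
Proof.
  unfold nrm. rewrite !conj_shift by (apply nrm_scale_pos || now apply circ_pos).
  replace (conj_angle (circ0 H) (circ1 H) (x + a) - a + a)
    with (conj_angle (circ0 H) (circ1 H) (x + a)) by ring.
  rewrite Hinv. ring.
Qed.

Lemma nrm_0 : nrm (circ0 H) 0 = 1.
Proof. unfold nrm. rewrite Rplus_0_l. pose proof (circ_pos H Hh a). field. lra. Qed.

Lemma nrm_max x : nrm (circ0 H) x <= 1.
Proof.
  rewrite <- nrm_0. unfold nrm. apply Rmult_le_compat_l; [left; apply nrm_scale_pos|].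
  rewrite Rplus_0_l. apply Ha.
Qed.

(** The angle 0 is a maximum. *)
Lemma nrm1_0 : nrm (circ1 H) 0 = 0.
Proof.
  pose proof (nrm_derive0 0) as D.
  assert (- nrm (circ1 H) 0 = 0); [|lra].
  apply (derive_at_minimum (fun x => - nrm (circ0 H) x) 0).
  - apply (is_derive_opp (K := R_AbsRing) (V := R_NormedModule)). exact D.
  - intros y. rewrite nrm_0. pose proof (nrm_max y). lra.
Qed.

Definition nrad : R -> R := rad0 (nrm (circ0 H)).
Definition nrs : R := / nrm (circ0 H) (PI / 2).

Lemma nrm_similar : similar_to (unit_ball H) (polar_set (rtilde nrad nrs)).
Proof.
  apply (similar_of_shift H (circ0 H) (nrm (circ0 H)) _ (circ0 H a) (- a)).
  - now apply circ_gauge.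
  - now apply circ_pos.
  - exact nrm_pos.
  - exact nrm_per.
  - apply (rtilde_rad (nrm (circ0 H)) (nrm (circ1 H)) (nrm (circ2 H)));
      first [exact nrm_pos|exact nrm_per|exact nrm_derive0|exact nrm_derive1|exact nrm_continuous2
            |exact nrm_inv|exact nrm_0|exact nrm1_0|exact nrm_max].
  - intros th. unfold nrm. replace (th + - a + a) with th by ring.
    pose proof (circ_pos H Hh a). field. lra.
Qed.

Lemma nrm_quarter_data : pos_on_quarter nrad /\ 1 <= nrs /\ boundary_cond nrad nrs /\
  (forall x, quarter x -> curvature_ineq nrad x) /\ C_n_in quarter 2 nrad.
Proof.
  split; [apply rad_pos, nrm_pos|]. split; [apply rad_rs; [exact nrm_pos|exact nrm_max]|].
  split; [|split].
  - apply (rad_boundary (nrm (circ0 H)) (nrm (circ1 H)) (nrm (circ2 H)));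
      first [exact nrm_pos|exact nrm_derive0|exact nrm_derive1|exact nrm_inv|exact nrm_0|exact nrm1_0].
  - apply (rad_curvature (nrm (circ0 H)) (nrm (circ1 H)) (nrm (circ2 H)));
      first [exact nrm_pos|exact nrm_derive0|exact nrm_derive1|exact nrm_inv].
  - apply (rad_C2 (nrm (circ0 H)) (nrm (circ1 H)) (nrm (circ2 H)));
      first [exact nrm_pos|exact nrm_derive0|exact nrm_derive1|exact nrm_continuous2].
Qed.

End Normalize.

(** Strict convexity supplies the supporting lines with which the sign condition becomes the
    involution. *)
Lemma quarter_of_gauge (H : R -> R -> R) :
  pos_homogeneous H -> even2 H -> C_n_punctured 2 H -> strictly_convex (unit_ball H) ->
  condition_S H ->
  exists (r : R -> R) (rs : R),
    pos_on_quarter r /\ C_n_in quarter 2 r /\ ae_in quarter (curvature_ineq r) /\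
    1 <= rs /\ boundary_cond r rs /\
    similar_to (unit_ball H) (polar_set (rtilde r rs)).
Proof.
  intros Hh He HC Hsc HS.
  assert (HC1 : C_n_punctured 1 H) by (apply (punctured_le 2); [lia|exact HC]).
  assert (Hs : supported (circ0 H) (circ1 H)) by now apply supported_of_strictly_convex.
  pose proof (conj_involution_of_S H Hh He HC1 Hs HS) as Hinv.
  destruct (max_angle (circ0 H) (circ0_continuous H HC1) (circ_per H He)) as [a Ha].
  destruct (nrm_quarter_data H Hh HC Hinv a Ha) as [B1 [B2 [B3 [B4 B5]]]].
  exists (nrad H a), (nrs H a).
  split; [exact B1|]. split; [exact B5|]. split; [now apply ae_of_everywhere|].
  split; [exact B2|]. split; [exact B3|]. now apply nrm_similar.
Qed.

(** * Uniform ellipticity *)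

Section Elliptic.
Context (H : R -> R -> R) (Hh : pos_homogeneous H) (He : even2 H) (HC : C_n_punctured 2 H).

Lemma elliptic_C1 : C_n_punctured 1 H.
Proof. apply (punctured_le 2); [lia|exact HC]. Qed.

(** The gradient is constant along rays, so the Hessian annihilates the radial direction
    and is determined by its value in the orthogonal direction. *)
Lemma polar_hessian t th : 0 < t ->
  let m := (circ0 H th + circ2 H th) / t in
  polar_partial H 2 0 t th = m * sin th ^ 2 /\
  polar_partial H 1 1 t th = - m * (sin th * cos th) /\
  polar_partial H 0 2 t th = m * cos th ^ 2.
Proof.
  intros Ht m.
  pose proof (polar_partial_ray 2 1 0 H t th HC ltac:(lia) Ht) as R1.
  pose proof (polar_partial_ray 2 0 1 H t th HC ltac:(lia) Ht) as R2.
  pose proof (polar_partial_angle 2 1 0 H t th HC ltac:(lia) Ht) as A1.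
  pose proof (polar_partial_angle 2 0 1 H t th HC ltac:(lia) Ht) as A2.
  pose proof (polar_gradient H Hh elliptic_C1) as G.
  assert (L : locally t (fun u => 0 < u)).
  { exists (mkposreal t Ht). intros u Hu. change (Rabs (u - t) < t) in Hu.
    apply Rabs_lt_between' in Hu. lra. }
  assert (R1' : is_derive (fun u => polar_partial H 1 0 u th) t 0).
  { apply (is_derive_ext_loc (fun _ => grad_x (circ0 H) (circ1 H) th)).
    - revert L. apply filter_imp. intros u Hu. symmetry. now apply G.
    - apply (is_derive_const (K := R_AbsRing) (V := R_NormedModule)). }
  assert (R2' : is_derive (fun u => polar_partial H 0 1 u th) t 0).
  { apply (is_derive_ext_loc (fun _ => grad_y (circ0 H) (circ1 H) th)).
    - revert L. apply filter_imp. intros u Hu. symmetry. now apply G.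
    - apply (is_derive_const (K := R_AbsRing) (V := R_NormedModule)). }
  pose proof (circ0_derive H th elliptic_C1) as D0. pose proof (circ1_derive H th HC) as D1.
  assert (A1' : is_derive (polar_partial H 1 0 t) th (- (circ0 H th + circ2 H th) * sin th)).
  { apply (is_derive_ext (grad_x (circ0 H) (circ1 H))).
    - intros u. symmetry. now apply G.
    - unfold grad_x. auto_derive; [repeat split; eexists; eassumption|].
      derive_rw D0. derive_rw D1. ring. }
  assert (A2' : is_derive (polar_partial H 0 1 t) th ((circ0 H th + circ2 H th) * cos th)).
  { apply (is_derive_ext (grad_y (circ0 H) (circ1 H))).
    - intros u. symmetry. now apply G.
    - unfold grad_y. auto_derive; [repeat split; eexists; eassumption|].
      derive_rw D0. derive_rw D1. ring. }
  apply is_derive_unique in R1, R2, A1, A2, R1', R2', A1', A2'.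
  rewrite R1' in R1. rewrite R2' in R2. rewrite A1' in A1. rewrite A2' in A2.
  set (q := circ0 H th + circ2 H th) in *.
  set (x := polar_partial H 2 0 t th) in *. set (y := polar_partial H 1 1 t th) in *.
  set (z := polar_partial H 0 2 t th) in *.
  pose proof (sin2_cos2 th) as SC. unfold Rsqr in SC.
  set (s := sin th) in *. set (c := cos th) in *.
  assert (Eq : q = m * t) by (unfold m; field; lra).
  assert (F1 : - s * x + c * y = - m * s).
  { apply Rmult_eq_reg_l with t; [|lra]. rewrite <- A1, Eq. ring. }
  assert (F2 : - s * y + c * z = m * c).
  { apply Rmult_eq_reg_l with t; [|lra]. rewrite <- A2, Eq. ring. }
  split; [|split].
  - transitivity (x * (s * s + c * c)); [rewrite SC; ring|].
    transitivity (c * (c * x + s * y) - s * (- s * x + c * y)); [ring|]. rewrite <- R1, F1. ring.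
  - transitivity (y * (s * s + c * c)); [rewrite SC; ring|].
    transitivity (s * (c * x + s * y) + c * (- s * x + c * y)); [ring|]. rewrite <- R1, F1. ring.
  - transitivity (z * (s * s + c * c)); [rewrite SC; ring|].
    transitivity (s * (c * y + s * z) + c * (- s * y + c * z)); [ring|]. rewrite <- R2, F2. ring.
Qed.

Lemma hessian_form t th z1 z2 : 0 < t ->
  partial_derive 2 0 H (t * cos th) (t * sin th) * z1 * z1
  + partial_derive 1 1 H (t * cos th) (t * sin th) * z1 * z2
  + partial_derive 1 1 H (t * cos th) (t * sin th) * z2 * z1
  + partial_derive 0 2 H (t * cos th) (t * sin th) * z2 * z2
  = (circ0 H th + circ2 H th) / t * (- sin th * z1 + cos th * z2) ^ 2.
Proof.
  intros Ht. destruct (polar_hessian t th Ht) as [E1 [E2 E3]]. unfold polar_partial in E1, E2, E3.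
  rewrite E1, E2, E3. ring.
Qed.

Lemma polar_grad t th : 0 < t ->
  grad1 H (t * cos th) (t * sin th) = grad_x (circ0 H) (circ1 H) th /\
  grad2 H (t * cos th) (t * sin th) = grad_y (circ0 H) (circ1 H) th.
Proof.
  intros Ht.
  apply (differentiable_pt_lim_unique _ _ _ _ _ (homogeneous_differentiable H Hh elliptic_C1 t th Ht)).
Qed.

Lemma level_one_frontier x y : H x y = 1 -> frontier2 (unit_ball H) (x, y).
Proof.
  intros E. split; [now apply level_one_closure|]. intros Hi. apply locally_singleton in Hi.
  unfold unit_ball in Hi; simpl in Hi. lra.
Qed.

(** In the tangent direction at a boundary point the Hessian is a nonnegative multiple of
    [h + h'']. *)
Lemma curvature_of_elliptic : uniformly_elliptic H -> forall th, 0 < circ0 H th + circ2 H th.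
Proof.
  intros [l [Hl HE]] th. pose proof (circ_pos H Hh th) as Hp.
  set (t := / circ0 H th). assert (Ht : 0 < t) by (apply Rinv_0_lt_compat; exact Hp).
  assert (E1 : H (t * cos th) (t * sin th) = 1).
  { rewrite (circ_gauge H Hh t th) by lra. unfold t. field. lra. }
  destruct (polar_grad t th Ht) as [G1 G2].
  set (gx := grad_x (circ0 H) (circ1 H) th) in *. set (gy := grad_y (circ0 H) (circ1 H) th) in *.
  specialize (HE (t * cos th) (t * sin th) (- gy) gx (level_one_frontier _ _ E1)).
  rewrite G1, G2 in HE. specialize (HE ltac:(ring)). rewrite hessian_form in HE by exact Ht.
  assert (Hg : 0 < (- gy) ^ 2 + gx ^ 2).
  { assert (Eg : gx * cos th + gy * sin th = circ0 H th).
    { unfold gx, gy, grad_x, grad_y. pose proof (sin2_cos2 th) as SC. unfold Rsqr in SC.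
      transitivity (circ0 H th * (sin th * sin th + cos th * cos th)); [ring|rewrite SC; ring]. }
    destruct (Req_dec gx 0) as [Z|Z].
    - assert (gy <> 0) by (intros Z2; rewrite Z, Z2 in Eg; lra).
      assert (0 < gy ^ 2) by now apply pow2_gt_0. nra.
    - assert (0 < gx ^ 2) by now apply pow2_gt_0. pose proof (pow2_ge_0 gy). nra. }
  apply Rnot_le_lt. intros Hn.
  assert (Hm : (circ0 H th + circ2 H th) / t <= 0).
  { unfold Rdiv. pose proof (Rinv_0_lt_compat t Ht). nra. }
  pose proof (pow2_ge_0 (- sin th * - gy + cos th * gx)). nra.
Qed.

(** On a tangent vector the Hessian is [h + h''] times the square of the component across the
    ray, and that component is a fixed proportion of the length. By compactness the resulting
    factor has a positive minimum over the circle. *)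
Lemma elliptic_of_curvature : (forall th, 0 < circ0 H th + circ2 H th) -> uniformly_elliptic H.
Proof.
  intros Hcu. pose proof (circ_pos H Hh) as Hp. pose proof elliptic_C1 as HC1.
  assert (D0 : forall x, is_derive (circ0 H) x (circ1 H x)) by (intros x; now apply circ0_derive).
  assert (D1 : forall x, is_derive (circ1 H) x (circ2 H x)) by (intros x; now apply circ1_derive).
  assert (K0 : forall x, continuous (circ0 H) x) by (intros x; now apply (continuous_of_derive _ x _ (D0 x))).
  assert (K1 : forall x, continuous (circ1 H) x) by (intros x; now apply (continuous_of_derive _ x _ (D1 x))).
  assert (K2 : forall x, continuous (circ2 H) x) by (intros x; now apply circ2_continuous).
  pose proof (smooth_supported (circ0 H) (circ1 H) (circ2 H) Hp (circ_per H He) D0 D1 Hcu) as Hs.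
  assert (HK : forall x y, continuity_2d_pt H x y).
  { apply (gauge_continuous (circ0 H) (circ1 H)); try assumption. now apply circ_gauge. }
  set (N := fun x => circ0 H x * circ0 H x + circ1 H x * circ1 H x).
  assert (HN : forall x, 0 < N x) by (intros x; pose proof (Hp x); unfold N; nra).
  set (f := fun x => (circ0 H x + circ2 H x) * (circ0 H x * (circ0 H x * circ0 H x)) * / N x).
  destruct (continuity_ab_min f 0 (2 * PI)) as [m [Hm _]].
  { pose proof PI_RGT_0. lra. }
  { intros c _. apply continuity_pt_filterlim. pose proof (K0 c). pose proof (K1 c). pose proof (K2 c).
    assert (KN : continuous (fun x => / N x) c).
    { apply continuous_Rinv_comp; [unfold N; continuous_arith; assumption|].
      pose proof (HN c). lra. }
    change (continuous f c). unfold f. continuous_arith; assumption. }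
  exists (f m). split.
  { unfold f. pose proof (Hcu m). pose proof (Hp m). pose proof (Rinv_0_lt_compat _ (HN m)).
    repeat apply Rmult_lt_0_compat; assumption. }
  intros x y z1 z2 [Hcl Hni] Hz.
  assert (E1 : H x y = 1).
  { apply Rle_antisym; [now apply unit_ball_closure|]. apply Rnot_lt_le. intros L.
    now apply Hni, unit_ball_interior. }
  destruct (polar_coords0 x y) as [t [th [Ht0 [Hth [-> ->]]]]].
  rewrite (circ_gauge H Hh t th) in E1 by exact Ht0.
  assert (Ht : 0 < t) by (destruct Ht0 as [L|<-]; [exact L|lra]).
  destruct (polar_grad t th Ht) as [G1 G2]. rewrite G1, G2 in Hz.
  rewrite hessian_form by exact Ht. pose proof (Hp th) as P.
  replace ((circ0 H th + circ2 H th) / t) with ((circ0 H th + circ2 H th) * circ0 H th).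
  2:{ unfold Rdiv. f_equal. apply Rmult_eq_reg_l with t; [|lra]. rewrite E1. field. lra. }
  apply Rle_trans with (f th * (z1 ^ 2 + z2 ^ 2)).
  { apply Rmult_le_compat_r; [|now apply Hm]. pose proof (pow2_ge_0 z1). pose proof (pow2_ge_0 z2). lra. }
  right.
  (* components of the tangent vector along and across the ray *)
  set (u := cos th * z1 + sin th * z2). set (b := - sin th * z1 + cos th * z2).
  pose proof (sin2_cos2 th) as SC. unfold Rsqr in SC.
  assert (Ez : z1 ^ 2 + z2 ^ 2 = u ^ 2 + b ^ 2).
  { unfold u, b. transitivity ((z1 ^ 2 + z2 ^ 2) * (sin th * sin th + cos th * cos th));
      [rewrite SC; ring|ring]. }
  assert (Eu : u = - (b * circ1 H th) / circ0 H th).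
  { apply Rmult_eq_reg_r with (circ0 H th); [|lra].
    transitivity (- (b * circ1 H th)); [|field; lra].
    unfold u, b. unfold grad_x, grad_y in Hz. lra. }
  rewrite Ez, Eu. pose proof (HN th) as HNt. unfold f. unfold N in *. field.
  split; lra.
Qed.

End Elliptic.

(** * Hoelder regularity of the radius *)

Section HolderGauge.
Context (alpha : R) (Ha : 0 < alpha <= 1).

Lemma holder_quarter_const c : holder_quarter alpha (fun _ => c).
Proof.
  apply (holder_quarter_of_C1 alpha _ (fun _ => 0)); [exact Ha| |].
  - intros x. apply (is_derive_const (K := R_AbsRing) (V := R_NormedModule)).
  - intros x. apply continuous_const.
Qed.

Lemma holder_quarter_opp f : holder_quarter alpha f -> holder_quarter alpha (fun x => - f x).
Proof.
  intros Hf. apply (holder_quarter_ext alpha (fun x => -1 * f x)); [intros x; ring|].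
  apply holder_quarter_mult; [apply holder_quarter_const|exact Hf].
Qed.

Lemma holder_quarter_minus f g : holder_quarter alpha f -> holder_quarter alpha g ->
  holder_quarter alpha (fun x => f x - g x).
Proof. intros Hf Hg. apply holder_quarter_plus; [exact Hf|now apply holder_quarter_opp]. Qed.

Lemma holder_quarter_sin a : holder_quarter alpha (fun x => sin (x + a)).
Proof.
  apply (holder_quarter_of_C1 alpha _ (fun x => cos (x + a))); [exact Ha| |].
  - intros x. auto_derive; [easy|ring].
  - intros x. apply (continuous_comp (fun x => x + a) cos); [|apply continuous_cos].
    apply (continuous_plus (V := R_NormedModule)); [apply continuous_id|apply continuous_const].
Qed.

Lemma holder_quarter_cos a : holder_quarter alpha (fun x => cos (x + a)).
Proof.
  apply (holder_quarter_ext alpha (fun x => sin (x + (a + PI / 2)))); [|apply holder_quarter_sin].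
  intros x. rewrite <- sin_shift, <- sin_PI_x. f_equal. field.
Qed.

Lemma polar_partial_holder_C1 n p q H a : C_n_punctured n H -> (p + q < n)%nat ->
  holder_quarter alpha (fun x => polar_partial H p q 1 (x + a)).
Proof.
  intros HH Hpq.
  set (D := fun x => 1 * (- sin x * polar_partial H (S p) q 1 x + cos x * polar_partial H p (S q) 1 x)).
  apply (holder_quarter_of_C1 alpha _ (fun x => D (x + a))); [exact Ha| |].
  - intros x. pose proof (polar_partial_angle n p q H 1 (x + a) HH Hpq Rlt_0_1) as E.
    fold (D (x + a)) in E. auto_derive; [eexists; exact E|]. derive_rw E. ring.
  - intros x. apply (continuous_comp (fun x => x + a) D).
    + apply (continuous_plus (V := R_NormedModule)); [apply continuous_id|apply continuous_const].
    + unfold D. continuous_arith; apply (polar_partial_continuous n); (assumption || lia || lra).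
Qed.

(** Reduces the Hoelder property of an arithmetic expression to its atoms, following its
    syntax. *)
Ltac holder_arith :=
  lazymatch goal with
  | |- holder_quarter _ (fun _ => ?c) => apply (holder_quarter_const c)
  | |- holder_quarter _ (fun x => sin (x + _)) => apply holder_quarter_sin
  | |- holder_quarter _ (fun x => cos (x + _)) => apply holder_quarter_cos
  | |- holder_quarter _ (fun x => - @?f x) => apply (holder_quarter_opp f); holder_arith
  | |- holder_quarter _ (fun x => @?f x + @?g x) =>
      apply (holder_quarter_plus alpha f g); holder_arith
  | |- holder_quarter _ (fun x => @?f x - @?g x) =>
      apply (holder_quarter_minus f g); holder_arith
  | |- holder_quarter _ (fun x => @?f x * @?g x) =>
      apply (holder_quarter_mult alpha f g); holder_arith
  | |- _ => idtac
  end.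

Lemma circ3_holder H a : C_n_alpha_loc_punctured 3 alpha H ->
  holder_quarter alpha (fun x => circ3 H (x + a)).
Proof.
  intros HH. pose proof HH as [HC _].
  assert (K : forall p q, (p + q <= 3)%nat ->
    holder_quarter alpha (fun x => polar_partial H p q 1 (x + a))).
  { intros p q Hpq. destruct (Nat.eq_dec (p + q) 3) as [E|E].
    - now apply (polar_partial_holder 3).
    - apply (polar_partial_holder_C1 3); [exact HC|lia]. }
  unfold circ3. holder_arith; apply K; lia.
Qed.

Lemma rad3_holder (h h1 h2 h3 : R -> R) : (forall x, 0 < h x) ->
  (forall x, is_derive h x (h1 x)) -> (forall x, is_derive h1 x (h2 x)) ->
  (forall x, is_derive h2 x (h3 x)) -> (forall x, continuous h3 x) ->
  holder_quarter alpha h3 -> holder_quarter alpha (rad3 h h1 h2 h3).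
Proof.
  intros Hp D0 D1 D2 C3 K3.
  assert (C1 : forall x, continuous h1 x) by (intros x; apply (continuous_of_derive _ x _ (D1 x))).
  assert (C2 : forall x, continuous h2 x) by (intros x; apply (continuous_of_derive _ x _ (D2 x))).
  assert (K1 : holder_quarter alpha h1) by now apply (holder_quarter_of_C1 alpha h1 h2).
  assert (K2 : holder_quarter alpha h2) by now apply (holder_quarter_of_C1 alpha h2 h3).
  assert (Kr : holder_quarter alpha (rad0 h)).
  { apply (holder_quarter_of_C1 alpha _ (rad1 h h1)); [exact Ha| |].
    - intros x. now apply rad0_derive.
    - intros x. apply (continuous_of_derive _ x (rad2 h h1 h2 x)). now apply rad1_derive. }
  apply (holder_quarter_ext alpha (fun x => - h3 x * (rad0 h x * rad0 h x)
    + 6 * (h1 x * h2 x) * (rad0 h x * (rad0 h x * rad0 h x))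
    - 6 * (h1 x * (h1 x * h1 x)) * ((rad0 h x * rad0 h x) * (rad0 h x * rad0 h x)))).
  { intros x. unfold rad3, rad0. pose proof (Hp x). field. lra. }
  holder_arith; assumption.
Qed.

End HolderGauge.

(** * Third-order regularity *)

(** Ellipticity replaces strict convexity as the source of the supporting lines. In the other
    direction a set built from a quarter is a Radon curve, and its involution gives back
    the positive curvature. *)
Lemma elliptic_S_iff_quarter (alpha : R) (H : R -> R -> R) :
  0 < alpha <= 1 -> pos_homogeneous H -> even2 H -> C_n_alpha_loc_punctured 3 alpha H ->
  (uniformly_elliptic H /\ condition_S H <->
   exists (r : R -> R) (rs : R),
     pos_on_quarter r /\ C_n_alpha_in quarter 3 alpha r /\ 1 <= rs /\ boundary_cond r rs /\
     (forall theta : R, quarter theta -> curvature_ineq r theta) /\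
     d_quarter 2 r (PI / 2) = - (rs * d_quarter 2 r 0) / (1 - d_quarter 2 r 0) /\
     d_quarter 3 r (PI / 2) = - (rs * d_quarter 3 r 0) / (1 - d_quarter 2 r 0) ^ 3 /\
     similar_to (unit_ball H) (polar_set (rtilde r rs))).
Proof.
  intros Hal Hh He HCa. pose proof HCa as [HC3 _].
  assert (HC2 : C_n_punctured 2 H) by (apply (punctured_le 3); [lia|exact HC3]).
  assert (HC1 : C_n_punctured 1 H) by (apply (punctured_le 2); [lia|exact HC2]).
  pose proof (circ_pos H Hh) as Hp. pose proof (circ_per H He) as Hper.
  assert (D0 : forall x, is_derive (circ0 H) x (circ1 H x)) by (intros x; now apply circ0_derive).
  assert (D1 : forall x, is_derive (circ1 H) x (circ2 H x)) by (intros x; now apply circ1_derive).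
  assert (D2 : forall x, is_derive (circ2 H) x (circ3 H x)) by (intros x; now apply circ2_derive).
  split.
  - intros [Hell HS].
    pose proof (curvature_of_elliptic H Hh HC2 Hell) as Hcu.
    pose proof (smooth_supported _ _ _ Hp Hper D0 D1 Hcu) as Hs.
    pose proof (conj_involution_of_S H Hh He HC1 Hs HS) as Hinv.
    destruct (max_angle (circ0 H) (circ0_continuous H HC1) Hper) as [a Ha].
    destruct (nrm_quarter_data H Hh HC2 Hinv a Ha) as [B1 [B2 [B3 [B4 B5]]]].
    pose proof (nrm_pos H Hh a) as Np.
    pose proof (nrm_derive0 H HC2 a) as N0. pose proof (nrm_derive1 H HC2 a) as N1.
    assert (N2 : forall x, is_derive (nrm H a (circ2 H)) x (nrm H a (circ3 H) x))
      by (intros x; apply derive_shift, D2).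
    assert (N3 : forall x, continuous (nrm H a (circ3 H)) x)
      by (intros x; now apply continuous_shift, circ3_continuous).
    destruct (rad_compat _ _ _ _ Np N0 N1 N2 (nrm_inv H Hh Hinv a) (nrm_0 H Hh a)
      (nrm1_0 H Hh HC2 a Ha)) as [E2 E3].
    exists (nrad H a), (nrs H a).
    split; [exact B1|]. split.
    { split; [now apply (rad_C3 _ _ _ _ Np N0 N1 N2 N3)|].
      assert (K : holder_quarter alpha (rad3 (nrm H a (circ0 H)) (nrm H a (circ1 H))
        (nrm H a (circ2 H)) (nrm H a (circ3 H)))).
      { apply rad3_holder; try assumption.
        apply (holder_quarter_mult alpha (fun _ => _)).
        - now apply holder_quarter_const.
        - now apply circ3_holder. }
      destruct K as [C [_ [_ K]]]. exists C. intros x y Hx Hy Hne.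
      change (Derive_n_in quarter 3 (nrad H a)) with (d_quarter 3 (rad0 (nrm H a (circ0 H)))).
      rewrite !(rad_d3 _ _ _ _ Np N0 N1 N2) by assumption. now apply K. }
    split; [exact B2|]. split; [exact B3|]. split; [exact B4|]. split; [exact E2|].
    split; [exact E3|]. now apply nrm_similar.
  - intros [r [rs [Hpos [[[Hd Hc] _] [Hrs [Hb [Hcu [_ [_ Hsim]]]]]]]]].
    assert (Hr2 : C_n_in quarter 2 r).
    { split; [intros k x Hk; apply Hd; lia|].
      intros x Hx. destruct (Hd 2%nat x ltac:(lia) Hx) as [l Hl].
      apply (cont_deriv _ (fun _ => l)). exact Hl. }
    destruct (radon_of_quarter r rs Hpos Hr2 (ae_of_everywhere _ _ Hcu) Hrs Hb)
      as [_ [_ [g [dg [HR E]]]]].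
    destruct (shift_of_similar H (circ0 H) g (rtilde r rs) (circ_gauge H Hh) Hp
      (radon_pos _ _ _ HR) (radon_per _ _ _ HR) E Hsim) as [s [a [Hs Eh]]].
    pose proof (radon_ext _ _ _ _ _ Eh D0 (radon_shift g dg rs s a Hs HR)) as HRH.
    split.
    + apply elliptic_of_curvature; try assumption.
      apply (curvature_pos (circ0 H) (circ1 H) (circ2 H)); try assumption.
      apply (radon_inv _ _ _ HRH).
    + apply (radon_condition_S _ _ _ HRH H (circ_gauge H Hh)).
Qed.

Theorem proposition1p3 :
  (forall (r : R -> R) (rs : R),
     pos_on_quarter r ->
     C_n_in quarter 2 r ->
     ae_in quarter (curvature_ineq r) ->
     1 <= rs ->
     boundary_cond r rs ->
     (forall eta : R, quarter eta -> PI / 2 <= tau r eta <= PI) /\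
     (forall theta : R, PI / 2 <= theta <= PI ->
        exists! eta : R, quarter eta /\ tau r eta = theta) /\
     class_C1 (rtilde r rs) /\
     strictly_convex (polar_set (rtilde r rs)) /\
     (exists H : R -> R -> R,
        polar_gauge (rtilde r rs) H /\ condition_S H))
  /\
  (forall H : R -> R -> R,
     pos_homogeneous H ->
     even2 H ->
     C_n_punctured 2 H ->
     strictly_convex (unit_ball H) ->
     condition_S H ->
     exists (r : R -> R) (rs : R),
       pos_on_quarter r /\
       C_n_in quarter 2 r /\
       ae_in quarter (curvature_ineq r) /\
       1 <= rs /\
       boundary_cond r rs /\
       similar_to (unit_ball H) (polar_set (rtilde r rs)))
  /\
  (forall (alpha : R) (H : R -> R -> R),
     0 < alpha <= 1 ->
     pos_homogeneous H ->
     even2 H ->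
     C_n_alpha_loc_punctured 3 alpha H ->
     (uniformly_elliptic H /\ condition_S H <->
      exists (r : R -> R) (rs : R),
        pos_on_quarter r /\
        C_n_alpha_in quarter 3 alpha r /\
        1 <= rs /\
        boundary_cond r rs /\
        (forall theta : R, quarter theta -> curvature_ineq r theta) /\
        d_quarter 2 r (PI / 2)
          = - (rs * d_quarter 2 r 0) / (1 - d_quarter 2 r 0) /\
        d_quarter 3 r (PI / 2)
          = - (rs * d_quarter 3 r 0) / (1 - d_quarter 2 r 0) ^ 3 /\
        similar_to (unit_ball H) (polar_set (rtilde r rs)))).
Proof.
  split; [exact quarter_construction|]. split; [exact quarter_of_gauge|].
  exact elliptic_S_iff_quarter.
Qed.
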